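(* Let $U\in\mathcal{F}_d$ be unitary. If $\mathcal{F}_d^{\lambda_U}=\mathbb{C}1$, then $\mathcal{O}_d^{\lambda_U}=\mathbb{C}1$; and if $\mathcal{N}^{\lambda_U}=\mathbb{C}1$, then $\mathcal{M}^{\lambda_U}=\mathbb{C}1$.
   Context: Let $d\ge 2$. $\mathcal{O}_d$ is the Cuntz algebra generated by isometries $S_1,\dots,S_d$ with $S_i^*S_j=\delta_{ij}1$, $\sum_iS_iS_i^*=1$. $\mathcal{F}_d$ is the norm closure of $\bigcup_n\mathcal{F}_d^n$, where $\mathcal{F}_d^n=\mathrm{span}\{S_\mu S_\nu^*:|\mu|=|\nu|=n\}\cong M_d^{\otimes n}$. A unitary $u\in\mathcal{O}_d$ defines the unital endomorphism $\lambda_u$ of $\mathcal{O}_d$ with $\lambda_u(S_i)=uS_i$; if $u\in\mathcal{F}_d$ then $\lambda_u(\mathcal{F}_d)\subset\mathcal{F}_d$. $\tau$ is the normalized trace on $\mathcal{F}_d$, $E^0(x)=\frac1{2\pi}\int_0^{2\pi}\lambda_{e^{it}1}(x)\,dt$, $\omega=\tau\circ E^0$, $\mathcal{M}=\pi_\omega(\mathcal{O}_d)''$, $\mathcal{N}=\pi_\omega(\mathcal{F}_d)''$ ($\pi_\omega$ the faithful GNS representation). For unitary $u\in\mathcal{F}_d$, $\lambda_u$ extends to a normal $\omega$-preserving endomorphism of $\mathcal{M}$ leaving $\mathcal{N}$ invariant. For an algebra $A$ invariant under $\lambda_U$, $A^{\lambda_U}=\{x\in A:\lambda_U(x)=x\}$.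 *)

(* Defs.v *)
From HB Require Import structures.
From mathcomp Require Import all_boot all_order all_algebra.
From mathcomp Require Import complex.
From mathcomp Require Import all_classical all_reals all_analysis.

Set Implicit Arguments.
Unset Strict Implicit.
Unset Printing Implicit Defensive.

Import Order.TTheory GRing.Theory Num.Theory.
Import numFieldNormedType.Exports.

Local Open Scope classical_set_scope.
Local Open Scope ring_scope.
Local Open Scope complex_scope.

(** Unital C*-algebras and Hilbert spaces over R[i], the complex numbers.
    Norms take their values in R[i], on its nonnegative real half-line. *)

(* The product is a field of the structure, and the ring and algebra structures
   are derived below: a structure extending both NormedModule and Algebra would
   be a missing join below NumDomain in the MathComp hierarchy. *)
HB.mixin Record isCStarAlgebra (R : realType) A
    & CompleteNormedModule R[i] A := {
  cmul : A -> A -> A ;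
  cone : A ;
  star : A -> A ;
  cmulA : associative cmul ;
  cmul1l : left_id cone cmul ;
  cmul1r : right_id cone cmul ;
  cmulDl : left_distributive cmul +%R ;
  cmulDr : right_distributive cmul +%R ;
  cone_neq0 : cone != 0 ;
  cmulZl : forall (c : R[i]) x y, c *: cmul x y = cmul (c *: x) y ;
  cmulZr : forall (c : R[i]) x y, c *: cmul x y = cmul x (c *: y) ;
  starK : involutive star ;
  starD : {morph star : x y / x + y} ;
  starZ : forall (c : R[i]) x, star (c *: x) = c^* *: star x ;
  starM : forall x y, star (cmul x y) = cmul (star y) (star x) ;
  cstar_normM : forall x y : A, `|cmul x y| <= `|x| * `|y| ;
  cstar_normE : forall x : A, `|cmul (star x) x| = `|x| ^+ 2
}.

#[short(type="cstarAlgType")]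
HB.structure Definition CStarAlgebra (R : realType) :=
  {A of CompleteNormedModule R[i] A & isCStarAlgebra R A}.

Section CStarRing.
Variables (R : realType) (A : cstarAlgType R).

HB.instance Definition _ := GRing.Zmodule_isNzRing.Build A
  (@cmulA R A) (@cmul1l R A) (@cmul1r R A) (@cmulDl R A) (@cmulDr R A)
  (@cone_neq0 R A).
HB.instance Definition _ :=
  GRing.Lmodule_isLalgebra.Build R[i] A (@cmulZl R A).
HB.instance Definition _ :=
  GRing.Lalgebra_isAlgebra.Build R[i] A (@cmulZr R A).

End CStarRing.

(* The inner product is linear in its first argument. *)
HB.mixin Record isHilbert (R : realType) H & CompleteNormedModule R[i] H := {
  inner : H -> H -> R[i] ;
  inner_linear : forall (c : R[i]) x y z,
    inner (c *: x + y) z = c * inner x z + inner y z ;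
  inner_conj : forall x y, inner y x = (inner x y)^* ;
  inner_norm : forall x : H, inner x x = `|x| ^+ 2
}.

#[short(type="hilbertType")]
HB.structure Definition Hilbert (R : realType) :=
  {H of CompleteNormedModule R[i] H & isHilbert R H}.

Section CStarAlgebras.
Variable R : realType.

Definition unitary (A : cstarAlgType R) (u : A) : Prop :=
  star u * u = 1 /\ u * star u = 1.

Definition unital_star_hom (A B : cstarAlgType R) (f : A -> B) : Prop :=
  [/\ linear f, monoid_morphism f & forall x, f (star x) = star (f x)].

Definition closed_star_subalgebra (A : cstarAlgType R) (X : set A) : Prop :=
  [/\ closed X,
      forall (c : R[i]) x y, X x -> X y -> X (c *: x + y),
      forall x y, X x -> X y -> X (x * y) &
      forall x, X x -> X (star x)].

Definition scalars (A : cstarAlgType R) : set A :=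
  range (fun c : R[i] => c%:A).

End CStarAlgebras.

Arguments scalars {R} A.

Definition fixed_points (T : Type) (X : set T) (f : T -> T) : set T :=
  [set x | X x /\ f x = x].

Section RiemannIntegral.
Variables (R : realType) (V : normedModType R[i]).

(* I is the integral of f over [a, b], as the norm limit of the Riemann sums
   of tagged partitions a = p 0 <= s 0 <= p 1 <= ... <= p n = b. *)
Definition is_riemann_integral (f : R -> V) (a b : R) (I : V) : Prop :=
  forall eps : R, 0 < eps -> exists2 delta : R, 0 < delta &
    forall (n : nat) (p s : nat -> R), p 0%N = a -> p n = b ->
      (forall i, (i < n)%N ->
         p i <= s i <= p i.+1 /\ p i.+1 - p i < delta) ->
      `|\sum_(0 <= i < n) (p i.+1 - p i)%:C *: f (s i) - I| < eps%:C.

Definition riemann_integral (f : R -> V) (a b : R) : V :=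
  xget 0 [set I | is_riemann_integral f a b I].

End RiemannIntegral.

Section Cuntz.
Variables (R : realType) (d : nat).

Definition cuntz_relations (B : cstarAlgType R) (T : 'I_d -> B) : Prop :=
  (forall i j, star (T i) * T j = (i == j)%:R) /\
  \sum_i T i * star (T i) = 1.

(* A, with generators S, is the Cuntz algebra: the universal C*-algebra
   generated by elements satisfying the relations. *)
Definition is_cuntz_algebra (A : cstarAlgType R) (S : 'I_d -> A) : Prop :=
  [/\ cuntz_relations S,
      forall X, closed_star_subalgebra X -> (forall i, X (S i)) -> X = setT &
      forall (B : cstarAlgType R) (T : 'I_d -> B), cuntz_relations T ->
        exists2 f : A -> B, unital_star_hom f & forall i, f (S i) = T i].

Variables (A : cstarAlgType R) (S : 'I_d -> A).

Definition word n (mu : n.-tuple 'I_d) : A := \prod_(i <- mu) S i.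

Definition core_level (n : nat) : set A :=
  [set x | exists c : n.-tuple 'I_d -> n.-tuple 'I_d -> R[i],
     x = \sum_mu \sum_nu c mu nu *: (word mu * star (word nu))].

Definition core : set A := closure (\bigcup_n core_level n).

(* In a Cuntz algebra, this endomorphism exists by universality when u is
   unitary, and is unique since it is determined on generators. *)
Definition is_cuntz_endo (u : A) (f : A -> A) : Prop :=
  unital_star_hom f /\ forall i, f (S i) = u * S i.

Definition cuntz_endo (u : A) : A -> A := xget (id : A -> A) [set f | is_cuntz_endo u f].

(* The UHF algebra [core] has a unique tracial state. Only values on [core]
   are constrained. *)
Definition is_normalized_trace (t : A -> R[i]) : Prop :=
  [/\ forall (c : R[i]) x y, core x -> core y ->
        t (c *: x + y) = c * t x + t y,
      forall x, core x -> 0 <= t (star x * x),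
      forall x y, core x -> core y -> t (x * y) = t (y * x) &
      t 1 = 1].

Definition core_trace : A -> R[i] :=
  xget ((fun=> 0) : A -> R[i]) [set t | is_normalized_trace t].

Definition expi (t : R) : R[i] := cos t +i* sin t.

Definition E0 (x : A) : A :=
  ((2 * pi)^-1)%:C *:
    riemann_integral (fun t => cuntz_endo (expi t)%:A x) 0 (2 * pi).

Definition omega (x : A) : R[i] := core_trace (E0 x).

End Cuntz.

Section Operators.
Variables (R : realType) (H : hilbertType R).
Implicit Types (X Y T : H -> H) (D M : set (H -> H)).

Definition bounded_operator T : Prop := linear T /\ continuous T.

Definition adjoint_of X Y : Prop :=
  forall xi eta : H, inner (X xi) eta = inner xi (Y eta).

Definition commutant D : set (H -> H) :=
  [set T | bounded_operator T /\ forall X, D X -> T \o X = X \o T].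

Definition bicommutant D : set (H -> H) := commutant (commutant D).

Definition operator_scalars : set (H -> H) :=
  range (fun (c : R[i]) (xi : H) => c *: xi).

(* The order of R[i] makes [X <= Y] say that Y - X is a positive operator. *)
Definition operator_le X Y : Prop :=
  forall xi : H, inner (X xi) xi <= inner (Y xi) xi.

Definition self_adjoint_part M : set (H -> H) :=
  [set T | M T /\ adjoint_of T T].

Definition is_operator_sup M D T : Prop :=
  [/\ self_adjoint_part M T, forall X, D X -> operator_le X T &
      forall Y, self_adjoint_part M Y ->
        (forall X, D X -> operator_le X Y) -> operator_le T Y].

Definition upward_directed D : Prop :=
  D !=set0 /\ forall X Y, D X -> D Y ->
    exists Z, [/\ D Z, operator_le X Z & operator_le Y Z].

Definition star_endomorphism M (L : (H -> H) -> H -> H) : Prop :=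
  [/\ forall X, M X -> M (L X),
      forall (c : R[i]) X Y, M X -> M Y ->
        L (fun xi => c *: X xi + Y xi) = (fun xi => c *: L X xi + L Y xi),
      forall X Y, M X -> M Y -> L (X \o Y) = L X \o L Y &
      forall X Y, M X -> M Y -> adjoint_of X Y -> adjoint_of (L X) (L Y)].

(* Normality: L preserves suprema of bounded increasing nets. *)
Definition normal M (L : (H -> H) -> H -> H) : Prop :=
  forall D T, D `<=` self_adjoint_part M -> upward_directed D ->
    is_operator_sup M D T -> is_operator_sup M (L @` D) (L T).

Variable A : cstarAlgType R.
Implicit Type rho : A -> H -> H.

Definition star_representation rho : Prop :=
  [/\ forall a, bounded_operator (rho a),
      forall (c : R[i]) a b xi,
        rho (c *: a + b) xi = c *: rho a xi + rho b xi,
      forall a b, rho (a * b) = rho a \o rho b,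
      rho 1 = id &
      forall a, adjoint_of (rho a) (rho (star a))].

Definition is_GNS (phi : A -> R[i]) rho (Omega : H) : Prop :=
  [/\ star_representation rho,
      forall a, phi a = inner (rho a Omega) Omega &
      closure (range (fun a => rho a Omega)) = setT].

End Operators.

Arguments operator_scalars {R} H.

Section ExtendedEndomorphism.
Variables (R : realType) (d : nat) (A : cstarAlgType R) (S : 'I_d -> A).
Variables (H : hilbertType R) (rho : A -> H -> H) (Omega : H).

Definition vN_M : set (H -> H) := bicommutant (range rho).
Definition vN_N : set (H -> H) := bicommutant (rho @` core S).

(* L is meaningful on [vN_M] only; the vector state of Omega extends omega. *)
Definition is_normal_extension (u : A) (L : (H -> H) -> H -> H) : Prop :=
  [/\ star_endomorphism vN_M L,
      normal vN_M L,
      forall a, L (rho a) = rho (cuntz_endo S u a),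
      forall X, vN_M X -> inner (L X Omega) Omega = inner (X Omega) Omega &
      L @` vN_N `<=` vN_N].

End ExtendedEndomorphism.

(* Main.v *)
Require Import Defs.
From HB Require Import structures.
From mathcomp Require Import all_boot all_order all_algebra.
From mathcomp Require Import complex.
From mathcomp Require Import all_classical all_reals all_analysis.
From mathcomp Require Import zify ring lra.

Set Implicit Arguments.
Unset Strict Implicit.
Unset Printing Implicit Defensive.

Import Order.TTheory GRing.Theory Num.Theory.
Import numFieldNormedType.Exports.

Local Open Scope classical_set_scope.
Local Open Scope ring_scope.
Local Open Scope complex_scope.

(** Proposition (ergodicity of lambda_U on the core forces ergodicity on the whole
    algebra).  The endomorphism lambda = lambda_U commutes with the gauge action,
    because U is gauge invariant.  A fixed point therefore has fixed spectral
    components, so it is enough to see that a fixed element x of degree k <> 0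
    vanishes.  Both x^* x and x x^* are fixed of degree 0, hence scalars c and c'
    by hypothesis, and c = c' unless x = 0.  But a trace scales these two products
    by different powers of d: for the gauge-invariant state omega,
    omega (x x^* ) = d^(-k) omega (x^* x).  So c = 0 and x = 0.

    The gauge action enters through one automorphism only, [gauge], the one of the
    point w = (3 + 4i) / 5, which has infinite order on the circle
    ([wc_exp_neq1]).  The component of degree k is then the mean ergodic limit of
    w^(-kl) gauge^l ([fourier]), the degree 0 part of the Cuntz algebra is the core
    ([degree0_core]), and the expectation E0 given by a Riemann integral is the
    component of degree 0 ([E0_fourier]).

    In the Cuntz algebra, an element all of whose components of nonzero degree
    vanish lies in the core because its Fejer means converge to it
    ([fejer_conv], [fourier0_only]).  The scaling argument uses, in place of the
    trace, the contractions y |-> d^-1 sum_i S_i^* y S_i, whose n-th iterate is the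
    normalized trace on the matrix algebra of level n ([shift_mean_trace],
    [homogeneous_scalar_eq0]).

    For the von Neumann algebras everything is read off vectors.  The trace
    property determines omega on the products S_mu S_nu^* and gives the KMS relation
    omega (S_i b) = d^-1 omega (b S_i) ([om_kms]).  It makes right multiplication by
    S_i and S_i^* bounded, which produces enough operators in the commutant of the
    representation for Omega to separate M ([vN_M_separating]) and for the KMS
    relation to extend to M ([vN_M_kms]).  The automorphism [gauge] is implemented
    by a unitary V; the components of an element of M are strong limits of averages
    of V^l X V^(-l) and stay in M ([component_exists]); an element of M of degree 0
    lies in N ([vN_N_degree0]); and the KMS relation gives
    d^(k/2) |X^* Omega| <= |X Omega| for X in M of degree k ([vN_M_adjoint_nrm]),
    which is the scaling argument again ([fixed_positive_degree]).

    Three facts of general theory are proved on the way: unital star-homomorphisms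
    and star-representations are contractive ([star_hom_contractive],
    [rep_contractive]), and bounded operators of a Hilbert space have adjoints
    ([adjoint_exists]). *)

(** * The real-valued norm and limits of sequences *)

Section RealNorm.
Variables (R : realType) (V : normedModType R[i]).
Implicit Types (x y : V) (u v : nat -> V).

(** The norm takes values in the partially ordered field R[i]; estimates are made
    with its real part, which loses nothing ([nrmC]). *)
Definition nrm x : R := complex.Re `|x|.

Lemma nrmC x : `|x| = (nrm x)%:C.
Proof. by rewrite /nrm RRe_real // ger0_real. Qed.

Lemma nrm_ge0 x : 0 <= nrm x.
Proof. by rewrite -ler0c -nrmC. Qed.

Lemma nrm_le x (r : R) : (nrm x <= r) = (`|x| <= r%:C).
Proof. by rewrite nrmC lecR. Qed.

Lemma nrm_lt x (r : R) : (nrm x < r) = (`|x| < r%:C).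
Proof. by rewrite nrmC ltcR. Qed.

Lemma nrm0 : nrm 0 = 0.
Proof. by rewrite /nrm normr0. Qed.

Lemma nrm_eq0 x : nrm x = 0 -> x = 0.
Proof. by move=> x0; apply/eqP; rewrite -normr_eq0 nrmC x0. Qed.

Lemma nrmN x : nrm (- x) = nrm x.
Proof. by rewrite /nrm normrN. Qed.

Lemma nrmB x y : nrm (x - y) = nrm (y - x).
Proof. by rewrite -nrmN opprB. Qed.

Lemma nrmD x y : nrm (x + y) <= nrm x + nrm y.
Proof. by rewrite nrm_le rmorphD /= -!nrmC ler_normD. Qed.

Lemma nrm_sum (I : Type) (r : seq I) (P : pred I) (F : I -> V) :
  nrm (\sum_(i <- r | P i) F i) <= \sum_(i <- r | P i) nrm (F i).
Proof.
elim/big_rec2: _ => [|i a b _ ab]; first by rewrite nrm0.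
by rewrite (le_trans (nrmD _ _)) // lerD2l.
Qed.

Lemma nrm_dist x y z : nrm (x - z) <= nrm (x - y) + nrm (y - z).
Proof. by apply: le_trans (nrmD _ _); rewrite addrA subrK. Qed.

Lemma nrm_le_small x (a : R) : (forall e : R, 0 < e -> nrm x <= a + e) -> nrm x <= a.
Proof. by move=> h; apply/ler_addgt0Pr. Qed.

Lemma nrm_small_eq0 x : (forall e : R, 0 < e -> nrm x <= e) -> x = 0.
Proof.
move=> h; apply: nrm_eq0; apply/eqP; rewrite eq_le nrm_ge0 andbT.
by apply: nrm_le_small => e e0; rewrite add0r h.
Qed.

Definition conv u x : Prop :=
  forall e : R, 0 < e -> exists N, forall n, (N <= n)%N -> nrm (u n - x) < e.

Lemma conv_cst x : conv (fun=> x) x.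
Proof. by move=> e e0; exists 0%N => n _; rewrite subrr nrm0. Qed.

Lemma conv_eventually u v x N :
  (forall n, (N <= n)%N -> u n = v n) -> conv u x -> conv v x.
Proof.
move=> uv ux e /ux[M h]; exists (maxn N M) => n; rewrite geq_max => /andP[n1 n2].
by rewrite -uv // h.
Qed.

Lemma convD u v x y : conv u x -> conv v y -> conv (fun n => u n + v n) (x + y).
Proof.
move=> ux vy e e0; have e2 : 0 < e / 2 by rewrite divr_gt0.
have [N1 h1] := ux _ e2; have [N2 h2] := vy _ e2.
exists (maxn N1 N2) => n; rewrite geq_max => /andP[/h1 a /h2 b].
rewrite opprD addrACA (le_lt_trans (nrmD _ _)) //; lra.
Qed.

Lemma conv_le u x (C : R) : conv u x -> (forall n, nrm (u n) <= C) -> nrm x <= C.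
Proof.
move=> ux uC; apply: nrm_le_small => e e0; have [N /(_ N (leqnn N)) h] := ux e e0.
have := nrmD (x - u N) (u N); rewrite subrK (nrmB x); move: (uC N) h; lra.
Qed.

Lemma conv_unique u x y : conv u x -> conv u y -> x = y.
Proof.
move=> ux uy; apply/eqP; rewrite -subr_eq0; apply/eqP.
apply: nrm_small_eq0 => e e0; have e2 : 0 < e / 2 by rewrite divr_gt0.
have [N1 h1] := ux _ e2; have [N2 h2] := uy _ e2.
have := h1 _ (leq_maxl N1 N2); have := h2 _ (leq_maxr N1 N2).
have := nrm_dist x (u (maxn N1 N2)) y; rewrite (nrmB x (u _)); lra.
Qed.

Lemma closure_nrmP (X : set V) x :
  closure X x <-> forall e : R, 0 < e -> exists2 y, X y & nrm (y - x) < e.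
Proof.
split=> [cX e e0|h B].
  have /cX[y [Xy yB]] : nbhs x [set y | `|x - y| < e%:C].
    by apply/nbhs_normP; exists e%:C => //=; rewrite ltcR.
  by exists y => //; rewrite nrmB nrm_lt.
move=> /nbhs_normP[e /= e0 eB].
have eE : e = (complex.Re e)%:C by rewrite RRe_real // gtr0_real.
have /h[y Xy yx] : 0 < complex.Re e by rewrite -ltcR -eE.
by exists y; split => //; apply: eB => /=; rewrite eE -nrm_lt nrmB.
Qed.

Lemma closed_conv (X : set V) u x : closed X -> (forall n, X (u n)) -> conv u x -> X x.
Proof.
move=> cX Xu ux; apply: cX; apply/closure_nrmP => e /ux[N h].
by exists (u N) => //; exact: h.
Qed.

Lemma closed_nrm (X : set V) :
  (forall x, (forall e : R, 0 < e -> exists2 y, X y & nrm (y - x) < e) -> X x) ->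
  closed X.
Proof. by move=> h x /closure_nrmP/h. Qed.

Lemma closure_seq (X : set V) x :
  closure X x -> exists2 u, (forall n, X (u n)) & conv u x.
Proof.
move=> /closure_nrmP cX.
have /choice[u hu] n : exists y, X y /\ nrm (y - x) < n.+1%:R^-1.
  have [|y ? ?] := cX n.+1%:R^-1; first by rewrite invr_gt0.
  by exists y.
exists u => [n|e e0]; first by case: (hu n).
have [N _ hN] := near_infty_natSinv_lt (PosNum e0).
by exists N => n Nn; apply: lt_trans (hN n Nn); case: (hu n).
Qed.

End RealNorm.

Section Modulus.
Variable R : realType.
Implicit Types c : R[i].

Definition cabs c : R := nrm (c : R[i]^o).

Lemma cabsE c : `|c| = (cabs c)%:C.
Proof. exact: (nrmC (c : R[i]^o)). Qed.

Lemma nrmZ (V : normedModType R[i]) c (x : V) : nrm (c *: x) = cabs c * nrm x.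
Proof. by rewrite {1}/nrm normrZ nrmC cabsE -rmorphM. Qed.

Lemma cabsM c c' : cabs (c * c') = cabs c * cabs c'.
Proof. exact: (nrmZ c (c' : R[i]^o)). Qed.

Lemma cabs_sqr c : (cabs c ^+ 2)%:C = c * conjc c.
Proof. by rewrite rmorphXn /= -cabsE; exact: normCK. Qed.

Lemma cabs_conj c : cabs (conjc c) = cabs c.
Proof. by apply: complexI; rewrite -!cabsE; exact: norm_conjC. Qed.

Lemma cabs_real (r : R) : 0 <= r -> cabs r%:C = r.
Proof. by move=> r0; apply: complexI; rewrite -cabsE ger0_norm // ler0c. Qed.

Lemma cabs1 : cabs 1 = 1.
Proof. exact: (@cabs_real 1 ler01). Qed.

Lemma cabsX c n : cabs (c ^+ n) = cabs c ^+ n.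
Proof. by elim: n => [|n IH]; rewrite ?expr0 ?cabs1 // !exprS cabsM IH. Qed.

Lemma cabsV c : cabs c^-1 = (cabs c)^-1.
Proof. by apply: complexI; rewrite fmorphV -!cabsE normfV. Qed.

Lemma realC_natV n : (n%:R^-1 : R[i]) = (n%:R^-1 : R)%:C.
Proof. by rewrite fmorphV rmorph_nat. Qed.

Lemma cabs_natV n : cabs (n%:R^-1) = n%:R^-1.
Proof. by rewrite realC_natV cabs_real // invr_ge0. Qed.

Lemma conjcX c n : conjc (c ^+ n) = conjc c ^+ n.
Proof. by elim: n => [|n IH]; rewrite ?conjc1 // !exprS rmorphM /= IH. Qed.

Lemma half_add : 2^-1 + 2^-1 = 1 :> R[i].
Proof. by rewrite -mulr2n -[LHS]mulr_natr mulVf // pnatr_eq0. Qed.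

End Modulus.

Section Scalars.
Variables (R : realType) (V : normedModType R[i]).
Implicit Types (x y : V) (u : nat -> V).

Lemma nrmZr (r : R) x : 0 <= r -> nrm (r%:C *: x) = r * nrm x.
Proof. by move=> r0; rewrite nrmZ cabs_real. Qed.

Lemma convZ (c : R[i]) u x : conv u x -> conv (fun n => c *: u n) (c *: x).
Proof.
move=> ux e e0.
have c1 : 0 < cabs c + 1 by rewrite ltr_wpDl // nrm_ge0.
have [|N h] := ux (e / (cabs c + 1)); first by rewrite divr_gt0.
exists N => n /h; rewrite ltr_pdivlMr // => hn.
rewrite -scalerBr nrmZ; have := nrm_ge0 (u n - x).
by move=> ?; apply: le_lt_trans hn; rewrite mulrC; nra.
Qed.

End Scalars.

Section Complete.
Variables (R : realType) (V : completeNormedModType R[i]).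

Lemma cauchy_conv (u : nat -> V) :
  (forall e : R, 0 < e ->
    exists N, forall m n, (N <= m)%N -> (N <= n)%N -> nrm (u m - u n) < e) ->
  exists l, conv u l.
Proof.
move=> cu.
have /cauchy_cvg uc : cauchy (u @ \oo).
  apply/cauchy_exP => e e0.
  have eE : e = (complex.Re e)%:C by rewrite RRe_real // gtr0_real.
  have /cu[N h] : 0 < complex.Re e by rewrite -ltcR -eE.
  exists (u N); exists N => // n /= Nn.
  by rewrite -ball_normE /= eE -nrm_lt; apply: h.
exists (lim (u @ \oo)) => e e0.
have /cvgrPdist_lt/(_ e%:C) : u @ \oo --> lim (u @ \oo) by [].
rewrite ltcR => /(_ e0)[N _ h]; exists N => n /h /=.
by rewrite nrmB nrm_lt.
Qed.

End Complete.

(** * Bounded linear maps *)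

Section LinearMaps.
Variables (R : realType) (V W : lmodType R[i]) (f : V -> W).
Hypothesis f_lin : linear f.

Lemma lin0 : f 0 = 0.
Proof. by have := f_lin (-1) 0 0; rewrite scaler0 addr0 scaleN1r addNr. Qed.

Lemma linD x y : f (x + y) = f x + f y.
Proof. by have := f_lin 1 x y; rewrite !scale1r. Qed.

Lemma linZ (c : R[i]) x : f (c *: x) = c *: f x.
Proof. by have := f_lin c x 0; rewrite lin0 !addr0. Qed.

Lemma linN x : f (- x) = - f x.
Proof. by rewrite -scaleN1r linZ scaleN1r. Qed.

Lemma linB x y : f (x - y) = f x - f y.
Proof. by rewrite linD linN. Qed.

Lemma lin_sum (I : Type) (r : seq I) (P : pred I) (F : I -> V) :
  f (\sum_(i <- r | P i) F i) = \sum_(i <- r | P i) f (F i).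
Proof. exact: (big_morph f linD lin0). Qed.

End LinearMaps.

Section BoundedMaps.
Variables (R : realType) (V W : normedModType R[i]).

Definition bounded_by (C : R) (f : V -> W) : Prop :=
  forall x, nrm (f x) <= C * nrm x.

Lemma conv_lin (f : V -> W) (C : R) u x : linear f -> bounded_by C f ->
  conv u x -> conv (fun n => f (u n)) (f x).
Proof.
move=> fl fC ux e e0.
have C1 : 0 < `|C| + 1 by rewrite ltr_wpDl.
have [|N h] := ux (e / (`|C| + 1)); first by rewrite divr_gt0.
exists N => n /h; rewrite ltr_pdivlMr // => hn; rewrite -linB //.
apply: le_lt_trans (fC _) _; have := nrm_ge0 (u n - x).
by have := ler_norm C => ? ?; apply: le_lt_trans hn; rewrite mulrC; nra.
Qed.

Lemma bounded_byP (f : V -> W) : linear f ->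
  continuous f <-> exists2 C : R, 0 <= C & bounded_by C f.
Proof.
move=> fl.
pose g : {linear V -> W} :=
  HB.pack f (GRing.isLinear.Build R[i] V W *:%R f fl).
split=> [cf|[C C0 fC]].
  have /linear_boundedP gb : bounded_near g (nbhs (0 : V)).
    exact/linear_bounded_continuous.
  near (+oo : set_system R[i]) => r.
  have r0 : 0 < r by near: r; exact: nbhs_pinfty_gt.
  have rE : r = (complex.Re r)%:C by rewrite RRe_real // gtr0_real.
  exists (complex.Re r) => [|x]; first by rewrite -ler0c -rE ltW.
  have : forall x, `|g x| <= r * `|x| by near: r.
  by move=> /(_ x); rewrite {1}rE (nrmC x) -rmorphM -nrm_le.
apply: (@bounded_linear_continuous _ _ _ g); apply/linear_boundedP.
near=> r => x.
rewrite (@le_trans _ _ (C%:C * `|x|)) //.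
  by rewrite (nrmC x) -rmorphM -nrm_le; exact: fC.
rewrite ler_wpM2r //; near: r; apply: nbhs_pinfty_ge.
by rewrite ger0_real // ler0c.
Unshelve. all: by end_near. Qed.

End BoundedMaps.

Section Geometric.
Variables (R : realType) (V : completeNormedModType R[i]).

Lemma geometric_conv (u : nat -> V) (C r : R) : 0 <= r -> r < 1 ->
  (forall n, nrm (u n.+1 - u n) <= C * r ^+ n) -> exists l, conv u l.
Proof.
move=> r0 r1 hu; have r1' : 0 < 1 - r by rewrite subr_gt0.
have C0 : 0 <= C by have := hu 0%N; rewrite expr0 mulr1; apply: le_trans (nrm_ge0 _).
have tail n k : nrm (u (n + k)%N - u n) <= C / (1 - r) * (r ^+ n - r ^+ (n + k)).
  elim: k => [|k IH]; first by rewrite addn0 !subrr nrm0 mulr0.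
  rewrite addnS; apply: le_trans (nrm_dist _ (u (n + k)%N) _) _.
  have -> : C / (1 - r) * (r ^+ n - r ^+ (n + k).+1)
     = C * r ^+ (n + k) + C / (1 - r) * (r ^+ n - r ^+ (n + k)).
    by rewrite exprS; field; rewrite gt_eqF.
  by rewrite lerD.
have tail' n k : (n <= k)%N -> nrm (u k - u n) <= C / (1 - r) * r ^+ n.
  move=> /subnKC <-; apply: le_trans (tail _ _) _.
  apply: ler_wpM2l; first by rewrite divr_ge0 // ltW.
  by rewrite gerBl exprn_ge0.
apply: cauchy_conv => e e0.
have : GRing.exp r @ \oo --> (0 : R) by apply: cvg_expr; rewrite ger0_norm.
have C1 : 0 < C / (1 - r) + 1 by rewrite ltr_wpDl // divr_ge0 // ltW.
have e1 : 0 < e / (2 * (C / (1 - r) + 1)) by rewrite divr_gt0 // mulr_gt0.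
move=> /cvgrPdist_lt/(_ _ e1)[N _ h].
have rN : C / (1 - r) * r ^+ N < e / 2.
  have := h N (leqnn N); rewrite /= sub0r normrN ger0_norm ?exprn_ge0 //.
  rewrite ltr_pdivlMr ?mulr_gt0 //; have := exprn_ge0 N r0.
  set a := C / _; set b := r ^+ N => *; lra.
exists N => m n Nm Nn; apply: le_lt_trans (nrm_dist _ (u N) _) _.
rewrite (nrmB (u N)); have := tail' _ _ Nm; have := tail' _ _ Nn; lra.
Qed.

End Geometric.

(** * Norm and involution of a C*-algebra *)

Section CStarNorm.
Variables (R : realType) (A : cstarAlgType R).
Implicit Types (x y h : A).

Lemma nrmM x y : nrm (x * y) <= nrm x * nrm y.
Proof.
rewrite nrm_le rmorphM /= -!nrmC; exact: cstar_normM.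
Qed.

Lemma nrm_starM x : nrm (star x * x) = nrm x ^+ 2.
Proof.
have := cstar_normE x; rewrite -/(star x * x) !nrmC -rmorphXn /=.
by move=> /complexI.
Qed.

Lemma star_scale (c : R[i]) x : star (c *: x) = conjc c *: star x.
Proof. exact: starZ. Qed.

Lemma star0 : star (0 : A) = 0.
Proof. by rewrite -[X in star X](scale0r (0 : A)) star_scale conjc0 scale0r. Qed.

Lemma starN x : star (- x) = - star x.
Proof. by rewrite -scaleN1r star_scale rmorphN1 scaleN1r. Qed.

Lemma starB x y : star (x - y) = star x - star y.
Proof. by rewrite starD starN. Qed.

Lemma star_mul x y : star (x * y) = star y * star x.
Proof. exact: starM. Qed.

Lemma star1 : star (1 : A) = 1.
Proof. by rewrite -[LHS]mulr1 -[X in _ * X]starK -star_mul mulr1 starK. Qed.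

Lemma star_scalar (c : R[i]) : star (c%:A : A) = (conjc c)%:A.
Proof. by rewrite star_scale star1. Qed.

Lemma nrm_star x : nrm (star x) = nrm x.
Proof.
suff le y : nrm y <= nrm (star y) by apply/eqP; rewrite eq_le le -{2}[x]starK le.
have := nrmM (star y) y; rewrite nrm_starM expr2.
have := nrm_ge0 y; rewrite le_eqVlt => /predU1P[<- _|y0]; first exact: nrm_ge0.
by rewrite ler_pM2r.
Qed.

Lemma nrm1 : nrm (1 : A) = 1.
Proof.
have := nrm_starM 1; rewrite star1 mulr1 expr2 => h.
have : nrm (1 : A) != 0 by apply/eqP => /nrm_eq0/eqP; rewrite oner_eq0.
by move=> n0; apply: (mulfI n0); rewrite -h mulr1.
Qed.

Lemma nrm_isometry x : star x * x = 1 -> nrm x = 1.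
Proof.
move=> x1; have := nrm_starM x; rewrite x1 nrm1 => /esym/eqP.
by rewrite sqrf_eq1 => /orP[/eqP //|/eqP h]; have := nrm_ge0 x; rewrite h; lra.
Qed.

Lemma conv_star u x : conv u x -> conv (fun n => star (u n)) (star x).
Proof. by move=> ux e /ux[N h]; exists N => n /h; rewrite -starB nrm_star. Qed.

Lemma convMl y u x : conv u x -> conv (fun n => y * u n) (y * x).
Proof.
apply: (@conv_lin R A A (fun z => y * z) (nrm y)) => [c a b|z]; last exact: nrmM.
by rewrite mulrDr scalerAr.
Qed.

Lemma convMr y u x : conv u x -> conv (fun n => u n * y) (x * y).
Proof.
apply: (@conv_lin R A A (fun z => z * y) (nrm y)) => [c a b|z]; last by rewrite mulrC nrmM.
by rewrite mulrDl scalerAl.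
Qed.

Lemma convM u v x y : conv u x -> conv v y -> conv (fun n => u n * v n) (x * y).
Proof.
move=> ux vy e e0.
have b0 : 0 < 1 + nrm x + nrm y + e.
  by have := nrm_ge0 x; have := nrm_ge0 y; lra.
have d0 : 0 < e / (1 + nrm x + nrm y + e) by rewrite divr_gt0.
have [N1 h1] := ux _ d0; have [N2 h2] := vy _ d0.
exists (maxn N1 N2) => n; rewrite geq_max => /andP[/h1 a1 /h2 a2].
have -> : u n * v n - x * y
    = (u n - x) * (v n - y) + (u n - x) * y + x * (v n - y).
  by rewrite -mulrDr subrK mulrBl mulrBr addrA subrK.
have := nrmD ((u n - x) * (v n - y) + (u n - x) * y) (x * (v n - y)).
have := nrmD ((u n - x) * (v n - y)) ((u n - x) * y).
have := nrmM (u n - x) (v n - y); have := nrmM (u n - x) y.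
have := nrmM x (v n - y).
have := nrm_ge0 (u n - x); have := nrm_ge0 (v n - y).
have := nrm_ge0 x; have := nrm_ge0 y.
have dE : e / (1 + nrm x + nrm y + e) * (1 + nrm x + nrm y + e) = e.
  by rewrite divfK // gt_eqF.
move: a1 a2 d0 dE; set dl := e / _ => a1 a2 d0 dE y0 x0 p0 q0 i1 i2 i3 i4 i5.
have dl1 : dl < 1 by nra.
nra.
Qed.

End CStarNorm.

(** * Contractivity of star-homomorphisms *)

Section UnitaryDecomposition.
Variables (R : realType) (A : cstarAlgType R).
Implicit Types (x y h u : A).

(** The root is 1 - w, where w is the fixed point of w |-> (h^2 + w^2) / 2.  This
    map is a contraction of the ball of radius 1 - sqrt (1 - |h|^2), and its iterates
    from 0 are self-adjoint and commute with h. *)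
Lemma sqrt_one_sub h : star h = h -> nrm h < 1 ->
  exists y, [/\ star y = y, h * y = y * h & y * y = 1 - h * h].
Proof.
move=> hh h1.
pose w n := iter n (fun w => 2^-1 *: (h * h + w * w)) (0 : A).
have wS n : w n.+1 = 2^-1 *: (h * h + w n * w n) by [].
have w_star n : star (w n) = w n.
  elim: n => [|n IH]; first exact: star0.
  by rewrite wS star_scale starD !star_mul hh IH conjc_inv conjc_nat.
have w_comm z n : z * h = h * z -> z * w n = w n * z.
  move=> zh; elim: n => [|n IH]; first by rewrite mulr0 mul0r.
  rewrite wS -scalerAr -scalerAl mulrDr mulrDl.
  by rewrite !mulrA zh -(mulrA h) zh IH -(mulrA _ z) IH !mulrA.
have w_comm2 m n : w m * w n = w n * w m.
  by apply: (w_comm (w m) n); rewrite (w_comm h).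
have h0 := nrm_ge0 h.
pose s := Num.sqrt (1 - nrm h ^+ 2); pose r := 1 - s.
have q0 : 0 < 1 - nrm h ^+ 2 by rewrite subr_gt0 expr2; nra.
have s0 : 0 < s by rewrite sqrtr_gt0.
have ss : s ^+ 2 = 1 - nrm h ^+ 2 by rewrite sqr_sqrtr // ltW.
have s1 : s <= 1 by nra.
have r0 : 0 <= r by rewrite subr_ge0.
have r1 : r < 1 by rewrite /r; lra.
have half x : nrm (2^-1 *: x) = 2^-1 * nrm x.
  rewrite (realC_natV R 2).
  by rewrite nrmZr // invr_ge0.
have w_le n : nrm (w n) <= r.
  elim: n => [|n IH]; first by rewrite nrm0.
  rewrite wS half; have := nrmD (h * h) (w n * w n).
  have := nrmM h h; have := nrmM (w n) (w n); have := nrm_ge0 (w n).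
  rewrite /r in IH *; nra.
have w_geo n : nrm (w n.+1 - w n) <= nrm (w 1%N) * r ^+ n.
  elim: n => [|n IH]; first by rewrite expr0 mulr1 subr0.
  have -> : w n.+2 - w n.+1 = 2^-1 *: ((w n.+1 - w n) * (w n.+1 + w n)).
    rewrite (wS n.+1) {2}(wS n) -scalerBr opprD addrACA subrr add0r.
    by rewrite mulrDr !mulrBl (w_comm2 n n.+1) addrA subrK.
  rewrite half exprSr mulrA; have := nrmM (w n.+1 - w n) (w n.+1 + w n).
  have := nrmD (w n.+1) (w n); have := w_le n; have := w_le n.+1.
  have := nrm_ge0 (w n.+1 - w n); have := nrm_ge0 (w n.+1 + w n).
  move: IH; set a := nrm (w n.+1 - w n); set b := nrm (w n.+1 + w n).
  set c := nrm (w 1%N) * _ => ? ? ? ? ? ? ?; nra.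
have [l wl] := geometric_conv r0 r1 w_geo.
have lE : l = 2^-1 *: (h * h + l * l).
  apply: (@conv_unique _ _ (fun n => w n.+1)).
    by move=> e /wl[N hN]; exists N => n Nn; apply/hN/leqW.
  exact/convZ/convD/convM/wl/wl/conv_cst.
have l2 : l + l = h * h + l * l.
  by rewrite {1 2}lE -scalerDl half_add scale1r.
have l_comm : h * l = l * h.
  apply: (@conv_unique _ _ (fun n => h * w n)); first exact: convMl.
  apply: (conv_eventually (N := 0%N)) (convMr h wl) => n _.
  by rewrite (w_comm h).
exists (1 - l); split.
- rewrite starB star1; congr (1 - _).
  apply: conv_unique (conv_star wl) _.
  by apply: (conv_eventually (N := 0%N)) wl => n _; rewrite w_star.
- by rewrite mulrBr mulrBl mulr1 mul1r l_comm.
- have -> : h * h = l + l - l * l by rewrite l2 addrK.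
  by rewrite mulrBr mulr1 mulrBl mul1r !opprB opprD !addrA (addrAC 1 (- l)).
Qed.

(** Take u = h + i sqrt (1 - h^2). *)
Lemma unitary_mean h : star h = h -> nrm h < 1 ->
  exists2 u, unitary u & h = 2^-1 *: (u + star u).
Proof.
move=> hh /(sqrt_one_sub hh)[y [yy hy y2]].
have i_conj : conjc 'i%C = - 'i%C :> R[i] by apply/eqP; rewrite eq_complex /= oppr0 !eqxx.
exists (h + 'i%C *: y); last first.
  rewrite starD star_scale hh yy i_conj scaleNr addrACA subrr addr0.
  by rewrite scalerDr -scalerDl half_add scale1r.
rewrite /unitary starD star_scale hh yy i_conj scaleNr.
have i2 : ('i%C * 'i%C : R[i]) = -1 by rewrite -expr2 sqr_i.
split; rewrite mulrDr !mulrDl ?mulNr ?mulrN -!scalerAl -!scalerAr !scalerA i2.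
  by rewrite scaleN1r hy opprK addrA subrK y2 addrC subrK.
by rewrite scaleN1r opprK hy addrA addrK y2 addrC subrK.
Qed.

End UnitaryDecomposition.

Section Contractive.
Variables (R : realType).

(** Unitaries are mapped to unitaries, which have norm 1; so the image of a
    self-adjoint h of norm less than 1, being a mean of two unitaries, has norm at
    most 1.  The C*-identity reduces the general case to this one. *)
Lemma star_hom_contractive (A B : cstarAlgType R) (f : A -> B) :
  unital_star_hom f -> forall x, nrm (f x) <= nrm x.
Proof.
move=> [fl [f1 fM] fs].
have contr h : star h = h -> nrm h < 1 -> nrm (f h) <= 1.
  move=> hh /(unitary_mean hh)[u [u1 u2] ->].
  have nu : nrm (f u) = 1 by apply: nrm_isometry; rewrite -fs -fM u1.
  rewrite (linZ fl) (linD fl) fs.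
  rewrite (realC_natV R 2).
  rewrite nrmZr ?invr_ge0 //.
  have := nrmD (f u) (star (f u)); rewrite nrm_star nu; lra.
have contr' h : star h = h -> nrm (f h) <= nrm h.
  move=> hh; apply: nrm_le_small => e e0; have h0 := nrm_ge0 h.
  have c0 : 0 < nrm h + e by lra.
  have ci : 0 <= (nrm h + e)^-1 by rewrite invr_ge0 ltW.
  have := contr ((nrm h + e)^-1%:C *: h).
  rewrite star_scale conjc_real hh (linZ fl) !nrmZr // => /(_ erefl).
  rewrite mulrC ltr_pdivrMr // mul1r => /(_ _)-/(_ _).
  rewrite mulrC ler_pdivrMr // mul1r; apply; lra.
move=> x; have := contr' (star x * x); rewrite star_mul starK => /(_ erefl).
rewrite fM fs !nrm_starM ler_sqr ?nnegrE ?nrm_ge0 //.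
Qed.

End Contractive.

(** * Limits of operators and extension by density *)

Section Density.
Variables (R : realType) (V W : normedModType R[i]).

Lemma conv_nrm_le (C : R) (u : nat -> V) (v : nat -> W) x y : 0 <= C ->
  conv u x -> conv v y -> (forall n, nrm (v n) <= C * nrm (u n)) ->
  nrm y <= C * nrm x.
Proof.
move=> C0 ux vy uv; apply: nrm_le_small => e e0.
have e1 : 0 < e / (1 + C) by rewrite divr_gt0 // ltr_wpDr.
have [N1 h1] := ux _ e1; have [N2 h2] := vy _ e1.
have := h1 _ (leq_maxl N1 N2); have := h2 _ (leq_maxr N1 N2).
set n := maxn _ _; have := uv n; move: (u n) (v n) => a b ab.
have := nrmD (y - b) b; have := nrmD (a - x) x; rewrite !subrK (nrmB y).
have eE : e / (1 + C) * (1 + C) = e by rewrite divfK // gt_eqF // ltr_wpDr.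
move: e1 eE; set d := e / _; have := nrm_ge0 (a - x); nra.
Qed.

Lemma dense_ind (D P : set V) : closure D = setT ->
  (forall u x, (forall n, P (u n)) -> conv u x -> P x) ->
  (forall x, D x -> P x) -> forall x, P x.
Proof.
move=> dD cP DP x; have /closure_seq[u uD ux] : closure D x by rewrite dD.
by apply: cP ux => n; apply: DP.
Qed.

End Density.

Section StrongLimit.
Variables (R : realType) (V : normedModType R[i]) (W : completeNormedModType R[i]).

(** Uniform boundedness carries pointwise convergence from a dense set to the whole
    space. *)
Lemma strong_limit (T : nat -> V -> W) (C : R) (D : set V) : 0 <= C ->
  (forall n, linear (T n)) -> (forall n, bounded_by C (T n)) ->
  closure D = setT -> (forall x, D x -> exists l, conv (T^~ x) l) ->
  exists T' : V -> W,
    [/\ linear T', bounded_by C T' & forall x, conv (T^~ x) (T' x)].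
Proof.
move=> C0 Tl TC dD DT.
have /choice[T' T'P] x : exists l, conv (T^~ x) l.
  apply: cauchy_conv => e e0.
  have e1 : 0 < e / (4 * (1 + C)) by rewrite divr_gt0 // mulr_gt0 // ltr_wpDr.
  have /closure_nrmP/(_ _ e1)[y Dy xy] : closure D x by rewrite dD.
  have [l yl] := DT y Dy.
  have e4 : 0 < e / 4 by rewrite divr_gt0.
  have [N h] := yl _ e4; exists N => m n Nm Nn.
  have eE : e / (4 * (1 + C)) * (4 * (1 + C)) = e.
    by rewrite divfK // gt_eqF // mulr_gt0 // ltr_wpDr.
  have := nrm_dist (T m x) (T m y) (T n x); have := nrm_dist (T m y) l (T n x).
  have := nrm_dist l (T n y) (T n x).
  have := h _ Nm; have := h _ Nn; rewrite (nrmB l (T n y)) (nrmB (T m x) (T m y)).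
  rewrite -!linB //; have := TC m (y - x); have := TC n (y - x).
  move: xy e1 eE; set d := e / (4 * _); have := nrm_ge0 (y - x); nra.
exists T'; split => // [c x y|x].
  apply: conv_unique (T'P (c *: x + y)) _.
  apply: (conv_eventually (N := 0%N)) (convD (convZ c (T'P x)) (T'P y)) => n _.
  by rewrite Tl.
apply: conv_nrm_le C0 (conv_cst x) (T'P x) _ => n; exact: TC.
Qed.

(** The estimate makes the limit of r along a sequence depend only on the limit of q
    along it. *)
Lemma dense_extension (E : lmodType R[i]) (q : E -> V) (r : E -> W) (C : R) :
  0 <= C -> linear q -> linear r -> closure (range q) = setT ->
  (forall a, nrm (r a) <= C * nrm (q a)) ->
  exists T : V -> W, [/\ linear T, bounded_by C T & forall a, T (q a) = r a].
Proof.
move=> C0 ql rl dq qr.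
have app x : exists2 u : nat -> E, conv (q \o u) x & exists y, conv (r \o u) y.
  have /closure_seq[v vq vx] : closure (range q) x by rewrite dq.
  have /choice[u uv] n : exists a, q a = v n by have [a _ <-] := vq n; exists a.
  have ux : conv (q \o u) x.
    by apply: (conv_eventually (N := 0%N)) vx => n _ /=; rewrite uv.
  exists u => //; apply: cauchy_conv => e e0.
  have e1 : 0 < e / (2 * (1 + C)) by rewrite divr_gt0 // mulr_gt0 // ltr_wpDr.
  have eE : e / (2 * (1 + C)) * (2 * (1 + C)) = e.
    by rewrite divfK // gt_eqF // mulr_gt0 // ltr_wpDr.
  have [N h] := ux _ e1; exists N => m n /h /= hm /h /= hn.
  rewrite -linB //; apply: le_lt_trans (qr _) _; rewrite linB //.
  have := nrm_dist (q (u m)) x (q (u n)); rewrite (nrmB x (q (u n))).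
  move: hm hn e1 eE; set d := e / (2 * _); have := nrm_ge0 (q (u m) - q (u n)); nra.
have /choice[T TP] x : exists y, exists2 u : nat -> E, conv (q \o u) x & conv (r \o u) y.
  by have [u ux [y uy]] := app x; exists y, u.
have Tuniq x (u : nat -> E) y : conv (q \o u) x -> conv (r \o u) y -> T x = y.
  move=> ux uy; have [v vx vy] := TP x.
  have h0 : conv (fun n => q (u n) - q (v n)) 0.
    have := convD ux (convZ (-1) vx); rewrite scaleN1r subrr.
    by apply: (conv_eventually (N := 0%N)) => n _; rewrite scaleN1r.
  have h1 : conv (fun n => r (u n) - r (v n)) (y - T x).
    have := convD uy (convZ (-1) vy); rewrite scaleN1r.
    by apply: (conv_eventually (N := 0%N)) => n _; rewrite scaleN1r.
  have := conv_nrm_le C0 h0 h1 => /(_ _)/wrap[n|].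
    by rewrite -!linB.
  rewrite nrm0 mulr0 => yT; apply/eqP; rewrite eq_sym -subr_eq0; apply/eqP.
  by apply: nrm_eq0; apply/eqP; rewrite eq_le yT nrm_ge0.
exists T; split => [c x y|x|a].
- have [u ux uy] := TP x; have [v vx vy] := TP y.
  apply: (Tuniq _ (fun n => c *: u n + v n)).
    apply: (conv_eventually (N := 0%N)) (convD (convZ c ux) vx) => n _ /=.
    by rewrite ql.
  apply: (conv_eventually (N := 0%N)) (convD (convZ c uy) vy) => n _ /=.
  by rewrite rl.
- have [u ux uy] := TP x; apply: conv_nrm_le C0 ux uy _ => n; exact: qr.
- apply: (Tuniq _ (fun=> a)); exact: conv_cst.
Qed.

End StrongLimit.

(** * Hilbert spaces: Cauchy-Schwarz, Riesz representation, adjoints *)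

Section InnerProduct.
Variables (R : realType) (H : hilbertType R).
Implicit Types (x y z : H) (c : R[i]).

Lemma innerDl x y z : inner (x + y) z = inner x z + inner y z.
Proof. by have := inner_linear 1 x y z; rewrite scale1r mul1r. Qed.

Lemma inner0l z : inner (0 : H) z = 0.
Proof. by apply: (addrI (inner 0 z)); rewrite -innerDl !addr0. Qed.

Lemma innerZl c x z : inner (c *: x) z = c * inner x z.
Proof. by have := inner_linear c x 0 z; rewrite inner0l !addr0. Qed.

Lemma innerNl x z : inner (- x) z = - inner x z.
Proof. by rewrite -scaleN1r innerZl mulN1r. Qed.

Lemma innerBl x y z : inner (x - y) z = inner x z - inner y z.
Proof. by rewrite innerDl innerNl. Qed.

Lemma innerDr x y z : inner z (x + y) = inner z x + inner z y.
Proof. by rewrite inner_conj innerDl rmorphD /= -!inner_conj. Qed.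

Lemma innerZr c x z : inner z (c *: x) = conjc c * inner z x.
Proof. by rewrite inner_conj innerZl rmorphM /= -inner_conj. Qed.

Lemma inner0r z : inner z (0 : H) = 0.
Proof. by rewrite inner_conj inner0l conjc0. Qed.

Lemma innerNr x z : inner z (- x) = - inner z x.
Proof. by rewrite inner_conj innerNl rmorphN /= -inner_conj. Qed.

Lemma innerBr x y z : inner z (x - y) = inner z x - inner z y.
Proof. by rewrite innerDr innerNr. Qed.

Lemma innerxx x : inner x x = (nrm x ^+ 2)%:C.
Proof. by rewrite inner_norm nrmC rmorphXn. Qed.

(** This expands the squared norm of the component of x orthogonal to z, multiplied
    by |z|^4 to avoid a division; it yields the Cauchy-Schwarz inequality and the
    orthogonality of nearest points. *)
Lemma nrm_orth x z :
  nrm ((nrm z ^+ 2)%:C *: x - inner x z *: z) ^+ 2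
    = nrm z ^+ 2 * (nrm z ^+ 2 * nrm x ^+ 2 - cabs (inner x z) ^+ 2).
Proof.
have morph (a b p : R) : (b * (b * a - p))%:C = b%:C * (b%:C * a%:C - p%:C).
  by rewrite !(rmorphM, rmorphB).
apply: complexI; rewrite morph cabs_sqr -!innerxx.
rewrite !(innerBl, innerBr, innerZl, innerZr) (inner_conj x z) [inner z z]innerxx conjc_real.
ring.
Qed.

Lemma cauchy_schwarz x z : cabs (inner x z) <= nrm x * nrm z.
Proof.
have [->|z0] := eqVneq z 0; first by rewrite inner0r nrm0 mulr0 /cabs nrm0.
have zp : 0 < nrm z.
  by rewrite lt_neqAle nrm_ge0 andbT eq_sym; apply: contra_neq z0 => /nrm_eq0.
have := sqr_ge0 (nrm ((nrm z ^+ 2)%:C *: x - inner x z *: z)).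
rewrite nrm_orth pmulr_rge0 ?exprn_gt0 // subr_ge0 -exprMn mulrC.
by rewrite ler_sqr // nnegrE ?mulr_ge0 ?nrm_ge0 //; exact: nrm_ge0.
Qed.

Lemma nearest_orth x z :
  (forall c, nrm x <= nrm (x - c *: z)) -> inner x z = 0.
Proof.
move=> min; have [->|z0] := eqVneq z 0; first exact: inner0r.
have zp : 0 < nrm z.
  by rewrite lt_neqAle nrm_ge0 andbT eq_sym; apply: contra_neq z0 => /nrm_eq0.
have z2 : 0 < nrm z ^+ 2 by rewrite exprn_gt0.
have := nrm_orth x z.
have -> : (nrm z ^+ 2)%:C *: x - inner x z *: z
  = (nrm z ^+ 2)%:C *: (x - (inner x z / (nrm z ^+ 2)%:C) *: z).
  by rewrite scalerBr scalerA mulrC divfK // gt_eqF // ltcR.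
rewrite nrmZr ?ltW // => h.
have := min (inner x z / (nrm z ^+ 2)%:C); have := nrm_ge0 x.
move: h; set a := nrm (_ - _); set b := nrm z ^+ 2; set p := cabs _.
rewrite -/b in z2; move=> h x0 xa.
have p0 : 0 <= p by exact: nrm_ge0.
have xa2 : nrm x ^+ 2 <= a ^+ 2 by rewrite ler_sqr // nnegrE // (le_trans x0).
have p2 : p ^+ 2 = 0.
  apply/eqP; rewrite eq_le sqr_ge0 andbT.
  have : b * p ^+ 2 <= 0 by rewrite exprMn in h; nra.
  by rewrite pmulr_rle0.
move/eqP: p2; rewrite sqrf_eq0 => /eqP; exact: nrm_eq0.
Qed.

Lemma parallelogram x y :
  nrm (x + y) ^+ 2 + nrm (x - y) ^+ 2 = 2 * nrm x ^+ 2 + 2 * nrm y ^+ 2.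
Proof.
have morph (a b c e : R) : a + b = 2 * c + 2 * e <->
    a%:C + b%:C = 2 * c%:C + 2 * e%:C.
  have -> : 2 * c%:C + 2 * e%:C = (2 * c + 2 * e)%:C.
    by rewrite rmorphD !rmorphM !rmorph_nat.
  by rewrite -rmorphD; split=> [->|/complexI].
apply/morph; rewrite -!innerxx.
rewrite !(innerDl, innerDr, innerNl, innerNr); ring.
Qed.

Lemma conv_innerl u x y : conv u x ->
  conv (fun n => inner (u n) y : R[i]^o) (inner x y).
Proof.
apply: (@conv_lin R H R[i]^o (fun z => inner z y) (nrm y)) => [c a b|z].
  exact: inner_linear.
by rewrite mulrC; exact: cauchy_schwarz.
Qed.

Lemma conv_innerr u x y : conv u x ->
  conv (fun n => inner y (u n) : R[i]^o) (inner y x).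
Proof.
move=> ux e /(conv_innerl y ux)[N h]; exists N => n /h.
have := cabs_conj (inner (u n) y - inner x y).
by rewrite rmorphB /= -!inner_conj => E; apply: le_lt_trans; rewrite -[leLHS]/(cabs _) E.
Qed.

Lemma inner_ext x y : (forall z, inner x z = inner y z) -> x = y.
Proof.
move=> h; apply/eqP; rewrite -subr_eq0; apply/eqP/nrm_eq0/eqP.
by rewrite -sqrf_eq0 -(inj_eq (@complexI _)) -innerxx innerBl h subrr.
Qed.

End InnerProduct.

Section Adjoints.
Variables (R : realType) (H : hilbertType R).
Implicit Types (x y z : H) (X Y T : H -> H).

(** The vector y is proportional to the point x0 of least norm on the hyperplane
    f = 1.  A minimizing sequence is a Cauchy sequence by the parallelogram law, and x0
    is orthogonal to the kernel of f because x0 + ker f is that hyperplane. *)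
Lemma riesz (f : H -> R[i]^o) (C : R) : linear f -> bounded_by C f ->
  exists y, forall x, f x = inner x y.
Proof.
move=> fl fC; case: (pselect (exists x, f x != 0)) => [[x1 fx1]|f0]; last first.
  exists 0 => x; rewrite inner0r; apply/eqP/negPn/negP => fx.
  by apply: f0; exists x.
pose E := [set nrm x ^+ 2 | x in [set x | f x = 1]].
have E_inf : has_inf E.
  split; last by exists 0 => _ [x _ <-]; exact: sqr_ge0.
  exists (nrm ((f x1)^-1 *: x1) ^+ 2), ((f x1)^-1 *: x1) => //=.
  by rewrite (linZ fl); exact: mulVf.
have infE x : f x = 1 -> inf E <= nrm x ^+ 2.
  by move=> fx; apply: ge_inf; [case: E_inf|exists x].
have E_app n : exists x, f x = 1 /\ nrm x ^+ 2 < inf E + n.+1%:R^-1.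
  have [||_ [x fx <-] xn] := @inf_adherent _ E n.+1%:R^-1 => //.
  by exists x.
have /choice[u uP] := E_app.
have u_cauchy m n : nrm (u m - u n) ^+ 2 <= 2 * m.+1%:R^-1 + 2 * n.+1%:R^-1.
  have [[fm um] [fn un]] := (uP m, uP n).
  have := parallelogram (u m) (u n).
  have /infE : f (2^-1 *: (u m + u n)) = 1.
    by rewrite (linZ fl) (linD fl) fm fn scalerDr -scalerDl half_add scale1r.
  rewrite (realC_natV R 2).
  rewrite nrmZr ?invr_ge0 // exprMn.
  have -> : (2^-1 : R) ^+ 2 = 4^-1 by field.
  move: um un; set a := m.+1%:R^-1; set b := n.+1%:R^-1; lra.
have [x0 ux0] : exists x0, conv u x0.
  apply: cauchy_conv => e e0.
  have e4 : 0 < e ^+ 2 / 4 by rewrite divr_gt0 // exprn_gt0.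
  have [N _ hN] := near_infty_natSinv_lt (PosNum e4).
  exists N => m n Nm Nn.
  rewrite -ltr_sqr ?nnegrE ?nrm_ge0 ?(ltW e0) //; have := u_cauchy m n.
  have : m.+1%:R^-1 < e ^+ 2 / 4 := hN m Nm.
  have : n.+1%:R^-1 < e ^+ 2 / 4 := hN n Nn.
  set a := m.+1%:R^-1; set b := n.+1%:R^-1; lra.
have fx0 : f x0 = 1.
  apply: conv_unique (conv_lin fl fC ux0) _.
  by apply: (conv_eventually (N := 0%N)) (conv_cst _) => n _; case: (uP n).
have x0_min : nrm x0 ^+ 2 <= inf E.
  apply/ler_addgt0Pr => e e0.
  have [N _ hN] := near_infty_natSinv_lt (PosNum e0).
  have e1 : 0 <= inf E by apply: lb_le_inf; [case: E_inf|move=> _ [x _ <-]; exact: sqr_ge0].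
  rewrite -[leRHS]sqr_sqrtr; last by rewrite addr_ge0 // ltW.
  rewrite ler_sqr ?nnegrE ?nrm_ge0 ?sqrtr_ge0 //.
  apply: (@conv_le _ _ (fun n => u (n + N)%N)) => [d /ux0[M h]|n].
    by exists M => n Mn; apply/h/(leq_trans Mn)/leq_addr.
  rewrite -ler_sqr ?nnegrE ?nrm_ge0 ?sqrtr_ge0 // sqr_sqrtr; last first.
    by rewrite addr_ge0 // ltW.
  have [_ /ltW] := uP (n + N)%N; move=> /le_trans; apply.
  by rewrite lerD2l ltW // (hN (n + N)%N) //= leq_addl.
have x0n : nrm x0 ^+ 2 != 0.
  rewrite sqrf_eq0; apply/eqP => /nrm_eq0 x00.
  by move: fx0; rewrite x00 lin0 // => /esym/eqP; rewrite oner_eq0.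
have x0C : (nrm x0 ^+ 2)%:C != 0 :> R[i] by rewrite (inj_eq (@complexI _) _ 0).
have orth z : f z = 0 -> inner x0 z = 0.
  move=> fz; apply: nearest_orth => c.
  rewrite -ler_sqr ?nnegrE ?nrm_ge0 //; apply: le_trans x0_min (infE _ _).
  by rewrite (linB fl) (linZ fl) fz scaler0 subr0.
exists ((nrm x0 ^+ 2)^-1%:C *: x0) => x.
have /orth : f (x - f x *: x0) = 0.
  by rewrite (linB fl) (linZ fl) fx0 -[_ *: _]/(f x * 1) mulr1 subrr.
rewrite inner_conj => /(congr1 conjc); rewrite conjcK conjc0.
rewrite innerBl innerZl innerxx => /eqP; rewrite subr_eq0 => /eqP xE.
by rewrite innerZr conjc_real xE mulrC fmorphV mulfK.
Qed.

Lemma bounded_operatorP T :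
  bounded_operator T <-> linear T /\ exists2 C : R, 0 <= C & bounded_by C T.
Proof. by split=> -[Tl Tb]; split=> //; apply/bounded_byP. Qed.

Lemma adjoint_exists T : bounded_operator T ->
  exists2 T', bounded_operator T' & adjoint_of T T'.
Proof.
move=> /bounded_operatorP[Tl [C C0 TC]].
have /choice[T' T'P] y : exists z, forall x, inner (T x) y = inner x z.
  apply: (@riesz (fun x => inner (T x) y) (C * nrm y)) => [c a b|x].
    by rewrite Tl; exact: inner_linear.
  apply: le_trans (cauchy_schwarz _ _) _; rewrite mulrAC.
  by rewrite ler_wpM2r ?nrm_ge0.
have adj x y : inner (T' x) y = inner x (T y).
  by rewrite (inner_conj y) -T'P -inner_conj.
exists T' => //; apply/bounded_operatorP; split=> [c x y|].
  apply: inner_ext => z.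
  by rewrite adj innerDl innerZl -!adj -innerZl -innerDl.
exists C => // y; have := cauchy_schwarz (T (T' y)) y.
rewrite T'P innerxx cabs_real ?sqr_ge0 // => h.
have := TC (T' y); have := nrm_ge0 (T' y); rewrite le_eqVlt => /predU1P[<- _|y0 Ty].
  by rewrite mulr_ge0 ?nrm_ge0.
rewrite -(ler_pM2l y0) -expr2; apply: le_trans h _.
by rewrite mulrA (mulrC _ C) ler_wpM2r ?nrm_ge0.
Qed.

Lemma adjoint_sym X Y : adjoint_of X Y -> adjoint_of Y X.
Proof. by move=> XY x y; rewrite inner_conj -XY -inner_conj. Qed.

Lemma adjoint_unique X Y Y' : adjoint_of X Y -> adjoint_of X Y' -> Y = Y'.
Proof.
move=> /adjoint_sym XY /adjoint_sym XY'; apply/funext => x.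
by apply: inner_ext => z; rewrite XY XY'.
Qed.

Lemma adjoint_comp X X' Y Y' :
  adjoint_of X X' -> adjoint_of Y Y' -> adjoint_of (X \o Y) (Y' \o X').
Proof. by move=> XX YY x y /=; rewrite XX YY. Qed.

Lemma bounded_operator_comp X Y :
  bounded_operator X -> bounded_operator Y -> bounded_operator (X \o Y).
Proof.
move=> /bounded_operatorP[Xl [C C0 XC]] /bounded_operatorP[Yl [D D0 YD]].
apply/bounded_operatorP; split=> [c x y|]; first by rewrite /= Yl Xl.
exists (C * D) => [|x]; first by rewrite mulr_ge0.
by apply: le_trans (XC _) _; rewrite -mulrA ler_wpM2l.
Qed.

Lemma bounded_operator_lincomb (c : R[i]) X Y :
  bounded_operator X -> bounded_operator Y ->
  bounded_operator (fun x => c *: X x + Y x).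
Proof.
move=> /bounded_operatorP[Xl [C C0 XC]] /bounded_operatorP[Yl [D D0 YD]].
apply/bounded_operatorP; split=> [a x y|].
  rewrite Xl Yl !scalerDr !scalerA (mulrC c) -!addrA; congr (_ + _).
  by rewrite addrCA.
exists (cabs c * C + D) => [|x]; first by rewrite addr_ge0 // mulr_ge0 // nrm_ge0.
apply: le_trans (nrmD _ _) _; rewrite nrmZ mulrDl lerD // -mulrA.
by rewrite ler_wpM2l //; exact: (nrm_ge0 (c : R[i]^o)).
Qed.

Lemma bounded_operator_id : bounded_operator (id : H -> H).
Proof.
by apply/bounded_operatorP; split=> //; exists 1 => // x; rewrite mul1r.
Qed.

Lemma adjoint_isometry T T' : adjoint_of T T' -> cancel T T' ->
  forall x, nrm (T x) = nrm x.
Proof.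
move=> adj TK x; apply/eqP; rewrite -(@eqrXn2 _ 2) ?nrm_ge0 //; apply/eqP/complexI.
by rewrite -!innerxx adj TK.
Qed.

End Adjoints.

(** * Commutants and representations *)

Section Commutants.
Variables (R : realType) (H : hilbertType R).
Implicit Types (D : set (H -> H)) (X Y T : H -> H).

Lemma commutant_bounded D X : commutant D X -> bounded_operator X.
Proof. by case. Qed.

Lemma commutantE D X T x : commutant D X -> D T -> X (T x) = T (X x).
Proof. by move=> [_ /[apply]] => /(congr1 (@^~ x)). Qed.

Lemma commutantI D X : bounded_operator X ->
  (forall T x, D T -> X (T x) = T (X x)) -> commutant D X.
Proof. by move=> bX h; split=> // T DT; apply/funext => x /=; exact: h. Qed.

Lemma commutantS D D' : D `<=` D' -> commutant D' `<=` commutant D.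
Proof. by move=> DD' X [bX h]; split=> // T /DD'/h. Qed.

Lemma sub_bicommutant D : (forall X, D X -> bounded_operator X) -> D `<=` bicommutant D.
Proof.
by move=> bD X DX; apply: commutantI (bD _ DX) _ => T x cT; rewrite (commutantE x cT).
Qed.

Lemma commutant_comp D X Y : commutant D X -> commutant D Y -> commutant D (X \o Y).
Proof.
move=> cX cY; apply: commutantI => [|T x DT /=].
  by apply: bounded_operator_comp; [case: cX|case: cY].
by rewrite (commutantE x cY) // (commutantE _ cX).
Qed.

Lemma commutant_lincomb D (c : R[i]) X Y : (forall T, D T -> bounded_operator T) ->
  commutant D X -> commutant D Y -> commutant D (fun x => c *: X x + Y x).
Proof.
move=> bD cX cY; apply: commutantI => [|T x DT].
  by apply: bounded_operator_lincomb; [case: cX|case: cY].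
by rewrite (commutantE x cX) // (commutantE x cY) //; have [Tl _] := bD _ DT; rewrite Tl.
Qed.

Lemma commutant_adjoint D X X' : (forall T, D T -> exists2 T', D T' & adjoint_of T T') ->
  commutant D X -> bounded_operator X' -> adjoint_of X X' -> commutant D X'.
Proof.
move=> starD cX bX' XX'; apply: commutantI => // T x DT.
have [T' DT' TT'] := starD _ DT; apply: inner_ext => y.
rewrite (adjoint_sym XX') TT' TT' (adjoint_sym XX').
by rewrite (commutantE _ cX).
Qed.

Lemma commutant_conv D (u : nat -> H -> H) X : (forall T, D T -> bounded_operator T) ->
  (forall n, commutant D (u n)) -> bounded_operator X ->
  (forall x, conv (u^~ x) (X x)) -> commutant D X.
Proof.
move=> bD uD bX uX; apply: commutantI => // T x DT.
have /bounded_operatorP[Tl [C C0 TC]] := bD _ DT.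
apply: conv_unique (uX (T x)) _.
apply: (conv_eventually (N := 0%N)) (conv_lin Tl TC (uX x)) => n _.
by rewrite (commutantE x (uD n)).
Qed.

End Commutants.

Section Representations.
Variables (R : realType) (A : cstarAlgType R) (H : hilbertType R) (rho : A -> H -> H).
Hypothesis rho_rep : star_representation rho.

(** As for star-homomorphisms: a unitary acts isometrically, and a self-adjoint
    element of norm less than 1 is a mean of two unitaries. *)
Lemma rep_contractive a x : nrm (rho a x) <= nrm a * nrm x.
Proof.
have [rb rl rM r1 rs] := rho_rep.
have rl' y : linear (rho^~ y) by move=> c b b'; exact: rl.
have contr h y : star h = h -> nrm h < 1 -> nrm (rho h y) <= nrm y.
  move=> hh /(unitary_mean hh)[u [u1 u2] ->].
  rewrite (linZ (rl' y)) (linD (rl' y)).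
  rewrite (realC_natV R 2).
  rewrite nrmZr ?invr_ge0 //; have := nrmD (rho u y) (rho (star u) y).
  rewrite (adjoint_isometry (rs u)) => [|z]; last first.
    by rewrite -[LHS]/((rho (star u) \o rho u) z) -rM u1 r1.
  rewrite (@adjoint_isometry _ _ (rho (star u)) (rho u)) => [||z]; first by lra.
    exact/adjoint_sym/rs.
  by rewrite -[LHS]/((rho u \o rho (star u)) z) -rM u2 r1.
have contr' h y : star h = h -> nrm (rho h y) <= nrm h * nrm y.
  move=> hh; apply: nrm_le_small => e e0.
  have h0 := nrm_ge0 h; have y0 := nrm_ge0 y.
  have y1 : 0 < 1 + nrm y by lra.
  pose d := e / (1 + nrm y); have d0 : 0 < d by rewrite divr_gt0.
  have dE : d * (1 + nrm y) = e by rewrite divfK // gt_eqF.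
  have c0 : 0 < nrm h + d by lra.
  have ci : 0 <= (nrm h + d)^-1 by rewrite invr_ge0 ltW.
  have := contr ((nrm h + d)^-1%:C *: h) y.
  rewrite star_scale conjc_real hh (linZ (rl' y)) !nrmZr // => /(_ erefl).
  rewrite mulrC ltr_pdivrMr // mul1r => k.
  have : (nrm h + d)^-1 * nrm (rho h y) <= nrm y by apply: k; lra.
  rewrite mulrC ler_pdivrMr //; nra.
have := contr' (star a * a) x; rewrite star_mul starK => /(_ erefl).
rewrite nrm_starM rM /= => h.
have := cauchy_schwarz (rho (star a) (rho a x)) x.
have rs' : adjoint_of (rho (star a)) (rho a) by exact/adjoint_sym/rs.
rewrite rs' innerxx cabs_real ?sqr_ge0 // => k.
rewrite -ler_sqr ?nnegrE ?mulr_ge0 ?nrm_ge0 //; apply: le_trans k _.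
by rewrite exprMn [in leRHS](expr2 (nrm x)) mulrA ler_wpM2r ?nrm_ge0.
Qed.

End Representations.

Section ClosedSubspaces.
Variables (R : realType) (V : normedModType R[i]).

Lemma closure_lincomb (X : set V) :
  (forall (c : R[i]) x y, X x -> X y -> X (c *: x + y)) ->
  forall (c : R[i]) x y, closure X x -> closure X y -> closure X (c *: x + y).
Proof.
move=> Xl c x y /closure_seq[u uX ux] /closure_seq[v vX vy].
apply: (@closed_conv _ _ _ (fun n => c *: u n + v n)).
- exact: closed_closure.
- by move=> n; apply: subset_closure; apply: Xl.
- exact/convD/vy/convZ.
Qed.

Lemma closure_stable (X : set V) (f : V -> V) (C : R) : linear f -> bounded_by C f ->
  (forall x, X x -> X (f x)) -> forall x, closure X x -> closure X (f x).
Proof.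
move=> fl fC fX x /closure_seq[u uX ux].
apply: (@closed_conv _ _ _ (fun n => f (u n))) (conv_lin fl fC ux).
  exact: closed_closure.
by move=> n; apply: subset_closure; apply: fX.
Qed.

End ClosedSubspaces.

(** * Spans of words in the Cuntz isometries *)

Section CuntzAlgebra.
Variables (R : realType) (d : nat) (A : cstarAlgType R) (S : 'I_d -> A).
Implicit Types (x y : A) (m n : nat) (i j : 'I_d).

(** The span of the products S_mu S_nu^* with |mu| = m and |nu| = n.  Building words
    from the outside lets stability properties be proved by induction on the rules. *)
Inductive gspan : nat -> nat -> A -> Prop :=
| gspan_zero m n : gspan m n 0
| gspan_scalar (c : R[i]) : gspan 0 0 (c%:A)
| gspan_lin m n (c : R[i]) x y : gspan m n x -> gspan m n y -> gspan m n (c *: x + y)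
| gspan_l m n i x : gspan m n x -> gspan m.+1 n (S i * x)
| gspan_r m n i x : gspan m n x -> gspan m n.+1 (x * star (S i)).

Inductive gpoly : A -> Prop :=
| gpoly_gspan m n x : gspan m n x -> gpoly x
| gpolyD x y : gpoly x -> gpoly y -> gpoly (x + y).

Lemma gspanZ m n (c : R[i]) x : gspan m n x -> gspan m n (c *: x).
Proof. by move=> gx; rewrite -[_ *: _]addr0; apply: gspan_lin => //; exact: gspan_zero. Qed.

Lemma gspanD m n x y : gspan m n x -> gspan m n y -> gspan m n (x + y).
Proof. by move=> gx gy; rewrite -[x]scale1r; exact: gspan_lin. Qed.

Lemma gspan_sum m n (I : Type) (r : seq I) (P : pred I) (F : I -> A) :
  (forall k, P k -> gspan m n (F k)) -> gspan m n (\sum_(k <- r | P k) F k).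
Proof. by move=> h; apply: big_ind => //; [exact: gspan_zero|exact: gspanD]. Qed.

Lemma gspan1 : gspan 0 0 1.
Proof. by have := gspan_scalar 1; rewrite scale1r. Qed.

Lemma gspan_star m n x : gspan m n x -> gspan n m (star x).
Proof.
elim=> {m n x}.
- by move=> m n; rewrite star0; exact: gspan_zero.
- by move=> c; rewrite star_scalar; exact: gspan_scalar.
- by move=> m n c x y _ gx _ gy; rewrite starD star_scale; exact: gspan_lin.
- by move=> m n i x _ gx; rewrite star_mul; exact: gspan_r.
- by move=> m n i x _ gx; rewrite star_mul starK; exact: gspan_l.
Qed.

Lemma gpolyZ (c : R[i]) x : gpoly x -> gpoly (c *: x).
Proof.
elim=> {x} [m n x gx|x y _ gx _ gy]; first exact: gpoly_gspan (gspanZ c gx).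
by rewrite scalerDr; exact: gpolyD.
Qed.

Lemma gspan_expS i n : gspan n 0 (S i ^+ n).
Proof. by elim: n => [|n IH]; [exact: gspan1|rewrite exprS; exact: gspan_l]. Qed.

Lemma gspan_expSS i j n : gspan n.+1 0 (S i ^+ n * S j).
Proof.
elim: n => [|n IH]; last by rewrite exprS -mulrA; exact: gspan_l.
by rewrite mul1r -[S j]mulr1; exact/gspan_l/gspan1.
Qed.

Section Relations.
Hypothesis S_rel : cuntz_relations S.

Lemma starSS i j : star (S i) * S j = (i == j)%:R.
Proof. by case: S_rel. Qed.

Lemma starSSi i : star (S i) * S i = 1.
Proof. by rewrite starSS eqxx. Qed.

Lemma star_expSS i n : star (S i ^+ n) * S i ^+ n = 1.
Proof.
elim: n => [|n IH]; first by rewrite star1 mulr1.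
by rewrite exprS star_mul -mulrA (mulrA (star (S i))) starSSi mul1r.
Qed.

Lemma sumSstarS : \sum_i S i * star (S i) = 1.
Proof. by case: S_rel. Qed.

(** Insert 1 = sum_i S_i S_i^* between S_mu and S_nu^*. *)
Lemma gspan_raise m n x : gspan m n x -> gspan m.+1 n.+1 x.
Proof.
elim=> {m n x}.
- by move=> m n; exact: gspan_zero.
- move=> c; rewrite -sumSstarS scaler_sumr; apply: gspan_sum => i _.
  by apply: gspanZ; apply: gspan_r; rewrite -[S i]mulr1; apply: gspan_l; exact: gspan1.
- by move=> m n c x y _ gx _ gy; exact: gspan_lin.
- by move=> m n i x _ gx; exact: gspan_l.
- by move=> m n i x _ gx; exact: gspan_r.
Qed.

Lemma gspan_raise_by k m n x : gspan m n x -> gspan (k + m) (k + n) x.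
Proof. by move=> gx; elim: k => // k; exact: gspan_raise. Qed.

Lemma gspan_starS m n i x : gspan m.+1 n x -> gspan m n (star (S i) * x).
Proof.
move=> gx; move: {-2}m.+1 gx (erefl m.+1) => k gx; move: m.
elim: gx => {k n x}.
- by move=> k n m _; rewrite mulr0; exact: gspan_zero.
- by [].
- move=> k n c x y _ gx _ gy m km; rewrite mulrDr -scalerAr.
  by apply: gspan_lin; [exact: gx|exact: gy].
- move=> k n j x gx _ m [->]; rewrite mulrA starSS.
  by case: eqP => _; rewrite ?mul1r ?mul0r //; exact: gspan_zero.
- by move=> k n j x _ gx m km; rewrite mulrA; apply: gspan_r; exact: gx.
Qed.

Lemma gspan_mulS m n i x : gspan m n.+1 x -> gspan m n (x * S i).
Proof.
by move=> /gspan_star/(gspan_starS i)/gspan_star; rewrite star_mul !starK.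
Qed.

Lemma gpoly_mulS i x : gpoly x -> gpoly (x * S i).
Proof.
elim=> {x} [m n x gx|x y _ gx _ gy]; last by rewrite mulrDl; exact: gpolyD.
exact: gpoly_gspan (gspan_mulS i (gspan_raise gx)).
Qed.

Lemma gpoly_mulstarS i x : gpoly x -> gpoly (x * star (S i)).
Proof.
elim=> {x} [m n x gx|x y _ gx _ gy]; last by rewrite mulrDl; exact: gpolyD.
exact: gpoly_gspan (gspan_r i gx).
Qed.

End Relations.

Section CoreLevels.

Definition word_span m n : set A :=
  [set x | exists c : m.-tuple 'I_d -> n.-tuple 'I_d -> R[i],
     x = \sum_mu \sum_nu c mu nu *: (word S mu * star (word S nu))].

Lemma word_span_lin m n (c : R[i]) x y :
  word_span m n x -> word_span m n y -> word_span m n (c *: x + y).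
Proof.
move=> [a ->] [b ->]; exists (fun mu nu => c * a mu nu + b mu nu).
rewrite scaler_sumr -big_split; apply: eq_bigr => mu _ /=.
rewrite scaler_sumr -big_split; apply: eq_bigr => nu _ /=.
by rewrite scalerDl scalerA.
Qed.

Lemma word_span0 m n : word_span m n 0.
Proof.
by exists (fun _ _ => 0); rewrite big1 // => mu _; rewrite big1 // => nu _; rewrite scale0r.
Qed.

Lemma word_span_sum m n (I : Type) (r : seq I) (P : pred I) (F : I -> A) :
  (forall k, P k -> word_span m n (F k)) -> word_span m n (\sum_(k <- r | P k) F k).
Proof.
move=> h; apply: big_ind => //; first exact: word_span0.
by move=> x y wx wy; rewrite -[x]scale1r; exact: word_span_lin.
Qed.

Lemma word_span_word m n (mu : m.-tuple 'I_d) (nu : n.-tuple 'I_d) (c : R[i]) :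
  word_span m n (c *: (word S mu * star (word S nu))).
Proof.
exists (fun mu' nu' => if (mu' == mu) && (nu' == nu) then c else 0).
rewrite (bigD1 mu) //= (bigD1 nu) //= !eqxx /= [X in _ + X + _]big1 ?addr0; last first.
  by move=> nu' /negPf ->; rewrite scale0r.
rewrite big1 ?addr0 // => mu' /negPf mu'E; rewrite big1 // => nu' _.
by rewrite mu'E scale0r.
Qed.

Lemma word_cons m i (mu : m.-tuple 'I_d) : S i * word S mu = word S (cons_tuple i mu).
Proof. by rewrite /word big_cons. Qed.

Lemma gspan_word_span m n x : gspan m n x -> word_span m n x.
Proof.
elim=> {m n x}.
- by move=> m n; exact: word_span0.
- move=> c; have := word_span_word (nil_tuple 'I_d) (nil_tuple 'I_d) c.
  by rewrite /word !big_nil star1 mulr1.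
- by move=> m n c x y _ gx _ gy; exact: word_span_lin.
- move=> m n i x _ [c ->]; rewrite mulr_sumr; apply: word_span_sum => mu _.
  rewrite mulr_sumr; apply: word_span_sum => nu _.
  by rewrite -scalerAr mulrA word_cons; exact: word_span_word.
- move=> m n i x _ [c ->]; rewrite mulr_suml; apply: word_span_sum => mu _.
  rewrite mulr_suml; apply: word_span_sum => nu _.
  by rewrite -scalerAl -mulrA -star_mul word_cons; exact: word_span_word.
Qed.

Lemma gspan_word n (mu : n.-tuple 'I_d) : gspan n 0 (word S mu).
Proof.
rewrite -{1}(size_tuple mu) /word; move: (tval mu) => s.
elim: s => [|i s IH]; first by rewrite big_nil; exact: gspan1.
by rewrite big_cons; exact: gspan_l.
Qed.

Lemma gspan_mul_row m x k y : gspan m 0 x -> gspan 0 k y -> gspan m k (x * y).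
Proof.
move=> gx; move: {-2}0%N (erefl 0%N) => z; move=> z0 gy; move: z0.
elim: gy => {z k y}.
- by move=> z k _; rewrite mulr0; exact: gspan_zero.
- by move=> c _; rewrite -scalerAr mulr1; exact: gspanZ.
- move=> z k c a b _ ga _ gb z0; rewrite mulrDr -scalerAr.
  by apply: gspan_lin; [exact: ga|exact: gb].
- by [].
- by move=> z k i a _ ga z0; rewrite mulrA; apply: gspan_r; exact: ga.
Qed.

Lemma core_levelP n x : core_level S n x <-> gspan n n x.
Proof.
split=> [[c ->]|/gspan_word_span //].
apply: gspan_sum => mu _; apply: gspan_sum => nu _; apply: gspanZ.
exact/gspan_mul_row/gspan_star/gspan_word/gspan_word.
Qed.

End CoreLevels.

Lemma gspan_core n x : gspan n n x -> core S x.
Proof. by move=> /core_levelP nx; apply: subset_closure; exists n. Qed.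

Lemma core_conv u x : (forall n, core S (u n)) -> conv u x -> core S x.
Proof. by move=> uc; apply: closed_conv uc; exact: closed_closure. Qed.

Lemma core_lin : cuntz_relations S -> forall (c : R[i]) x y,
  core S x -> core S y -> core S (c *: x + y).
Proof.
move=> S_rel; apply: closure_lincomb => c x y [m _ /core_levelP mx] [n _ /core_levelP ny].
exists (n + m)%N => //; apply/core_levelP.
apply: gspan_lin; first exact: gspan_raise_by.
by rewrite addnC; exact: gspan_raise_by.
Qed.

End CuntzAlgebra.

Section Generation.
Variables (R : realType) (d : nat) (A : cstarAlgType R) (S : 'I_d -> A).
Hypothesis hS : is_cuntz_algebra S.
Implicit Types (x y : A).

Lemma cuntz_rel : cuntz_relations S.
Proof. by case: hS. Qed.

(** The elements a such that G is stable under right multiplication by a and by a^*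
    form a closed star-subalgebra.  It contains the generators, so it is everything;
    apply it to 1, which is in G. *)
Lemma cuntz_generated (G : set A) : closed G ->
  (forall (c : R[i]) x y, G x -> G y -> G (c *: x + y)) -> G 1 ->
  (forall x i, G x -> G (x * S i)) -> (forall x i, G x -> G (x * star (S i))) ->
  forall x, G x.
Proof.
move=> cG linG G1 GS GS' x; have [_ gen _] := hS.
pose X := [set a | forall b, G b -> G (b * a) /\ G (b * star a)].
suff XT : X = setT.
  have Xx : X x by rewrite XT.
  by have [+ _] := Xx 1 G1; rewrite mul1r.
have G0 : G 0 by have := linG (-1) 1 1 G1 G1; rewrite scaleN1r addNr.
apply: gen => [|i b Gb]; last by split; [exact: GS|exact: GS'].
split.
- apply: closed_nrm => a happ b Gb.
  have /closure_seq[u uX ua] : closure X a by apply/closure_nrmP.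
  split.
    by apply: (@closed_conv R A _ (fun n => b * u n)) (convMl b ua) => // n; case: (uX n b Gb).
  apply: (@closed_conv R A _ (fun n => b * star (u n))) (convMl b (conv_star ua)) => // n.
  by case: (uX n b Gb).
- move=> c a a' Xa Xa' b Gb; have [h1 h2] := Xa b Gb; have [h3 h4] := Xa' b Gb.
  rewrite starD star_scale !mulrDr -!scalerAr; split; exact: linG.
- move=> a a' Xa Xa' b Gb; rewrite star_mul !mulrA; split.
    by have [/Xa'[]] := Xa b Gb.
  by have [_ /Xa[]] := Xa' b Gb.
- by move=> a Xa b Gb; rewrite starK; have [] := Xa b Gb.
Qed.

Lemma gpoly_dense : closure (gpoly S) = setT.
Proof.
apply/seteqP; split=> // x _; apply: (@cuntz_generated (closure (gpoly S))).
- exact: closed_closure.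
- by apply: closure_lincomb => c a b ga gb; apply: gpolyD gb; exact: gpolyZ.
- exact: subset_closure (gpoly_gspan (gspan1 S)).
- move=> a i; apply: (@closure_stable R A _ (fun b => b * S i) (nrm (S i))).
  + by move=> c b b'; rewrite mulrDl scalerAl.
  + by move=> b; rewrite mulrC nrmM.
  + by move=> b; exact: (gpoly_mulS cuntz_rel).
- move=> a i; apply: (@closure_stable R A _ (fun b => b * star (S i)) (nrm (star (S i)))).
  + by move=> c b b'; rewrite mulrDl scalerAl.
  + by move=> b; rewrite mulrC nrmM.
  + by move=> b; exact: gpoly_mulstarS.
Qed.

(** The main proof principle for continuous additive statements on the Cuntz
    algebra: they need only be checked on the spans of words. *)
Lemma cuntz_ind (P : set A) :
  (forall u x, (forall n, P (u n)) -> conv u x -> P x) ->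
  (forall x y, P x -> P y -> P (x + y)) ->
  (forall m n x, gspan S m n x -> P x) -> forall x, P x.
Proof.
move=> Pc PD Pg; apply: (dense_ind gpoly_dense) => // x.
by elim=> {x} [m n x /Pg //|x y _ Px _ Py]; exact: PD.
Qed.

Lemma star_hom_conv (B : cstarAlgType R) (f : A -> B) u x :
  unital_star_hom f -> conv u x -> conv (fun n => f (u n)) (f x).
Proof.
move=> hf; apply: (conv_lin (C := 1)); first by case: hf.
by move=> y; rewrite mul1r; exact: star_hom_contractive.
Qed.

Lemma star_hom_ext (B : cstarAlgType R) (f g : A -> B) :
  unital_star_hom f -> unital_star_hom g -> (forall i, f (S i) = g (S i)) ->
  forall x, f x = g x.
Proof.
move=> hf hg fg x; have [_ gen _] := hS.
have [fl [f1 fM] fs] := hf; have [gl [g1 gM] gs] := hg.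
suff -> : [set y | f y = g y] x by [].
rewrite (gen [set y | f y = g y]) //; split.
- apply: closed_nrm => y happ.
  have /closure_seq[u uX uy] : closure [set y | f y = g y] y by apply/closure_nrmP.
  apply: conv_unique (star_hom_conv hf uy) _.
  by apply: (conv_eventually (N := 0%N)) (star_hom_conv hg uy) => n _; rewrite uX.
- by move=> c y z /= fy fz; rewrite fl gl fy fz.
- by move=> y z /= fy fz; rewrite fM gM fy fz.
- by move=> y /= fy; rewrite fs gs fy.
Qed.

Lemma cuntz_endoP u : unitary u -> is_cuntz_endo S u (cuntz_endo S u).
Proof.
move=> [u1 u2]; apply: xgetPex; have [[r1 r2] _ univ] := hS.
have [|f hf fS] := univ A (fun i => u * S i).
  split=> [i j|].
    by rewrite star_mul -mulrA (mulrA (star u)) u1 mul1r r1.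
  under eq_bigr do rewrite star_mul -mulrA (mulrA (S _)) mulrA.
  by rewrite -mulr_suml -mulr_sumr r2 mulr1 u2.
by exists f.
Qed.

End Generation.

(** * A point of infinite order on the circle *)

Section CircleElement.
Variable R : realType.

(** Averaging over the powers of one point of infinite order separates the
    spectral components, as integration over the circle does; a rational point makes
    the infinite order an exercise in congruences. *)
Definition wc : R[i] := Complex (3 / 5) (4 / 5).

Lemma wc_conj : wc * conjc wc = 1.
Proof. by apply/eqP; rewrite eq_complex /=; apply/andP; split; apply/eqP; field. Qed.

Lemma wc_neq0 : wc != 0.
Proof.
by apply/eqP => w0; have := wc_conj; rewrite w0 mul0r => /esym/eqP; rewrite oner_eq0.
Qed.

Lemma wc_inv : conjc wc = wc^-1.
Proof. by apply: (mulfI wc_neq0); rewrite wc_conj divff // wc_neq0. Qed.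

Lemma cabs_wc : cabs wc = 1.
Proof.
apply/eqP; rewrite -(@eqrXn2 _ 2) ?expr1n ?nrm_ge0 //; apply/eqP/complexI.
by rewrite cabs_sqr wc_conj.
Qed.

Lemma cabs_wcX (k : int) : cabs (wc ^ k) = 1.
Proof.
case: k => n; first by rewrite -exprnP cabsX cabs_wc expr1n.
by rewrite NegzE -exprnN cabsV cabsX cabs_wc expr1n invr1.
Qed.

(** (3 + 4i)^m is congruent to 3 + 4i modulo 5, hence never equal to 5^m. *)
Lemma wc_exp_neq1 m : wc ^+ m.+1 != 1.
Proof.
have [p [q pq]] : exists p q : int,
    5 ^+ m.+1 * wc ^+ m.+1 = Complex (5 * p%:~R + 3) (5 * q%:~R + 4).
  elim: m => [|m [p [q IH]]].
    exists 0, 0; rewrite !expr1.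
    have -> : (5 : R[i]) = Complex 5 0 by rewrite -[5]/(5%:R) -[RHS]/((5 : R)%:C) rmorph_nat.
    by apply/eqP; rewrite eq_complex /=; apply/andP; split; apply/eqP; field.
  exists (3 * p - 4 * q - 2), (4 * p + 3 * q + 4).
  rewrite !(exprS _ m.+1) mulrACA IH.
  have -> : (5 : R[i]) = Complex 5 0 by rewrite -[5]/(5%:R) -[RHS]/((5 : R)%:C) rmorph_nat.
  rewrite !(rmorphB, rmorphD, rmorphM) /=.
  by apply/eqP; rewrite eq_complex /=; apply/andP; split; apply/eqP; field.
apply/eqP => w1; move: pq; rewrite w1 mulr1.
have -> : (5 ^+ m.+1 : R[i]) = (5 ^+ m.+1 : R)%:C by rewrite rmorphXn rmorph_nat.
case=> /eqP pm _; have : (5 ^+ m.+1 : int) == 5 * p + 3.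
  by rewrite -(eqr_int R) intrD intrM rmorphXn /=.
by rewrite exprS; move: (5 ^+ m : int) => t; lia.
Qed.

Lemma wcX_eq1 (k : int) : (wc ^ k == 1) = (k == 0).
Proof.
case: k => [[|n]|n]; first by rewrite expr0z !eqxx.
  by rewrite -exprnP (negPf (wc_exp_neq1 n)).
by rewrite NegzE -exprnN invr_eq1 (negPf (wc_exp_neq1 n)).
Qed.

Lemma wcXD (j k : int) : wc ^ (j + k) = wc ^ j * wc ^ k.
Proof. by rewrite expfzDr // wc_neq0. Qed.

Lemma wcX_conj (k : int) : conjc (wc ^ k) = wc ^ (- k).
Proof.
apply: (@mulfI _ (wc ^ k)); first exact: expfz_neq0 wc_neq0.
by rewrite -cabs_sqr cabs_wcX expr1n -wcXD subrr expr0z.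
Qed.

End CircleElement.

(** * Mean ergodic averages *)

Section CesaroMeans.
Variables (R : realType) (V : normedModType R[i]) (T : V -> V) (u : R[i]).
Hypotheses (T_lin : linear T) (T_contr : forall x, nrm (T x) <= nrm x).
Hypothesis u_unimod : cabs u = 1.

Definition cesaro n (x : V) : V :=
  (n.+1%:R^-1 : R[i]) *: \sum_(l < n.+1) u ^+ l *: iter l T x.

Lemma iter_lin l : linear (iter l T).
Proof. by elim: l => [|l IH] c x y //=; rewrite IH T_lin. Qed.

Lemma iter_contr l x : nrm (iter l T x) <= nrm x.
Proof. by elim: l => [|l IH] //=; apply: le_trans IH. Qed.

Lemma cesaro_lin n : linear (cesaro n).
Proof.
move=> c x y; rewrite /cesaro scalerA mulrC -scalerA -scalerDr; congr (_ *: _).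
rewrite scaler_sumr -big_split; apply: eq_bigr => l _ /=.
by rewrite iter_lin scalerDr !scalerA mulrC.
Qed.

Lemma cesaro_contr n x : nrm (cesaro n x) <= nrm x.
Proof.
rewrite nrmZ cabs_natV ler_pdivrMl ?ltr0Sn //.
apply: le_trans (nrm_sum _ _ _) _.
apply: le_trans (_ : \sum_(l < n.+1) nrm x <= _).
  apply: ler_sum => l _; rewrite nrmZ cabsX u_unimod expr1n mul1r.
  exact: iter_contr.
by rewrite sumr_const card_ord mulr_natl.
Qed.

Lemma iter_eigen (v : R[i]) x l : T x = v *: x -> iter l T x = v ^+ l *: x.
Proof.
move=> Tx; elim: l => [|l IH]; first by rewrite scale1r.
by rewrite /= IH (linZ T_lin) Tx scalerA -exprSr.
Qed.

Lemma cesaro_eigen (v : R[i]) x n : T x = v *: x ->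
  cesaro n x = (n.+1%:R^-1 * \sum_(l < n.+1) (u * v) ^+ l) *: x.
Proof.
move=> Tx; rewrite /cesaro -scalerA scaler_suml; congr (_ *: _).
by apply: eq_bigr => l _; rewrite (iter_eigen _ Tx) scalerA exprMn.
Qed.

(** On an eigenvector the average is that of a geometric series of ratio u v, which
    is bounded unless u v = 1. *)
Lemma cesaro_eigen_conv (v : R[i]) x : T x = v *: x -> cabs v = 1 ->
  conv (cesaro^~ x) (if u * v == 1 then x else 0).
Proof.
move=> Tx v1; case: eqP => [uv|/eqP uv].
  apply: (conv_eventually (N := 0%N)) (conv_cst x) => n _.
  rewrite (cesaro_eigen _ Tx) uv; under eq_bigr do rewrite expr1n.
  by rewrite sumr_const card_ord mulVf ?scale1r // pnatr_eq0.
have uv1 : u * v - 1 != 0 by rewrite subr_eq0.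
have c0 : 0 < cabs (u * v - 1).
  by rewrite lt_neqAle nrm_ge0 andbT eq_sym; apply: contra_neq uv1 => /nrm_eq0.
have x0 := nrm_ge0 x.
have K0 : 0 < 2 / cabs (u * v - 1) * (nrm x + 1).
  by rewrite mulr_gt0 ?divr_gt0 // ltr_wpDl.
move=> e e0; have e1 : 0 < e / (2 / cabs (u * v - 1) * (nrm x + 1)) by rewrite divr_gt0.
have [N _ hN] := near_infty_natSinv_lt (PosNum e1).
exists N => n Nn; rewrite subr0 (cesaro_eigen _ Tx) nrmZ cabsM cabs_natV.
have : n.+1%:R^-1 < e / (2 / cabs (u * v - 1) * (nrm x + 1)) := hN n Nn.
rewrite ltr_pdivlMr //; apply: le_lt_trans.
rewrite -mulrA ler_wpM2l ?invr_ge0 // ler_pM ?nrm_ge0 //; last by rewrite lerDl.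
rewrite ler_pdivlMr // mulrC -cabsM -subrX1.
apply: le_trans (nrmD _ _) _; rewrite nrmN -!/(cabs _) cabsX cabsM u_unimod v1.
by rewrite mulr1 expr1n cabs1.
Qed.

End CesaroMeans.

(** * The gauge automorphism and its spectral components *)

Section GaugeAction.
Variables (R : realType) (d : nat) (A : cstarAlgType R) (S : 'I_d -> A).
Hypothesis hS : is_cuntz_algebra S.
Implicit Types (x y : A) (k : int).
Local Notation w := (wc R).

Lemma unitary_scalar (z : R[i]) : z * conjc z = 1 -> unitary (z%:A : A).
Proof.
move=> z1; rewrite /unitary star_scalar -!scalerAl !mul1r !scalerA.
by rewrite mulrC z1 scale1r.
Qed.

Lemma gauge_gspan (z : R[i]) m n x : z * conjc z = 1 -> gspan S m n x ->
  cuntz_endo S z%:A x = (z ^+ m * conjc z ^+ n) *: x.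
Proof.
move=> z1 gx; have [[fl [f1 fM] fs] fS] := cuntz_endoP hS (unitary_scalar z1).
have {}fS i : cuntz_endo S z%:A (S i) = z *: S i by rewrite fS -scalerAl mul1r.
elim: gx => {m n x}.
- by move=> m n; rewrite (lin0 fl) scaler0.
- by move=> c; rewrite (linZ fl) f1 !expr0 mulr1 scale1r.
- by move=> m n c x y _ IHx _ IHy; rewrite fl IHx IHy scalerDr !scalerA mulrC.
- by move=> m n i x _ IH; rewrite fM fS IH -scalerAl -scalerAr scalerA exprS mulrA.
- move=> m n i x _ IH; rewrite fM IH fs fS star_scale -scalerAl -scalerAr scalerA.
  by rewrite exprSr mulrA.
Qed.

Definition gauge : A -> A := cuntz_endo S w%:A.

Lemma gauge_hom : unital_star_hom gauge.
Proof. by case: (cuntz_endoP hS (unitary_scalar (wc_conj R))). Qed.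

Lemma gauge_lin : linear gauge. Proof. by case: gauge_hom. Qed.

Lemma gaugeM x y : gauge (x * y) = gauge x * gauge y.
Proof. by case: gauge_hom => _ [_ h] _. Qed.

Lemma gauge_star x : gauge (star x) = star (gauge x).
Proof. by case: gauge_hom. Qed.

Lemma gauge_contr x : nrm (gauge x) <= nrm x.
Proof. exact: star_hom_contractive gauge_hom x. Qed.

Definition degree k x : Prop := gauge x = w ^ k *: x.

Lemma gspan_degree m n x : gspan S m n x -> degree (m%:Z - n%:Z) x.
Proof.
move=> gx; rewrite /degree /gauge (gauge_gspan (wc_conj R) gx) wc_inv wcXD.
by rewrite -exprnN exprVn -exprnP.
Qed.

Lemma degreeM j k x y : degree j x -> degree k y -> degree (j + k) (x * y).
Proof.
by rewrite /degree gaugeM => -> ->; rewrite -scalerAl -scalerAr scalerA wcXD.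
Qed.

Lemma degree_star k x : degree k x -> degree (- k) (star x).
Proof. by rewrite /degree gauge_star => ->; rewrite star_scale wcX_conj. Qed.

Lemma degreeD k x y : degree k x -> degree k y -> degree k (x + y).
Proof. by rewrite /degree (linD gauge_lin) => -> ->; rewrite scalerDr. Qed.

Lemma degree_conv k u x : (forall n, degree k (u n)) -> conv u x -> degree k x.
Proof.
move=> uk ux; apply: conv_unique (star_hom_conv gauge_hom ux) _.
by apply: (conv_eventually (N := 0%N)) (convZ (w ^ k) ux) => n _; rewrite uk.
Qed.

Lemma core_degree0 x : core S x -> degree 0 x.
Proof.
move=> /closure_seq[u uc]; apply: degree_conv => n.
by have [m _ /core_levelP/gspan_degree] := uc n; rewrite subrr.
Qed.

(** The mean of w^(-kl) gauge^l x over l; the limit exists because it exists on words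
    and the averages are contractive. *)
Definition fourier k x : A := xget 0 [set l | conv (fun n => cesaro gauge (w ^ (- k)) n x) l].

Lemma fourier_exists k : exists E : A -> A, [/\ linear E, bounded_by 1 E &
  forall x, conv (fun n => cesaro gauge (w ^ (- k)) n x) (E x)].
Proof.
have wk : cabs (w ^ (- k)) = 1 by exact: cabs_wcX.
apply: (strong_limit ler01 _ _ (gpoly_dense hS)) => [n|n x|x].
- exact: (cesaro_lin _ gauge_lin).
- by rewrite mul1r; apply: cesaro_contr => //; exact: gauge_contr.
elim=> {x} [m n x /gspan_degree xmn|x y _ [a ax] _ [b bx]].
  exists (if w ^ (- k) * w ^ (m%:Z - n%:Z) == 1 then x else 0).
  by apply: cesaro_eigen_conv => //; [exact: gauge_lin|exact: cabs_wcX].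
exists (a + b); apply: (conv_eventually (N := 0%N)) (convD ax bx) => n _.
by rewrite (linD (cesaro_lin _ gauge_lin _)).
Qed.

Lemma fourier_conv k x : conv (fun n => cesaro gauge (w ^ (- k)) n x) (fourier k x).
Proof.
by have [E [_ _ EP]] := fourier_exists k; apply: xgetPex; exists (E x); exact: EP.
Qed.

Lemma fourierE k : exists2 E : A -> A, linear E /\ bounded_by 1 E & fourier k = E.
Proof.
have [E [El E1 EP]] := fourier_exists k; exists E => //; apply/funext => x.
exact: conv_unique (fourier_conv k x) (EP x).
Qed.

Lemma fourier_lin k : linear (fourier k).
Proof. by have [E [El _] ->] := fourierE k. Qed.

Lemma fourier_contr k x : nrm (fourier k x) <= nrm x.
Proof. by have [E [_ E1] ->] := fourierE k; rewrite -[leRHS]mul1r. Qed.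

Lemma conv_fourier k u x : conv u x -> conv (fun n => fourier k (u n)) (fourier k x).
Proof.
apply: (conv_lin (C := 1)); first exact: fourier_lin.
by move=> y; rewrite mul1r; exact: fourier_contr.
Qed.

Lemma fourier_eigen j k x : degree j x -> fourier k x = if j == k then x else 0.
Proof.
move=> xj; apply: conv_unique (fourier_conv k x) _.
have := cesaro_eigen_conv gauge_lin (cabs_wcX _ (- k)) xj (cabs_wcX _ j).
by rewrite -wcXD wcX_eq1 addrC subr_eq0.
Qed.

Lemma fourier_id k x : degree k x -> fourier k x = x.
Proof. by move=> /(fourier_eigen k) ->; rewrite eqxx. Qed.

Lemma fourier_degree k x : degree k (fourier k x).
Proof.
move: x; apply: (cuntz_ind hS) => [u x uk ux|x y xk yk|m n x gx].
- exact: degree_conv uk (conv_fourier k ux).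
- by rewrite (linD (fourier_lin k)); exact: degreeD.
rewrite (fourier_eigen k (gspan_degree gx)); case: eqP => [<-|_].
  exact: gspan_degree.
by rewrite /degree scaler0 (lin0 gauge_lin).
Qed.

Lemma fourier0_core x : core S (fourier 0 x).
Proof.
move: x; apply: (cuntz_ind hS) => [u x uk ux|x y xk yk|m n x gx].
- exact: core_conv uk (conv_fourier 0 ux).
- rewrite (linD (fourier_lin 0)) -[fourier 0 x]scale1r.
  exact: core_lin (cuntz_rel hS) _ _ _ xk yk.
rewrite (fourier_eigen 0 (gspan_degree gx)); case: eqP => [/eqP|_].
  by rewrite subr_eq0 => /eqP[mn]; rewrite mn in gx; exact: gspan_core gx.
exact: gspan_core (gspan_zero S 0 0).
Qed.

(** An element of degree 0 is its own component of degree 0, and taking this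
    component maps the span of all words into the core. *)
Lemma degree0_core x : degree 0 x <-> core S x.
Proof.
by split=> [/fourier_id <-|]; [exact: fourier0_core|exact: core_degree0].
Qed.

Lemma fourier_commute k (f : A -> A) : unital_star_hom f ->
  (forall x, f (gauge x) = gauge (f x)) -> forall x, f (fourier k x) = fourier k (f x).
Proof.
move=> hf fg x; have [fl _ _] := hf.
apply: conv_unique (star_hom_conv hf (fourier_conv k x)) _.
apply: (conv_eventually (N := 0%N)) (fourier_conv k (f x)) => n _.
rewrite /cesaro (linZ fl) (lin_sum fl); congr (_ *: _); apply: eq_bigr => l _.
rewrite (linZ fl); congr (_ *: _).
by elim: (l : nat) => [|p IH] //=; rewrite fg IH.
Qed.

End GaugeAction.

(** * Fejer means *)

Section FiniteLimits.
Variables (R : realType) (V : normedModType R[i]).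

Lemma conv_sum (I : Type) (r : seq I) (P : pred I) (u : I -> nat -> V) (l : I -> V) :
  (forall i, P i -> conv (u i) (l i)) ->
  conv (fun n => \sum_(i <- r | P i) u i n) (\sum_(i <- r | P i) l i).
Proof.
move=> ul; elim: r => [|i r IH].
  rewrite big_nil; apply: (conv_eventually (N := 0%N)) (conv_cst 0) => n _.
  by rewrite big_nil.
rewrite big_cons; case: ifP => Pi.
  apply: (conv_eventually (N := 0%N)) (convD (ul i Pi) IH) => n _.
  by rewrite big_cons Pi.
by apply: (conv_eventually (N := 0%N)) IH => n _; rewrite big_cons Pi.
Qed.

Lemma conv_natV (x : V) : conv (fun n => (n.+1%:R^-1 : R[i]) *: x) 0.
Proof.
move=> e e0; have x0 := nrm_ge0 x.
have e1 : 0 < e / (nrm x + 1) by rewrite divr_gt0 // ltr_wpDl.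
have [N _ hN] := near_infty_natSinv_lt (PosNum e1).
exists N => n Nn; rewrite subr0 nrmZ cabs_natV.
have : n.+1%:R^-1 < e / (nrm x + 1) := hN n Nn.
rewrite ltr_pdivlMr ?ltr_wpDl //; apply: le_lt_trans.
by rewrite ler_wpM2l ?invr_ge0 // lerDl.
Qed.

End FiniteLimits.

Lemma sum_ord_eq M q : (\sum_(i < M) (i == q :> nat) = (q < M))%N.
Proof.
case: ltnP => qM; last first.
  by rewrite big1 // => i _; case: eqP => // iq; have := ltn_ord i; lia.
rewrite (bigD1 (Ordinal qM)) //= eqxx big1 // => i.
by rewrite -val_eqE /= => /negPf ->.
Qed.

(** This count is the Fejer coefficient of frequency p. *)
Lemma count_diagonal M p : (\sum_(j < M) \sum_(i < M) (i == j + p :> nat) = M - p)%N.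
Proof.
under eq_bigr do rewrite sum_ord_eq.
rewrite -(big_mkord xpredT (fun j => (j + p < M)%N : nat)).
rewrite (@big_cat_nat _ _ _ (M - p)%N) ?leq_subr //=.
rewrite [X in (_ + X)%N]big1_seq ?addn0; last first.
  by move=> j; rewrite mem_index_iota => /andP[_ jM]; case: ltnP => //; lia.
rewrite (eq_big_nat _ _ (F2 := fun=> 1%N)); last by move=> j jM; case: ltnP => //; lia.
by rewrite sum_nat_const_nat muln1 subn0.
Qed.

Section Fejer.
Variables (R : realType) (d : nat) (A : cstarAlgType R) (S : 'I_d -> A).
Hypothesis hS : is_cuntz_algebra S.
Implicit Types (x y : A) (k : int).
Local Notation w := (wc R).

(** The Fejer mean sum_k (1 - |k| / (N + 1)) fourier k, written as a double sum so that
    the positivity of its kernel is visible. *)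
Definition fejer N x : A := (N.+1%:R^-1 : R[i]) *:
  \sum_(j < N.+1) \sum_(i < N.+1) fourier S (j%:Z - i%:Z) x.

(** The approximation of [fejer] by averages over the powers of the gauge
    automorphism. *)
Definition fejer_mean N n x : A := (N.+1%:R^-1 : R[i]) *:
  \sum_(j < N.+1) \sum_(i < N.+1) cesaro (gauge S) (w ^ (- (j%:Z - i%:Z))) n x.

Lemma fejer_mean_conv N x : conv (fun n => fejer_mean N n x) (fejer N x).
Proof.
by apply/convZ/conv_sum => j _; apply: conv_sum => i _; exact: fourier_conv.
Qed.

(** The Fejer kernel at w^l, as the square modulus of a trigonometric polynomial. *)
Definition fejer_weight N l : R :=
  N.+1%:R^-1 * cabs (\sum_(j < N.+1) (w ^ (- j%:Z)) ^+ l) ^+ 2.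

Lemma fejer_weight_ge0 N l : 0 <= fejer_weight N l.
Proof. by rewrite mulr_ge0 ?invr_ge0 ?sqr_ge0. Qed.

Lemma fejer_meanE N n x : fejer_mean N n x =
  (n.+1%:R^-1 : R[i]) *: \sum_(l < n.+1) (fejer_weight N l)%:C *: iter l (gauge S) x.
Proof.
rewrite /fejer_mean /cesaro.
under eq_bigr do rewrite -scaler_sumr exchange_big /=.
rewrite -scaler_sumr scalerA mulrC -scalerA; congr (_ *: _).
rewrite exchange_big scaler_sumr; apply: eq_bigr => l _ /=.
have -> : (fejer_weight N l)%:C = N.+1%:R^-1 *
    \sum_(j < N.+1) \sum_(i < N.+1) (w ^ (- (j%:Z - i%:Z))) ^+ l.
  have morph (a b : R) : (a * b)%:C = a%:C * b%:C by exact: rmorphM.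
  rewrite /fejer_weight morph fmorphV rmorph_nat cabs_sqr; congr (_ * _).
  rewrite rmorph_sum mulr_suml; apply: eq_bigr => j _.
  rewrite mulr_sumr; apply: eq_bigr => i _.
  transitivity ((w ^ (- j%:Z)) ^+ l * conjc ((w ^ (- i%:Z)) ^+ l)); first by [].
  by rewrite conjcX wcX_conj -exprMn -wcXD opprB opprK addrC.
rewrite -scalerA; congr (_ *: _); rewrite scaler_suml; apply: eq_bigr => j _.
by rewrite scaler_suml.
Qed.

(** The weights are nonnegative, so the norm of the averaging operator is the sum of
    its weights, which is its value at 1. *)
Lemma fejer_mean_le N n x : nrm (fejer_mean N n x) <= nrm x * nrm (fejer_mean N n 1).
Proof.
have g1 l : iter l (gauge S) 1 = 1.
  by elim: l => // l IH; rewrite iterS IH; case: (gauge_hom hS) => _ [].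
rewrite !fejer_meanE [X in _ <= _ * nrm (_ *: X)](_ : _ =
    (\sum_(l < n.+1) fejer_weight N l)%:C *: 1); last first.
  by rewrite rmorph_sum scaler_suml; apply: eq_bigr => l _; rewrite g1.
have W0 : 0 <= \sum_(l < n.+1) fejer_weight N l.
  by apply: sumr_ge0 => l _; exact: fejer_weight_ge0.
rewrite !nrmZ cabs_natV cabs_real // nrm1 mulr1 mulrCA.
rewrite ler_wpM2l ?invr_ge0 // mulrC mulr_suml.
apply: le_trans (nrm_sum _ _ _) _; apply: ler_sum => l _.
rewrite nrmZ cabs_real ?fejer_weight_ge0 //.
rewrite ler_wpM2l ?fejer_weight_ge0 //; apply: iter_contr.
exact: gauge_contr.
Qed.

Lemma fejer_lin N : linear (fejer N).
Proof.
move=> c x y; rewrite /fejer scalerA mulrC -scalerA -scalerDr; congr (_ *: _).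
rewrite scaler_sumr -big_split; apply: eq_bigr => j _ /=.
rewrite scaler_sumr -big_split; apply: eq_bigr => i _ /=.
by rewrite (fourier_lin hS).
Qed.

Lemma fejer_degree N k x : degree S k x ->
  fejer N x = (N.+1%:R^-1 * (N.+1 - `|k|)%:R) *: x.
Proof.
move=> xk; rewrite /fejer -scalerA; congr (_ *: _).
rewrite -count_diagonal natr_sum scaler_suml.
have term (j i : 'I_N.+1) : fourier S (j%:Z - i%:Z) x = (k == j%:Z - i%:Z)%:R *: x.
  by rewrite (fourier_eigen hS _ xk); case: eqP; rewrite ?scale1r ?scale0r.
case: (leP 0 k) => k0.
  rewrite exchange_big; apply: eq_bigr => i _ /=.
  rewrite natr_sum scaler_suml; apply: eq_bigr => j _.
  by rewrite term; congr (_%:R *: _); congr nat_of_bool; apply/eqP/eqP; lia.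
apply: eq_bigr => j _ /=; rewrite natr_sum scaler_suml; apply: eq_bigr => i _.
by rewrite term; congr (_%:R *: _); congr nat_of_bool; apply/eqP/eqP; lia.
Qed.

(** In the limit the bound [fejer_mean_le] becomes |x| |fejer N 1|, and
    fejer N 1 = 1. *)
Lemma fejer_contr N x : nrm (fejer N x) <= nrm x.
Proof.
rewrite -[leRHS]mulr1 -(nrm1 A).
have <- : fejer N 1 = 1.
  rewrite (@fejer_degree N 0) ?subn0 ?mulVf ?scale1r ?pnatr_eq0 //.
  by have := gspan_degree hS (gspan1 S); rewrite subrr.
apply: conv_nrm_le (nrm_ge0 x) (fejer_mean_conv N 1) (fejer_mean_conv N x) _ => n.
exact: fejer_mean_le.
Qed.

Lemma fejer_conv x : conv (fejer^~ x) x.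
Proof.
move: x; apply: (cuntz_ind hS) => [u x uc ux e e0|x y xc yc|m n x gx].
- have e3 : 0 < e / 3 by rewrite divr_gt0.
  have [M hM] := ux _ e3; have [N hN] := uc M _ e3; exists N => n /hN.
  have := fejer_contr n (x - u M); rewrite (linB (fejer_lin n)) (nrmB x).
  have := hM M (leqnn M); have := nrm_dist (fejer n x) (fejer n (u M)) x.
  have := nrm_dist (fejer n (u M)) (u M) x; lra.
- apply: (conv_eventually (N := 0%N)) (convD xc yc) => n _.
  by rewrite (linD (fejer_lin n)).
have := convZ (- `|m%:Z - n%:Z|%:R) (conv_natV x); rewrite scaler0 => h0.
have := convD (conv_cst x) h0; rewrite addr0.
apply: (conv_eventually (N := `|m%:Z - n%:Z|%N)) => N NN.
rewrite (fejer_degree N (gspan_degree hS gx)) natrB ?(leq_trans NN) //.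
rewrite mulrBr mulVf ?pnatr_eq0 // scalerBl scale1r -scaleNr; congr (x + _).
by apply: etrans (scalerA _ _ _) _; congr (_ *: _); rewrite mulNr mulrC.
Qed.

(** All Fejer means of such an x are equal to its component of degree 0. *)
Lemma fourier0_only x : (forall k, k != 0 -> fourier S k x = 0) -> core S x.
Proof.
move=> x0; apply/(degree0_core hS); rewrite -[x](_ : fourier S 0 x = _).
  exact: fourier_degree.
apply: conv_unique (_ : conv (fejer^~ x) _) (fejer_conv x).
apply: (conv_eventually (N := 0%N)) (conv_cst _) => N _; rewrite /fejer.
rewrite (eq_bigr (fun=> fourier S 0 x)) => [|j _].
  by rewrite sumr_const card_ord -[fourier S 0 x *+ _]scaler_nat scalerA mulVf ?scale1r ?pnatr_eq0.
rewrite (bigD1 j) //= subrr big1 ?addr0 // => i; rewrite -val_eqE /= => ij.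
by apply: x0; lia.
Qed.

End Fejer.

(** * The conditional expectation as a Riemann integral *)

Section Circle.
Variable R : realType.
Implicit Types (a b c s t : R).

Lemma expiD a b : expi (a + b) = expi a * expi b.
Proof. by rewrite /expi cosD sinD; apply/eqP; rewrite eq_complex /= eqxx addrC eqxx. Qed.

Lemma expi0 : expi (0 : R) = 1.
Proof. by rewrite /expi cos0 sin0. Qed.

Lemma expi_conj t : conjc (expi t) = expi (- t).
Proof. by rewrite /expi cosN sinN. Qed.

Lemma expi_unimod t : expi t * conjc (expi t) = 1.
Proof. by rewrite expi_conj -expiD subrr expi0. Qed.

Lemma expiX t n : expi t ^+ n = expi (n%:R * t).
Proof.
elim: n => [|n IH]; first by rewrite expr0 mul0r expi0.
by rewrite exprS IH -expiD -natr1 mulrDl mul1r addrC.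
Qed.

Lemma expi2pi : expi (2 * pi : R) = 1.
Proof. by rewrite /expi mulr_natl cos2pi sin2pi. Qed.

Lemma between_dist a b x s : a <= x <= b -> a <= s <= b -> `|x - s| <= b - a.
Proof. by move=> /andP[? ?] /andP[? ?]; rewrite ler_norml; apply/andP; split; lra. Qed.

(** The point s is any point between a and b, whichever is larger; both signs occur
    below, as the frequency may be negative. *)
Lemma mean_value (f df : R -> R) a b s :
  (forall x : R, is_derive x 1 f (df x)) -> continuous f ->
  (a <= s <= b) || (b <= s <= a) ->
  exists2 x, f b - f a = df x * (b - a) & `|x - s| <= `|b - a|.
Proof.
move=> fd fc.
have mvt a' b' : a' <= b' -> exists2 x, x \in `[a', b']%R & f b' - f a' = df x * (b' - a').
  by move=> ab; apply: (MVT_segment ab (fun x _ => fd x)); exact: continuous_subspaceT.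
case/orP => asb; have [h1 h2] := andP asb; have [x] := mvt _ _ (le_trans h1 h2).
  rewrite in_itv /= => xab fab; exists x => //; apply: le_trans (between_dist xab asb) _.
  exact: ler_norm.
rewrite in_itv /= => xab fab; exists x.
  by rewrite -[LHS]opprB fab; ring.
by rewrite (distrC b); apply: le_trans (ler_norm _); exact: between_dist.
Qed.

Lemma sin_lip a b : `|sin b - sin a| <= `|b - a|.
Proof.
have [x -> _] : exists2 x, sin b - sin a = cos x * (b - a) & `|x - a| <= `|b - a|.
  apply: mean_value => [x|]; last by case: (leP a b) => h; rewrite ?lexx ?(ltW h) ?orbT ?h.
  exact: continuous_sin.
rewrite normrM ler_piMl // ler_norml cos_le1 andbT; exact: cos_geN1.
Qed.

Lemma cos_lip a b : `|cos b - cos a| <= `|b - a|.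
Proof.
have [x -> _] : exists2 x, cos b - cos a = - sin x * (b - a) & `|x - a| <= `|b - a|.
  apply: (mean_value (df := fun x => - sin x)) => [x|]; last first.
    by case: (leP a b) => h; rewrite ?lexx ?(ltW h) ?orbT ?h.
  exact: continuous_cos.
rewrite normrM normrN ler_piMl // ler_norml sin_le1 andbT; exact: sin_geN1.
Qed.

Lemma cabs_i : cabs ('i%C : R[i]) = 1.
Proof.
apply/eqP; rewrite -(@eqrXn2 _ 2) ?expr1n ?nrm_ge0 //; apply/eqP/complexI.
by rewrite cabs_sqr; apply/eqP; rewrite eq_complex /=; apply/andP; split; apply/eqP; ring.
Qed.

Lemma cabs_le (x y : R) : cabs (Complex x y) <= `|x| + `|y|.
Proof.
have absr (r : R) : cabs r%:C = `|r|.
  by apply: complexI; rewrite -cabsE normc_def /= expr0n addr0 sqrtr_sqr.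
rewrite [Complex x y]complexE /=; apply: le_trans (nrmD _ _) _.
by rewrite -/(cabs _) absr lerD2l -/(cabs _) cabsM cabs_i mul1r absr.
Qed.

(** The function t |-> expi (c t) has derivative i c expi (c s) at s; the two parts
    of the increment are evaluated by the mean value theorem. *)
Lemma expi_increment c a b s : a <= s <= b ->
  cabs ((b - a)%:C * ('i%C * c%:C * expi (c * s)) - (expi (c * b) - expi (c * a)))
    <= 2 * c ^+ 2 * (b - a) ^+ 2.
Proof.
move=> /andP[sa sb].
have cs : (c * a <= c * s <= c * b) || (c * b <= c * s <= c * a).
  by apply/orP; case: (lerP 0 c) => c0; [left|right]; apply/andP; split; nra.
have [x xE xs] := mean_value (@is_derive_sin R) (@continuous_sin R) cs.
have [y yE ys] := mean_value (@is_derive_cos R) (@continuous_cos R) cs.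
have -> : (b - a)%:C * ('i%C * c%:C * expi (c * s)) - (expi (c * b) - expi (c * a))
   = Complex ((sin y - sin (c * s)) * (c * (b - a))) ((cos (c * s) - cos x) * (c * (b - a))).
  apply/eqP; rewrite eq_complex /expi /=; apply/andP; split; apply/eqP.
    by rewrite yE; ring.
  by rewrite xE; ring.
apply: le_trans (cabs_le _ _) _; rewrite !normrM -mulrDl.
have ab : `|b - a| = b - a by rewrite ger0_norm //; lra.
rewrite -mulrBr normrM ab in xs; rewrite -mulrBr normrM ab in ys.
have sin_le := le_trans (sin_lip (c * s) y) ys.
have cos_le := cos_lip x (c * s); rewrite (distrC (c * s)) in cos_le.
have {}cos_le := le_trans cos_le xs.
have K0 : 0 <= `|c| * (b - a) by rewrite mulr_ge0 // subr_ge0 (le_trans sa).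
rewrite ab -(real_normK (num_real c)).
have -> : 2 * `|c| ^+ 2 * (b - a) ^+ 2 = (2 * (`|c| * (b - a))) * (`|c| * (b - a)) by ring.
by apply: ler_wpM2r => //; rewrite (mulrC 2) mulr_natr mulr2n lerD.
Qed.

End Circle.

Section RiemannSums.
Variables (R : realType) (V : normedModType R[i]).

Definition tagged (a b delta : R) (n : nat) (p s : nat -> R) : Prop :=
  [/\ p 0%N = a, p n = b &
    forall i, (i < n)%N -> p i <= s i <= p i.+1 /\ p i.+1 - p i < delta].

Definition riemann_sum (f : R -> V) (n : nat) (p s : nat -> R) : V :=
  \sum_(0 <= i < n) (p i.+1 - p i)%:C *: f (s i).

Lemma tagged_sum a b delta n p s : tagged a b delta n p s ->
  \sum_(0 <= i < n) (p i.+1 - p i) = b - a.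
Proof. by case=> <- <- _; rewrite telescope_sumr. Qed.

Lemma tagged_step a b delta n p s i : tagged a b delta n p s -> (i < n)%N ->
  0 <= p i.+1 - p i.
Proof. by case=> _ _ h /h[/andP[sa sb] _]; lra. Qed.

Lemma riemann_sum_le a b delta n p s (f : R -> V) C : tagged a b delta n p s ->
  (forall t, nrm (f t) <= C) -> nrm (riemann_sum f n p s) <= (b - a) * C.
Proof.
move=> tag fC; apply: le_trans (nrm_sum _ _ _) _; rewrite -(tagged_sum tag) mulr_suml.
rewrite !big_nat; apply: ler_sum => i /andP[_ iN].
by rewrite nrmZ cabs_real ?(tagged_step tag) // ler_wpM2l ?(tagged_step tag).
Qed.

Lemma is_riemann_integralP (f : R -> V) a b I :
  is_riemann_integral f a b I <->
  forall eps : R, 0 < eps -> exists2 delta : R, 0 < delta &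
    forall n p s, tagged a b delta n p s -> nrm (riemann_sum f n p s - I) < eps.
Proof.
split=> h eps /h[dl dl0 hd]; exists dl => // n p s.
  by move=> [p0 pn ps]; rewrite nrm_lt; exact: hd.
by move=> p0 pn ps; rewrite -nrm_lt; exact: hd.
Qed.

Lemma tagged_exists (a b delta : R) : a <= b -> 0 < delta ->
  exists n p s, tagged a b delta n p s.
Proof.
move=> ab d0.
have e0 : 0 < delta / (b - a + 1) by rewrite divr_gt0 //; lra.
have [N _ /(_ N (leqnn N)) hN] := near_infty_natSinv_lt (PosNum e0).
have {}hN : N.+1%:R^-1 < delta / (b - a + 1) by [].
pose p (i : nat) : R := a + i%:R * ((b - a) / N.+1%:R).
have step i : p i.+1 - p i = (b - a) / N.+1%:R by rewrite /p -natr1; ring.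
have st0 : 0 <= (b - a) / N.+1%:R by rewrite divr_ge0 //; lra.
exists N.+1, p, p; split=> [||i _].
- by rewrite /p mul0r addr0.
- by rewrite /p mulrC divfK ?pnatr_eq0 //; ring.
- rewrite step lexx /= -subr_ge0 step; split=> //.
  move: hN; rewrite ltr_pdivlMr; last by lra.
  apply: le_lt_trans; rewrite mulrC ler_wpM2l ?invr_ge0 //; lra.
Qed.

(** Compare two integrals on a partition fine enough for both. *)
Lemma riemann_unique (f : R -> V) a b I I' : a <= b ->
  is_riemann_integral f a b I -> is_riemann_integral f a b I' -> I = I'.
Proof.
move=> ab /is_riemann_integralP fI /is_riemann_integralP fI'.
apply/eqP; rewrite -subr_eq0; apply/eqP/nrm_small_eq0 => e e0.
have e2 : 0 < e / 2 by rewrite divr_gt0.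
have [d1 d10 h1] := fI _ e2; have [d2 d20 h2] := fI' _ e2.
have [|n [p [s [p0 pn ps]]]] := @tagged_exists a b (Num.min d1 d2) ab.
  by rewrite lt_min d10.
have := h1 n p s; have := h2 n p s.
have t1 : tagged a b d1 n p s.
  by split=> // i /ps[? +]; rewrite lt_min => /andP[].
have t2 : tagged a b d2 n p s.
  by split=> // i /ps[? +]; rewrite lt_min => /andP[].
move=> /(_ t2) + /(_ t1); set r := riemann_sum _ _ _ _.
have := nrm_dist I r I'; rewrite (nrmB I r); lra.
Qed.

Lemma riemann_integralE (f : R -> V) a b I : a <= b ->
  is_riemann_integral f a b I -> riemann_integral f a b = I.
Proof.
move=> ab fI; have fI' : is_riemann_integral f a b (riemann_integral f a b).
  by apply: xgetPex; exists I.
exact: riemann_unique ab fI' fI.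
Qed.

End RiemannSums.

Section ExpectationIntegral.
Variables (R : realType) (d : nat) (A : cstarAlgType R) (S : 'I_d -> A).
Hypothesis hS : is_cuntz_algebra S.
Implicit Types (x y : A).

Let orb x (t : R) : A := cuntz_endo S (expi t)%:A x.

Let twopi : 0 < 2 * pi :> R. Proof. by rewrite mulr_gt0 // pi_gt0. Qed.

Lemma orbit_hom t : unital_star_hom (fun x => orb x t).
Proof. by case: (cuntz_endoP hS (unitary_scalar A (expi_unimod t))). Qed.

(** On a word of degree k the integrand is expi (k t) x.  If k = 0 every Riemann sum
    is exact; otherwise i k times the Riemann sum differs from the telescoping sum of
    the increments of expi (k t), which vanishes over a period, by a multiple of the
    mesh.  Riemann sums are bounded by 2 pi |x|, which gives the general case by
    density. *)
Lemma orbit_riemann x :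
  is_riemann_integral (orb x) 0 (2 * pi) ((2 * pi)%:C *: fourier S 0 x).
Proof.
pose I x := (2 * pi)%:C *: fourier S 0 x.
have I_le x0 : nrm (I x0) <= 2 * pi * nrm x0.
  rewrite nrmZ cabs_real ?(ltW twopi) // ler_wpM2l ?(ltW twopi) //.
  exact: fourier_contr.
have IB x0 y0 : I (x0 - y0) = I x0 - I y0 by rewrite /I (linB (fourier_lin hS 0)) scalerBr.
have sumD x0 y0 n p s : riemann_sum (orb (x0 + y0)) n p s
    = riemann_sum (orb x0) n p s + riemann_sum (orb y0) n p s.
  rewrite /riemann_sum -big_split; apply: eq_bigr => i _ /=.
  by rewrite -scalerDr; have [fl _ _] := orbit_hom (s i); rewrite (linD fl).
have orb_le x0 t : nrm (orb x0 t) <= nrm x0 by exact: (star_hom_contractive (orbit_hom t)).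
move: x; apply: (cuntz_ind hS) => [u x uc ux|x y|m n x gx]; last 1 first.
- apply/is_riemann_integralP => e e0.
  have orbE t : orb x t = expi ((m%:R - n%:R) * t) *: x.
    rewrite /orb (gauge_gspan hS (expi_unimod t) gx) expi_conj !expiX -expiD.
    by congr (expi _ *: _); ring.
  rewrite (fourier_eigen hS _ (gspan_degree hS gx)) subr_eq0.
  have [/eqP[mn]|mn] := boolP (m%:Z == n%:Z).
    exists 1 => // k p s tag; rewrite /riemann_sum.
    under eq_bigr do rewrite orbE mn subrr mul0r expi0 scale1r.
    rewrite -scaler_suml -rmorph_sum /= (tagged_sum tag) subr0 -scalerBl subrr scale0r.
    by rewrite nrm0.
  have c0 : m%:R - n%:R != 0 :> R by rewrite subr_eq0 eqr_nat.
  set c : R := m%:R - n%:R in c0 orbE.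
  have c0' : 0 < `|c| by rewrite normr_gt0.
  have x0 := nrm_ge0 x; have x1 : 0 < nrm x + 1 by lra.
  have K0 : 0 < 2 * `|c| * (2 * pi) * (nrm x + 1) by rewrite !mulr_gt0 // pi_gt0.
  exists (e / (2 * `|c| * (2 * pi) * (nrm x + 1))); first by rewrite divr_gt0.
  move=> k p s tag; rewrite scaler0 subr0.
  have -> : riemann_sum (orb x) k p s
      = (\sum_(0 <= i < k) (p i.+1 - p i)%:C * expi (c * s i)) *: x.
    rewrite scaler_suml; apply: eq_bigr => i _; rewrite orbE scalerA //.
  set Sg := \sum_(0 <= i < k) _; rewrite nrmZ.
  have end0 : \sum_(0 <= i < k) (expi (c * p i.+1) - expi (c * p i)) = 0.
    rewrite telescope_sumr //; case: tag => -> -> _.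
    have -> : c * (2 * pi) = m%:R * (2 * pi) + - (n%:R * (2 * pi)) by rewrite /c; ring.
    by rewrite expiD -expi_conj -(expiX (2 * pi) m) -(expiX (2 * pi) n) expi2pi
      !expr1n conjc1 mulr0 expi0 mulr1 subrr.
  have cSg : cabs Sg * `|c| <=
      2 * c ^+ 2 * (\sum_(0 <= i < k) (p i.+1 - p i) ^+ 2).
    have -> : cabs Sg * `|c| = cabs ('i%C * c%:C * Sg).
      rewrite !cabsM cabs_i mul1r mulrC; congr (_ * _).
      by apply: complexI; rewrite -cabsE normc_def /= expr0n addr0 sqrtr_sqr.
    have -> : 'i%C * c%:C * Sg = \sum_(0 <= i < k)
       ((p i.+1 - p i)%:C * ('i%C * c%:C * expi (c * s i))
          - (expi (c * p i.+1) - expi (c * p i))).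
      rewrite sumrB end0 subr0 mulr_sumr; apply: eq_bigr => i _.
      by rewrite mulrCA.
    apply: le_trans (nrm_sum _ _ _) _; rewrite mulr_sumr !big_nat.
    apply: ler_sum => i /andP[_ ik]; apply: expi_increment.
    by case: tag => _ _ /(_ i ik)[].
  have dS : \sum_(0 <= i < k) (p i.+1 - p i) ^+ 2
      <= e / (2 * `|c| * (2 * pi) * (nrm x + 1)) * (2 * pi).
    rewrite -[X in _ * X]subr0 -(tagged_sum tag) mulr_sumr !big_nat.
    apply: ler_sum => i /andP[_ ik]; rewrite expr2 ler_wpM2r ?(tagged_step tag) //.
    by case: tag => _ _ /(_ i ik)[_ /ltW].
  have cS : cabs Sg <= 2 * `|c| * (e / (2 * `|c| * (2 * pi) * (nrm x + 1)) * (2 * pi)).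
    rewrite -(ler_pM2r c0'); apply: le_trans cSg _.
    rewrite -(real_normK (num_real c)).
    rewrite [leRHS](_ : _ = 2 * `|c| ^+ 2 *
      (e / (2 * `|c| * (2 * pi) * (nrm x + 1)) * (2 * pi))); last by ring.
    by rewrite ler_wpM2l // mulr_ge0 // sqr_ge0.
  have cSE : 2 * `|c| * (e / (2 * `|c| * (2 * pi) * (nrm x + 1)) * (2 * pi)) = e / (nrm x + 1).
    have alg (a q f : R) : 0 < a -> 0 < q -> 0 < f -> 2 * a * (e / (2 * a * q * f) * q) = e / f.
      by move=> a0 q0 f0; field; rewrite !gt_eqF.
    exact: alg.
  rewrite cSE in cS.
  apply: le_lt_trans (ler_wpM2r x0 cS) _.
  rewrite mulrAC ltr_pdivrMr // ltr_pM2l //; lra.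
- apply/is_riemann_integralP => e e0.
  have e3 : 0 < e / 3 by rewrite divr_gt0.
  have e6 : 0 < e / 3 / (2 * pi) by rewrite divr_gt0.
  have [N hN] := ux _ e6; have {hN} := hN N (leqnn N); move/is_riemann_integralP: (uc N).
  move: (u N) => y yI yx; have [dl dl0 hd] := yI _ e3; exists dl => // n p s tag.
  have sB : riemann_sum (orb x) n p s
      = riemann_sum (orb y) n p s + riemann_sum (orb (x - y)) n p s.
    by rewrite -sumD addrC subrK.
  have := hd n p s tag; have := riemann_sum_le tag (orb_le (x - y)).
  have := I_le (y - x); rewrite -/(I x) -/(I y) IB.
  rewrite sB (nrmB x) subr0; set b := riemann_sum _ _ _ _; set a := riemann_sum _ _ _ _.
  have yx' : 2 * pi * nrm (y - x) < e / 3 by rewrite mulrC -ltr_pdivlMr.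
  rewrite [X in _ -> _ -> _ -> nrm X < _](_ : _ = b + ((a - I y) + (I y - I x))); last first.
    by rewrite subrKA addrA (addrC b).
  have := nrmD b ((a - I y) + (I y - I x)); have := nrmD (a - I y) (I y - I x).
  lra.
- move=> /is_riemann_integralP xI /is_riemann_integralP yI.
  apply/is_riemann_integralP => e e0; have e2 : 0 < e / 2 by rewrite divr_gt0.
  have [d1 d10 h1] := xI _ e2; have [d2 d20 h2] := yI _ e2.
  exists (Num.min d1 d2) => [|n p s [p0 pn ps]]; first by rewrite lt_min d10.
  have t1 : tagged 0 (2 * pi) d1 n p s.
    by split=> // i /ps[? +]; rewrite lt_min => /andP[].
  have t2 : tagged 0 (2 * pi) d2 n p s.
    by split=> // i /ps[? +]; rewrite lt_min => /andP[].
  rewrite sumD (linD (fourier_lin hS 0)) scalerDr opprD addrACA.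
  apply: le_lt_trans (nrmD _ _) _; have := h1 _ _ _ t1; have := h2 _ _ _ t2; lra.
Qed.

Lemma E0_fourier x : E0 S x = fourier S 0 x.
Proof.
rewrite /E0 (riemann_integralE (ltW twopi) (orbit_riemann x)) scalerA -rmorphM /=.
by rewrite mulVf ?gt_eqF // scale1r.
Qed.

End ExpectationIntegral.

(** * Approximate traces *)

Section ShiftMean.
Variables (R : realType) (d : nat) (A : cstarAlgType R) (S : 'I_d -> A).
Hypotheses (d_gt1 : (1 < d)%N) (S_rel : cuntz_relations S).
Implicit Types (x y a b : A).

Lemma dC_neq0 : d%:R != 0 :> R[i].
Proof. by rewrite pnatr_eq0 -lt0n ltnW. Qed.

Lemma gspan_mul m n k x y : gspan S m n x -> gspan S n k y -> gspan S m k (x * y).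
Proof.
move=> gx; elim: gx y => {m n x}.
- by move=> m n y _; rewrite mul0r; exact: gspan_zero.
- by move=> c y gy; rewrite -scalerAl mul1r; exact: gspanZ.
- by move=> m n c x x' _ IH _ IH' y gy; rewrite mulrDl -scalerAl; apply: gspan_lin; auto.
- by move=> m n i x _ IH y gy; rewrite -mulrA; apply: gspan_l; auto.
- by move=> m n i x _ IH y gy; rewrite -mulrA; apply/IH/gspan_starS.
Qed.

Lemma gspan00 x : gspan S 0 0 x -> exists c : R[i], x = c%:A.
Proof.
suff h m n : gspan S m n x -> (m + n = 0)%N -> exists c : R[i], x = c%:A by move/h; apply.
elim=> {m n} [m n _|c _|m n c y z _ + _ + mn|//|m n i y _ _]; last by rewrite addnS.
- by exists 0; rewrite scale0r.
- by exists c.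
- by move=> /(_ mn)[a ->] /(_ mn)[b ->]; exists (c * a + b); rewrite scalerDl scalerA.
Qed.

Lemma gspan_inner m x y : gspan S m 0 x -> gspan S m 0 y ->
  exists c : R[i], star y * x = c%:A.
Proof. by move=> gx /gspan_star gy; apply: gspan00; exact: gspan_mul gy gx. Qed.

(** Elements of level (m, n) are sums of rank-one matrices x y^*, where x and y are
    column vectors. *)
Lemma gspan_rank1_ind m n (P : set A) : P 0 ->
  (forall (c : R[i]) x y, P x -> P y -> P (c *: x + y)) ->
  (forall x y, gspan S m 0 x -> gspan S n 0 y -> P (x * star y)) ->
  forall x, gspan S m n x -> P x.
Proof.
move=> P0 Pl Px _ /gspan_word_span[c ->].
have PD a b : P a -> P b -> P (a + b) by move=> Pa Pb; rewrite -[a]scale1r; exact: Pl.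
apply: big_ind => // mu _; apply: big_ind => // nu _.
by rewrite -[_ *: _]addr0; apply: (Pl) => //; apply: Px; exact: gspan_word.
Qed.

(** The n-th iterate restricts to the normalized trace of the matrix algebra of
    level n, and it is contractive on the whole algebra. *)
Definition shift_mean x : A := (d%:R^-1 : R[i]) *: \sum_i star (S i) * x * S i.

Lemma shift_mean_lin : linear shift_mean.
Proof.
move=> c x y; rewrite /shift_mean scalerA mulrC -scalerA -scalerDr; congr (_ *: _).
rewrite scaler_sumr -big_split; apply: eq_bigr => i _ /=.
by rewrite mulrDr mulrDl -scalerAr -scalerAl.
Qed.

Lemma nrmS i : nrm (S i) = 1.
Proof. by apply: nrm_isometry; exact: starSSi. Qed.

Lemma shift_mean_contr x : nrm (shift_mean x) <= nrm x.
Proof.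
rewrite nrmZ cabs_natV ler_pdivrMl ?ltr0n ?(ltnW d_gt1) //.
apply: le_trans (nrm_sum _ _ _) _; apply: le_trans (_ : \sum_(i < d) nrm x <= _).
  apply: ler_sum => i _; apply: le_trans (nrmM _ _) _; rewrite nrmS mulr1.
  by apply: le_trans (nrmM _ _) _; rewrite nrm_star nrmS mul1r.
by rewrite sumr_const card_ord mulr_natl.
Qed.

Lemma shift_mean_scalar (c : R[i]) : shift_mean c%:A = c%:A.
Proof.
rewrite (linZ shift_mean_lin) /shift_mean; congr (_ *: _).
rewrite (eq_bigr (fun=> 1)) => [|i _]; last by rewrite mulr1 starSSi.
by rewrite sumr_const card_ord -[(1 : A) *+ _]scaler_nat scalerA mulVf ?scale1r // dC_neq0.
Qed.

(** The scalar y^* x is the unnormalized trace of the matrix x y^*. *)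
Lemma shift_mean_rank1 n x y : gspan S n 0 x -> gspan S n 0 y ->
  iter n shift_mean (x * star y) = (d%:R^-1 ^+ n : R[i]) *: (star y * x).
Proof.
elim: n x y => [|n IH] x y gx gy.
  have [[a ->] [b ->]] := (gspan00 gx, gspan00 gy).
  rewrite expr0 scale1r star_scalar -!scalerAl -!scalerAr !mul1r.
  by rewrite !scalerA mulrC.
rewrite iterSr {2}/shift_mean (linZ (iter_lin shift_mean_lin n)).
rewrite (lin_sum (iter_lin shift_mean_lin n)) exprS -scalerA; congr (_ *: _).
have -> : star y * x = \sum_i star (star (S i) * y) * (star (S i) * x).
  under eq_bigr do rewrite star_mul starK -mulrA (mulrA (S _)).
  by rewrite -mulr_sumr -mulr_suml (sumSstarS S_rel) mul1r.
rewrite scaler_sumr; apply: eq_bigr => i _.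
rewrite -IH; try exact: gspan_starS.
by rewrite star_mul starK !mulrA.
Qed.

Lemma shift_mean_trace n a b : gspan S n n a -> gspan S n n b ->
  iter n shift_mean (a * b) = iter n shift_mean (b * a).
Proof.
have lin := iter_lin shift_mean_lin n.
move=> ga gb; move: a ga; apply: gspan_rank1_ind => [|c a a' IH IH'|x y gx gy].
- by rewrite mulr0 mul0r.
- by rewrite mulrDl mulrDr -scalerAl -scalerAr !lin IH IH'.
move: b gb; apply: gspan_rank1_ind => [|c b b' IH IH'|x' y' gx' gy'].
- by rewrite mulr0 mul0r.
- by rewrite mulrDl mulrDr -scalerAl -scalerAr !lin IH IH'.
have [[c cE] [e eE]] := (gspan_inner gx' gy, gspan_inner gx gy').
have -> : x * star y * (x' * star y') = c *: (x * star y').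
  by rewrite -mulrA (mulrA (star y)) cE -scalerAl mul1r -scalerAr.
have -> : x' * star y' * (x * star y) = e *: (x' * star y).
  by rewrite -mulrA (mulrA (star y')) eE -scalerAl mul1r -scalerAr.
rewrite !(linZ lin) !shift_mean_rank1 // cE eE !scalerA; congr (_ *: _); ring.
Qed.

End ShiftMean.

Section NoHomogeneousUnitary.
Variables (R : realType) (d : nat) (A : cstarAlgType R) (S : 'I_d -> A).
Hypotheses (d_gt1 : (1 < d)%N) (hS : is_cuntz_algebra S).
Implicit Types (x y a b f : A).

Let i0 : 'I_d := Ordinal (ltnW d_gt1).
Local Notation s := (S i0).

(** Approximate f by elements of finite levels, on which the iterated shift mean is a
    trace; on the right-hand sides it takes the values c and c' d^-n. *)
Lemma core_trace_equation f (c c' : R[i]) n : core S f -> f * star f = c%:A ->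
  star f * f = c' *: (s ^+ n * star (s ^+ n)) -> c = c' * d%:R^-1 ^+ n.
Proof.
move=> /closure_seq[u uc uf] fc fc'.
pose v k := u k * star (u k) - star (u k) * u k.
have vf : conv v (f * star f - star f * f).
  have := convD (convM uf (conv_star uf)) (convZ (-1) (convM (conv_star uf) uf)).
  rewrite scaleN1r; apply: (conv_eventually (N := 0%N)) => k _.
  by rewrite scaleN1r.
have lin N := iter_lin (shift_mean_lin S) N.
have scal N (a : R[i]) : iter N (shift_mean S) a%:A = a%:A.
  by elim: N => // N IH; rewrite iterS IH (shift_mean_scalar d_gt1 (cuntz_rel hS)).
have value m : iter (m + n) (shift_mean S) (f * star f - star f * f)
    = (c - c' * d%:R^-1 ^+ n)%:A.
  rewrite (linB (lin _)) fc scal fc' (linZ (lin _)) iterD.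
  have gs := gspan_expS S i0 n.
  rewrite (shift_mean_rank1 (cuntz_rel hS) gs gs) (star_expSS (cuntz_rel hS) i0) scal scalerA.
  by rewrite scalerBl.
apply/eqP; rewrite -subr_eq0; apply/eqP.
have : (c - c' * d%:R^-1 ^+ n)%:A = 0 :> A.
  apply: nrm_small_eq0 => e /vf[k /(_ k (leqnn k)) vk].
  have [m _ /core_levelP um] := uc k.
  have um' := gspan_raise_by (cuntz_rel hS) n um; rewrite addnC in um'.
  rewrite -(value m) -[X in nrm X]subr0.
  have <- : iter (m + n) (shift_mean S) (v k) = 0.
    rewrite (linB (lin _)) (shift_mean_trace (cuntz_rel hS)) ?subrr //.
    exact: gspan_star.
  rewrite nrmB -(linB (lin _)).
  apply: le_trans (ltW vk); apply: iter_contr => z.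
  exact: shift_mean_contr d_gt1 (cuntz_rel hS) z.
by move=> /eqP; rewrite scaler_eq0 oner_eq0 orbF => /eqP.
Qed.

(** The element f = y (S_1^n)^* lies in the core, with f f^* = y y^* and
    f^* f = S_1^n y^* y (S_1^n)^*; hence c' = c d^-n.  If y <> 0, then c = c', by
    computing y y^* y in two ways. *)
Lemma homogeneous_scalar_eq0 y (n : nat) (c c' : R[i]) : (0 < n)%N ->
  degree S n%:Z y -> star y * y = c%:A -> y * star y = c'%:A -> y = 0.
Proof.
move=> n0 yn yc yc'.
have sn : degree S n%:Z (s ^+ n).
  by have := gspan_degree hS (gspan_expS S i0 n); rewrite subr0.
have fcore : core S (y * star (s ^+ n)).
  apply/(degree0_core hS); rewrite -(subrr n%:Z).
  exact/(degreeM hS)/(degree_star hS).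
have cE : c' = c * d%:R^-1 ^+ n.
  apply: (core_trace_equation fcore); rewrite star_mul starK !mulrA.
    by rewrite -(mulrA y) (star_expSS (cuntz_rel hS) i0) mulr1.
  by rewrite -(mulrA _ (star y)) yc -scalerAr mulr1 scalerAl.
have [->//|y0] := eqVneq y 0.
have cc : c = c'.
  have : (c - c') *: y = 0.
    apply/eqP; rewrite scalerBl subr_eq0; apply/eqP.
    have := mulrA y (star y) y; rewrite yc yc' -scalerAr -scalerAl mulr1 mul1r.
    by [].
  by move=> /eqP; rewrite scaler_eq0 (negPf y0) orbF subr_eq0 => /eqP.
have c0 : c = 0.
  apply/eqP; move: cE; rewrite -cc => /eqP; rewrite -subr_eq0 -[X in X - _]mulr1 -mulrBr.
  rewrite mulf_eq0 => /orP[//|]; rewrite subr_eq0 => /eqP/(congr1 (@cabs R)).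
  rewrite cabs1 cabsX cabs_natV => /esym/eqP.
  rewrite exprVn invr_eq1 -natrX -[1]/(1%:R) eqr_nat -(exp1n n) eqn_exp2r //.
  by move=> /eqP d1; move: d_gt1; rewrite d1.
apply: nrm_eq0; apply/eqP; rewrite -sqrf_eq0 -nrm_starM yc c0 scale0r nrm0.
by [].
Qed.

End NoHomogeneousUnitary.

(** * Fixed points in the Cuntz algebra *)

Section CuntzFixedPoints.
Variables (R : realType) (d : nat) (A : cstarAlgType R) (S : 'I_d -> A) (U : A).
Hypotheses (d_gt1 : (1 < d)%N) (hS : is_cuntz_algebra S).
Hypotheses (U_core : core S U) (U_unitary : unitary U).
Implicit Types (x y : A).
Local Notation lam := (cuntz_endo S U).

Lemma lam_hom : unital_star_hom lam.
Proof. by case: (cuntz_endoP hS U_unitary). Qed.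

Lemma star_hom_comp (B C D : cstarAlgType R) (f : B -> C) (g : C -> D) :
  unital_star_hom f -> unital_star_hom g -> unital_star_hom (g \o f).
Proof.
move=> [fl [f1 fM] fs] [gl [g1 gM] gs]; split=> [c x y||x] /=.
- by rewrite fl gl.
- by split=> [|x y] /=; rewrite ?f1 ?fM.
- by rewrite fs gs.
Qed.

(** On generators, because U has degree 0. *)
Lemma lam_gauge x : lam (gauge S x) = gauge S (lam x).
Proof.
have [_ lamS] := cuntz_endoP hS U_unitary; have [ll _ _] := lam_hom.
apply: (star_hom_ext hS (star_hom_comp (gauge_hom hS) lam_hom)
                        (star_hom_comp lam_hom (gauge_hom hS))) => i /=.
have gS : gauge S (S i) = wc R *: S i.
  have := gspan_degree hS (gspan_l i (gspan1 S)).
  by rewrite mulr1 /degree subr0 expr1z.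
rewrite gS (linZ ll) lamS (gaugeM hS) gS scalerAr.
by have := core_degree0 hS U_core; rewrite /degree expr0z scale1r => ->.
Qed.

Lemma fixed_fourier k x : lam x = x -> lam (fourier S k x) = fourier S k x.
Proof. by move=> xf; rewrite (fourier_commute hS k lam_hom lam_gauge) xf. Qed.

Lemma scalars_fixed x : scalars A x -> lam x = x.
Proof. by case=> c _ <-; have [ll [l1 _] _] := lam_hom; rewrite (linZ ll) l1. Qed.

Lemma cuntz_fixed_points : fixed_points (core S) lam = scalars A ->
  fixed_points [set: A] lam = scalars A.
Proof.
move=> core_fixed; have [ll [l1 lM] ls] := lam_hom.
have scal x : core S x -> lam x = x -> exists c : R[i], x = c%:A.
  move=> xc xf; have : fixed_points (core S) lam x by [].
  by rewrite core_fixed => -[c _ <-]; exists c.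
have pos y n : (0 < n)%N -> degree S n%:Z y -> lam y = y -> y = 0.
  move=> n0 yn yf.
  have [||c yc] := scal (star y * y).
  - apply/(degree0_core hS); rewrite -(addNr n%:Z).
    by apply: (degreeM hS) => //; exact: degree_star.
  - by rewrite lM ls yf.
  have [||c' yc'] := scal (y * star y).
  - apply/(degree0_core hS); rewrite -(subrr n%:Z).
    by apply: (degreeM hS) => //; exact: degree_star.
  - by rewrite lM ls yf.
  exact: (homogeneous_scalar_eq0 d_gt1 hS n0 yn yc yc').
have zero k x : k != 0 -> lam x = x -> fourier S k x = 0.
  move=> k0 /(fixed_fourier k) fx; have yk := fourier_degree hS k x.
  set y := fourier S k x in fx yk *; move: y fx yk => y yf yk.
  case: k k0 yk => [[//|n]|n] _ yk.
    exact: pos yk yf.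
  rewrite -[y]starK (pos (star y) n.+1) ?star0 //; last by rewrite ls yf.
  by have := degree_star hS yk; rewrite NegzE opprK.
apply/seteqP; split=> [x [_ xf]|x xs]; last by split=> //; exact: scalars_fixed.
rewrite -core_fixed; split=> //; apply: (fourier0_only hS) => k k0.
exact: zero.
Qed.

End CuntzFixedPoints.

(** * The tracial representation and the KMS relation *)

Section TracialGNS.
Variables (R : realType) (d : nat) (A : cstarAlgType R) (S : 'I_d -> A).
Variables (H : hilbertType R) (rho : A -> H -> H) (Omega : H).
Hypotheses (d_gt1 : (1 < d)%N) (hS : is_cuntz_algebra S).
Hypothesis gns : is_GNS (omega S) rho Omega.
Hypothesis tr : is_normalized_trace S (core_trace S).
Implicit Types (a b x y : A) (xi eta : H) (X Y Z T : H -> H).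

Local Notation D := (d%:R : R[i]).
Local Notation M := (vN_M rho).

Definition vec a : H := rho a Omega.
Definition om a : R[i] := inner (vec a) Omega.

Lemma rep : star_representation rho. Proof. by case: gns. Qed.

Lemma rhoM a b xi : rho (a * b) xi = rho a (rho b xi).
Proof. by case: rep => _ _ -> . Qed.

Lemma rho1 xi : rho 1 xi = xi.
Proof. by case: rep => _ _ _ ->. Qed.

Lemma rho_adj a : adjoint_of (rho a) (rho (star a)).
Proof. by case: rep. Qed.

Lemma rho_bounded a : bounded_operator (rho a).
Proof. by case: rep. Qed.

Lemma rho_linl xi : linear (rho^~ xi).
Proof. by case: rep => _ h _ _ _ c a b; exact: h. Qed.

Lemma rho_convl u a xi : conv u a -> conv (fun n => rho (u n) xi) (rho a xi).
Proof.
apply: (@conv_lin R A H (rho^~ xi) (nrm xi)); first exact: rho_linl.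
by move=> b; rewrite mulrC; exact: rep_contractive rep b xi.
Qed.

Lemma vec_lin : linear vec. Proof. exact: rho_linl. Qed.

Lemma vec_conv u a : conv u a -> conv (fun n => vec (u n)) (vec a).
Proof. exact: rho_convl. Qed.

Lemma rho_vec a b : rho a (vec b) = vec (a * b).
Proof. by rewrite /vec rhoM. Qed.

Lemma vec1 : vec 1 = Omega. Proof. exact: rho1. Qed.

Lemma vec_dense : closure (range vec) = setT.
Proof. by case: gns. Qed.

Lemma GNS_ind (P : set H) :
  (forall u xi, (forall n, P (u n)) -> conv u xi -> P xi) ->
  (forall xi eta, P xi -> P eta -> P (xi + eta)) ->
  (forall m n a, gspan S m n a -> P (vec a)) -> forall xi, P xi.
Proof.
move=> Pc PD Pg; apply: (dense_ind vec_dense) => // _ [a _ <-].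
move: a; apply: (cuntz_ind hS) => [u x uP ux|x y Px Py|//].
  exact: Pc uP (vec_conv ux).
by rewrite (linD vec_lin); exact: PD.
Qed.

Lemma operator_ext X Y : bounded_operator X -> bounded_operator Y ->
  (forall m n a, gspan S m n a -> X (vec a) = Y (vec a)) -> forall xi, X xi = Y xi.
Proof.
move=> /bounded_operatorP[Xl [C _ XC]] /bounded_operatorP[Yl [C' _ YC]] h.
apply: GNS_ind => // [u xi uP uxi|xi eta hx hy].
  apply: conv_unique (conv_lin Xl XC uxi) _.
  by apply: (conv_eventually (N := 0%N)) (conv_lin Yl YC uxi) => n _; rewrite uP.
by rewrite (linD Xl) (linD Yl) hx hy.
Qed.

Lemma om_lin : linear (om : A -> R[i]^o).
Proof. by move=> c a b; rewrite /om vec_lin inner_linear. Qed.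

Lemma om_conv u a : conv u a -> conv (fun n => om (u n) : R[i]^o) (om a).
Proof. by move=> /vec_conv/conv_innerl; apply. Qed.

Lemma om_star a : om (star a) = conjc (om a).
Proof. by rewrite /om /vec -inner_conj (adjoint_sym (rho_adj a)). Qed.

Lemma om_inner a b : om (star b * a) = inner (vec a) (vec b).
Proof. by rewrite /om -rho_vec (adjoint_sym (rho_adj b)). Qed.

Lemma om_sqr a : om (star a * a) = (nrm (vec a) ^+ 2)%:C.
Proof. by rewrite om_inner innerxx. Qed.

Lemma omE a : om a = core_trace S (fourier S 0 a).
Proof. by rewrite -(E0_fourier hS); case: gns => _ /(_ a). Qed.

Lemma core1 : core S 1. Proof. exact: gspan_core (gspan1 S). Qed.

Lemma om_core a : core S a -> om a = core_trace S a.
Proof. by move=> /(core_degree0 hS)/(fourier_id hS); rewrite omE => ->. Qed.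

Lemma om1 : om 1 = 1.
Proof. by rewrite om_core; [case: tr|exact: core1]. Qed.

Lemma om_degree k a : k != 0 -> degree S k a -> om a = 0.
Proof.
move=> k0 ak; rewrite omE (fourier_eigen hS 0 ak) (negPf k0).
have [trl _ _ tr1] := tr; have := trl (-1) 1 1 core1 core1.
by rewrite tr1 scaleN1r addNr mulr1 addNr.
Qed.

Lemma om_trace a b : core S a -> core S b -> om (a * b) = om (b * a).
Proof.
move=> ac bc; have [_ _ trM _] := tr.
have abc x y : core S x -> core S y -> core S (x * y).
  move=> /(degree0_core hS) x0 /(degree0_core hS) y0.
  by apply/(degree0_core hS); rewrite -(addr0 0); exact: (degreeM hS).
by rewrite (om_core (abc _ _ ac bc)) (om_core (abc _ _ bc ac)) trM.
Qed.

Let i0 : 'I_d := Ordinal (ltnW d_gt1).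

(** Writing x y^* = (x s^* ) (s y^* ) for the isometry s = S_1^n, the trace property
    gives the factor y^* x; the remaining constant is found by summing over the
    rank-one projections of level n, whose sum is 1. *)
Lemma om_rank1 n x y (c : R[i]) : gspan S n 0 x -> gspan S n 0 y ->
  star y * x = c%:A -> om (x * star y) = c * D^-1 ^+ n.
Proof.
pose t n := om (S i0 ^+ n * star (S i0 ^+ n)).
have step k x' y' (c' : R[i]) : gspan S k 0 x' -> gspan S k 0 y' ->
    star y' * x' = c'%:A -> om (x' * star y') = c' * t k.
  move=> gx gy yx.
  have -> : x' * star y' = (x' * star (S i0 ^+ k)) * (S i0 ^+ k * star y').
    by rewrite mulrA -(mulrA x') (star_expSS (cuntz_rel hS)) mulr1.
  rewrite om_trace; last 2 first.
  - exact: gspan_core (gspan_mul (cuntz_rel hS) gx (gspan_star (gspan_expS S i0 k))).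
  - exact: gspan_core (gspan_mul (cuntz_rel hS) (gspan_expS S i0 k) (gspan_star gy)).
  rewrite mulrA -(mulrA _ (star y')) yx -scalerAr mulr1 -scalerAl.
  by rewrite (linZ om_lin).
have tE k : t k = D^-1 ^+ k.
  elim: k => [|k IH]; first by rewrite /t expr0 star1 mulr1 om1.
  have : t k = \sum_(i < d) t k.+1.
    rewrite {1}/t -[X in X * _]mulr1 -(sumSstarS (cuntz_rel hS)) mulr_sumr mulr_suml.
    rewrite (lin_sum om_lin); apply: eq_bigr => i _.
    have gk := gspan_expSS S i0 i k.
    rewrite mulrA -mulrA -star_mul (step k.+1 _ _ 1 gk gk) ?mul1r //.
    - rewrite star_mul -mulrA (mulrA _ _ (S i)) (star_expSS (cuntz_rel hS)) mul1r (starSSi (cuntz_rel hS)).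
      by rewrite scale1r.
  rewrite sumr_const card_ord IH -[t k.+1 *+ _]mulr_natl => tk.
  by rewrite exprS tk mulKf // dC_neq0.
by move=> gx gy yx; rewrite (step n _ _ c) // tE.
Qed.

(** Both sides vanish on words of degree different from -1; on the others they are
    evaluated by [om_rank1] at two consecutive levels. *)
Lemma om_kms i b : om (S i * b) = D^-1 * om (b * S i).
Proof.
have S_deg : degree S 1 (S i).
  by have := gspan_degree hS (gspan_l i (gspan1 S)); rewrite mulr1.
have Sl : linear (fun b => S i * b) by move=> c x y; rewrite mulrDr scalerAr.
have Sr : linear (fun b => b * S i) by move=> c x y; rewrite mulrDl scalerAl.
move: b; apply: (cuntz_ind hS) => [u b uP ub|a b ha hb|m n b gb].
- apply: (@conv_unique _ R[i]^o _ _ _ (om_conv (convMl (S i) ub))).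
  have := @convZ _ R[i]^o D^-1 _ _ (om_conv (convMr (S i) ub)).
  by apply: (conv_eventually (N := 0%N)) => n _; rewrite uP.
- by rewrite mulrDr mulrDl !(linD om_lin) ha hb mulrDr.
have [nm|nm] := eqVneq n m.+1; last first.
  have deg := gspan_degree hS gb.
  have k0 : 1 + (m%:Z - n%:Z) != 0 by apply/eqP; move/eqP: nm; lia.
  rewrite (om_degree k0 (degreeM hS S_deg deg)).
  by rewrite addrC in k0; rewrite (om_degree k0 (degreeM hS deg S_deg)) mulr0.
move: b gb; rewrite nm; apply: gspan_rank1_ind => [|c a b ha hb|x y gx gy].
- by rewrite mulr0 mul0r (lin0 om_lin) mulr0.
- by rewrite Sl Sr !om_lin ha hb mulrDr -[_ *: _]/(_ * _) -[X in _ = _ * X + _]/(_ * _) mulrCA.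
have gS := gspan_starS (cuntz_rel hS) i gy.
have [c yx] := gspan_inner (cuntz_rel hS) gx gS.
have -> : x * star y * S i = x * star (star (S i) * y) by rewrite star_mul starK mulrA.
rewrite [S i * _]mulrA (om_rank1 gx gS yx).
rewrite star_mul starK in yx.
rewrite (om_rank1 (gspan_l i gx) gy (c := c)) ?mulrA //.
by rewrite exprS; ring.
Qed.

Lemma om_kms_star i b : om (b * star (S i)) = D^-1 * om (star (S i) * b).
Proof.
have -> : b * star (S i) = star (S i * star b) by rewrite star_mul starK.
have -> : star (S i) * b = star (star b * S i) by rewrite star_mul starK.
by rewrite !om_star om_kms rmorphM /= conjc_inv conjc_nat.
Qed.

Lemma nrm_vec_mulstarS i a : nrm (vec (a * star (S i))) ^+ 2 = d%:R^-1 * nrm (vec a) ^+ 2.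
Proof.
apply: complexI; rewrite -om_sqr star_mul starK -mulrA om_kms -!mulrA.
rewrite (starSSi (cuntz_rel hS)) mulr1 om_sqr.
by rewrite [RHS](rmorphM (real_complex R)) /= fmorphV rmorph_nat.
Qed.

Lemma nrm_vec_mulS_sum a : \sum_i nrm (vec (a * S i)) ^+ 2 = d%:R * nrm (vec a) ^+ 2.
Proof.
apply: complexI; rewrite [RHS](rmorphM (real_complex R)) /= rmorph_nat -om_sqr.
have -> : star a * a = \sum_i star a * a * S i * star (S i).
  under eq_bigr do rewrite -mulrA.
  by rewrite -mulr_sumr (sumSstarS (cuntz_rel hS)) mulr1.
rewrite rmorph_sum /= (lin_sum om_lin) mulr_sumr; apply: eq_bigr => i _.
rewrite -om_sqr om_kms_star mulVKf ?dC_neq0 //.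
by rewrite star_mul !mulrA.
Qed.

(** Right multiplications commute with the representation, which acts by left
    multiplication. *)
Lemma right_mul_exists a (C : R) : 0 <= C ->
  (forall b, nrm (vec (b * a)) <= C * nrm (vec b)) ->
  exists2 T, commutant (range rho) T & forall b, T (vec b) = vec (b * a).
Proof.
move=> C0 hC.
have rl : linear (fun b => vec (b * a)).
  by move=> c x y; rewrite mulrDl -scalerAl vec_lin.
have [T [Tl TC Tvec]] := dense_extension C0 vec_lin rl vec_dense hC.
have Tb : bounded_operator T by apply/bounded_operatorP; split=> //; exists C.
exists T => //; apply: commutantI => // _ xi [b _ <-].
apply: (@operator_ext (T \o rho b) (rho b \o T)) => [||m n c _ /=].
- exact/bounded_operator_comp/rho_bounded.
- by apply/bounded_operator_comp/Tb; exact: rho_bounded.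
- by rewrite rho_vec !Tvec rho_vec mulrA.
Qed.

Lemma right_mulS i :
  exists2 T, commutant (range rho) T & forall b, T (vec b) = vec (b * S i).
Proof.
have d0 : 0 <= Num.sqrt d%:R :> R by exact: sqrtr_ge0.
apply: (right_mul_exists d0) => b.
rewrite -ler_sqr ?nnegrE ?mulr_ge0 ?nrm_ge0 // exprMn sqr_sqrtr //.
rewrite -nrm_vec_mulS_sum (bigD1 i) //= lerDl.
by apply: sumr_ge0 => j _; exact: sqr_ge0.
Qed.

Lemma right_mulstarS i :
  exists2 T, commutant (range rho) T & forall b, T (vec b) = vec (b * star (S i)).
Proof.
apply: (right_mul_exists ler01) => b.
rewrite -ler_sqr ?nnegrE ?mulr_ge0 ?nrm_ge0 // mul1r nrm_vec_mulstarS.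
rewrite ler_piMl ?sqr_ge0 // invf_le1 ?ltr0n ?(ltnW d_gt1) //.
by rewrite ler1n ltnW.
Qed.

Lemma vN_M_rho a : M (rho a).
Proof. by apply: sub_bicommutant; [move=> _ [b _ <-]; exact: rho_bounded|exists a]. Qed.

Lemma vN_M_comp X Y : M X -> M Y -> M (X \o Y).
Proof. exact: commutant_comp. Qed.

Lemma vN_M_lin (c : R[i]) X Y : M X -> M Y -> M (fun xi => c *: X xi + Y xi).
Proof. exact: (commutant_lincomb c (@commutant_bounded _ _ _)). Qed.

Lemma vN_M_linear X : M X -> linear X.
Proof. by case=> -[]. Qed.

Lemma vN_M_adjoint X : M X -> exists2 X', M X' & adjoint_of X X'.
Proof.
move=> MX; have [X' bX' XX'] := adjoint_exists (commutant_bounded MX).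
exists X' => //; apply: (commutant_adjoint _ MX) => // T cT.
have [T' bT' TT'] := adjoint_exists (commutant_bounded cT); exists T' => //.
apply: (commutant_adjoint _ cT) => // _ [a _ <-].
by exists (rho (star a)); [exists (star a)|exact: rho_adj].
Qed.

(** If a is a generator or its adjoint, then vec a is the image of Omega under a right
    multiplication, which commutes with Z.  The general case is by induction, because
    Z may be replaced by Z composed with the representation of a generator. *)
Lemma vN_M_vec_bound m n a : gspan S m n a -> exists2 C : R, 0 <= C &
  forall Z, M Z -> nrm (Z (vec a)) <= C * nrm (Z Omega).
Proof.
elim=> {m n a}.
- move=> m n; exists 0 => // Z MZ.
  by rewrite (lin0 vec_lin) (lin0 (vN_M_linear MZ)) nrm0 mul0r.
- move=> c; exists (cabs c) => [|Z MZ]; first exact: nrm_ge0.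
  by rewrite (linZ vec_lin) vec1 (linZ (vN_M_linear MZ)) nrmZ.
- move=> m n c a b _ [C C0 hC] _ [C' C'0 hC'].
  exists (cabs c * C + C') => [|Z MZ]; first by rewrite addr_ge0 ?mulr_ge0 ?nrm_ge0.
  rewrite vec_lin (vN_M_linear MZ); apply: le_trans (nrmD _ _) _.
  rewrite mulrDl lerD ?hC' // nrmZ -mulrA ler_wpM2l ?hC //.
  exact: nrm_ge0.
- move=> m n i a _ [C C0 hC].
  have [T cT Tvec] := right_mulS i.
  have /bounded_operatorP[Tl [C' C'0 TC']] := commutant_bounded cT.
  exists (C * C') => [|Z MZ]; first exact: mulr_ge0.
  have := hC _ (vN_M_comp MZ (vN_M_rho (S i))); rewrite /= rho_vec => h.
  apply: le_trans h _; rewrite -mulrA ler_wpM2l //.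
  have -> : rho (S i) Omega = T Omega by rewrite -{2}vec1 Tvec mul1r.
  by rewrite (commutantE Omega MZ cT).
- move=> m n i a _ [C C0 hC].
  have [T cT Tvec] := right_mulstarS i.
  have /bounded_operatorP[Tl [C' C'0 TC']] := commutant_bounded cT.
  exists (C' * C) => [|Z MZ]; first exact: mulr_ge0.
  rewrite -Tvec (commutantE _ MZ cT); apply: le_trans (TC' _) _.
  by rewrite -mulrA ler_wpM2l // hC.
Qed.

Lemma vN_M_separating Z : M Z -> Z Omega = 0 -> forall xi, Z xi = 0.
Proof.
move=> MZ Z0; apply: (@operator_ext Z (fun=> 0)) (commutant_bounded MZ) _ _.
  apply/bounded_operatorP; split=> [c x y|]; first by rewrite scaler0 addr0.
  by exists 0 => // x; rewrite nrm0 mul0r.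
move=> m n a /vN_M_vec_bound[C C0 /(_ Z MZ)]; rewrite Z0 nrm0 mulr0 => h.
by apply: nrm_eq0; apply/eqP; rewrite eq_le h nrm_ge0.
Qed.

Lemma vN_M_eq X Y : M X -> M Y -> X Omega = Y Omega -> X = Y.
Proof.
move=> MX MY XY; apply/funext => xi; apply/eqP; rewrite -subr_eq0; apply/eqP.
have := vN_M_separating (vN_M_lin (-1) MY MX); rewrite /= XY scaleN1r addNr.
by move=> /(_ erefl xi); rewrite scaleN1r addrC.
Qed.

Lemma inner_ext_vec T X (c : R[i]) : bounded_operator T -> bounded_operator X ->
  (forall b, inner (T (vec b)) Omega = c * inner (X (vec b)) Omega) ->
  forall xi, inner (T xi) Omega = c * inner (X xi) Omega.
Proof.
move=> /bounded_operatorP[Tl [C _ TC]] /bounded_operatorP[Xl [C' _ XC]] h.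
apply: GNS_ind => // [u xi uP uxi|xi eta hx hy].
  apply: (@conv_unique _ R[i]^o _ _ _ (conv_innerl Omega (conv_lin Tl TC uxi))).
  have := @convZ _ R[i]^o c _ _ (conv_innerl Omega (conv_lin Xl XC uxi)).
  by apply: (conv_eventually (N := 0%N)) => n _; rewrite uP.
by rewrite (linD Tl) (linD Xl) !innerDl hx hy mulrDr.
Qed.

(** For a generator, replace a by a right multiplication, which commutes with X, and
    apply [om_kms] to vectors instead of elements of the algebra.  Products follow
    because X is arbitrary in M. *)
Lemma gspan_kms m n a : gspan S m n a -> forall X, M X ->
  inner (X (vec a)) Omega = D ^ (m%:Z - n%:Z) * inner (rho a (X Omega)) Omega.
Proof.
have D0 : D != 0 := dC_neq0 R d_gt1.
elim=> {m n a}.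
- move=> m n X MX; rewrite (lin0 vec_lin) (lin0 (vN_M_linear MX)).
  by rewrite (lin0 (rho_linl _)) !inner0l mulr0.
- move=> c X MX; rewrite (linZ vec_lin) vec1 (linZ (vN_M_linear MX)).
  by rewrite (linZ (rho_linl _)) rho1 subrr expr0z mul1r.
- move=> m n c a b _ IHa _ IHb X MX; rewrite vec_lin (vN_M_linear MX).
  by rewrite (rho_linl _) !inner_linear IHa // IHb // mulrDr mulrCA.
- move=> m n i a _ IH X MX.
  have := IH _ (vN_M_comp MX (vN_M_rho (S i))); rewrite /= rho_vec => ->.
  have [T cT Tvec] := right_mulS i.
  have -> : rho (S i) Omega = T Omega by rewrite -{2}vec1 Tvec mul1r.
  rewrite (commutantE Omega MX cT) -(commutantE _ cT); last by exists a.
  rewrite (@inner_ext_vec T (rho (S i)) D _ (rho_bounded _)).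
  + have -> : D ^ (m.+1%:Z - n%:Z) = D ^ (m%:Z - n%:Z) * D.
      have -> : m.+1%:Z - n%:Z = (m%:Z - n%:Z) + 1 by lia.
      by rewrite expfzDr // expr1z.
    by rewrite rhoM mulrA.
  + exact: commutant_bounded cT.
  + by move=> b; rewrite Tvec rho_vec -/(om _) -/(om _) om_kms mulVKf.
- move=> m n i a _ IH X MX.
  have [T cT Tvec] := right_mulstarS i.
  rewrite -Tvec (commutantE _ MX cT) (@inner_ext_vec T (rho (star (S i))) D^-1 _ (rho_bounded _)).
  + have := IH _ (vN_M_comp (vN_M_rho (star (S i))) MX); rewrite /= => ->.
    have -> : D ^ (m%:Z - n.+1%:Z) = D^-1 * D ^ (m%:Z - n%:Z).
      have -> : m%:Z - n.+1%:Z = -1 + (m%:Z - n%:Z) by lia.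
      by rewrite expfzDr // exprN1.
    by rewrite rhoM mulrA.
  + exact: commutant_bounded cT.
  + by move=> b; rewrite Tvec rho_vec -/(om _) -/(om _) om_kms_star.
Qed.

Lemma vN_M_kms k a X : degree S k a -> M X ->
  inner (X (vec a)) Omega = D ^ k * inner (rho a (X Omega)) Omega.
Proof.
move=> ak MX; rewrite -(fourier_id hS ak); move: {ak} a.
have /bounded_operatorP[Xl [C _ XC]] := commutant_bounded MX.
apply: (cuntz_ind hS) => [u a uP ua|a b ha hb|m n a ga].
- have uk := conv_fourier hS k ua.
  apply: (@conv_unique _ R[i]^o _ _ _ (conv_innerl Omega (conv_lin Xl XC (vec_conv uk)))).
  have := @convZ _ R[i]^o (D ^ k) _ _ (conv_innerl Omega (rho_convl (X Omega) uk)).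
  by apply: (conv_eventually (N := 0%N)) => n _; rewrite uP.
- rewrite (linD (fourier_lin hS k)) (linD vec_lin) (linD Xl) innerDl ha hb.
  by rewrite (linD (rho_linl _)) innerDl mulrDr.
rewrite (fourier_eigen hS k (gspan_degree hS ga)); case: eqP => [<-|_].
  exact: gspan_kms.
by rewrite (lin0 vec_lin) (lin0 Xl) (lin0 (rho_linl _)) !inner0l mulr0.
Qed.


Definition gaugeV : A -> A := cuntz_endo S (conjc (wc R))%:A.

Let wcV_conj : conjc (wc R) * conjc (conjc (wc R)) = 1.
Proof. by rewrite conjcK mulrC wc_conj. Qed.

Lemma gaugeV_hom : unital_star_hom gaugeV.
Proof. by case: (cuntz_endoP hS (unitary_scalar A wcV_conj)). Qed.

Lemma gauge_cancel (z z' : R[i]) : z * conjc z = 1 -> z' * conjc z' = 1 -> z * z' = 1 ->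
  cancel (cuntz_endo S z%:A) (cuntz_endo S z'%:A).
Proof.
move=> z1 z'1 zz' a.
have [hz zS] := cuntz_endoP hS (unitary_scalar A z1).
have [hz' z'S] := cuntz_endoP hS (unitary_scalar A z'1).
have id_hom : unital_star_hom (id : A -> A) by split.
apply: (star_hom_ext hS (star_hom_comp hz hz') id_hom) => i /=.
rewrite zS -scalerAl mul1r (linZ (let: And3 l _ _ := hz' in l)) z'S.
by rewrite -scalerAl mul1r scalerA zz' scale1r.
Qed.

Lemma gaugeK : cancel (gauge S) gaugeV.
Proof. exact: gauge_cancel (wc_conj R) wcV_conj (wc_conj R). Qed.

Lemma gaugeVK : cancel gaugeV (gauge S).
Proof. by apply: gauge_cancel wcV_conj (wc_conj R) _; rewrite mulrC wc_conj. Qed.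

(** The state vanishes off degree 0, where the gauge automorphism acts trivially. *)
Lemma om_gauge a : om (gauge S a) = om a.
Proof.
move: a; apply: (cuntz_ind hS) => [u a uP ua|a b ha hb|m n a /(gspan_degree hS) ga].
- apply: (@conv_unique _ R[i]^o _ _ _ (om_conv (star_hom_conv (gauge_hom hS) ua))).
  by apply: (conv_eventually (N := 0%N)) (om_conv ua) => n _; rewrite uP.
- by rewrite (linD (gauge_lin hS)) !(linD om_lin) ha hb.
have [k0|k0] := eqVneq (m%:Z - n%:Z) 0; first by rewrite ga k0 expr0z scale1r.
by rewrite ga (linZ om_lin) !(om_degree k0 ga) scaler0.
Qed.

Definition implements (V V' : H -> H) : Prop :=
  [/\ bounded_operator V /\ bounded_operator V',
      forall a, V (vec a) = vec (gauge S a), forall a, V' (vec a) = vec (gaugeV a),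
      cancel V V' & cancel V' V].

Lemma implements_exists : exists V V', implements V V'.
Proof.
have ext (f : A -> A) : unital_star_hom f -> (forall a, om (f a) = om a) ->
    exists2 T, bounded_operator T & forall a, T (vec a) = vec (f a).
  move=> [fl [f1 fM] fs] fom.
  have [c x y|a|T [Tl TC Tvec]] :=
    dense_extension (q := vec) (r := fun a => vec (f a)) ler01 vec_lin _ vec_dense.
  - by rewrite fl vec_lin.
  - rewrite mul1r -ler_sqr ?nnegrE ?nrm_ge0 //.
    by rewrite -lecR -!om_sqr -fs -fM fom.
  by exists T => //; apply/bounded_operatorP; split=> //; exists 1.
have [V bV Vvec] := ext _ (gauge_hom hS) om_gauge.
have [|V' bV' V'vec] := ext _ gaugeV_hom.
  by move=> a; rewrite -om_gauge gaugeVK.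
exists V, V'; split=> //.
- apply: (operator_ext (bounded_operator_comp bV' bV) (bounded_operator_id H)) => m n a _ /=.
  by rewrite Vvec V'vec gaugeK.
- apply: (operator_ext (bounded_operator_comp bV bV') (bounded_operator_id H)) => m n a _ /=.
  by rewrite V'vec Vvec gaugeVK.
Qed.

Lemma bounded_operator_scale (c : R[i]) T :
  bounded_operator T -> bounded_operator (fun xi => c *: T xi).
Proof.
move=> /bounded_operatorP[Tl [C C0 TC]]; apply/bounded_operatorP; split=> [a x y|].
  by rewrite Tl scalerDr !scalerA mulrC.
exists (cabs c * C) => [|x]; first by rewrite mulr_ge0 // nrm_ge0.
by rewrite nrmZ -mulrA ler_wpM2l // nrm_ge0.
Qed.

(** * Spectral components in the von Neumann algebra *)

Section GaugeUnitary.
Variables V V' : H -> H.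
Hypothesis impl : implements V V'.

Let bV : bounded_operator V. Proof. by case: impl => -[]. Qed.
Let bV' : bounded_operator V'. Proof. by case: impl => -[]. Qed.
Let Vl : linear V. Proof. by case: bV. Qed.
Let V'l : linear V'. Proof. by case: bV'. Qed.
Let VK : cancel V V'. Proof. by case: impl. Qed.
Let V'K : cancel V' V. Proof. by case: impl. Qed.

Lemma V_vec a : V (vec a) = vec (gauge S a). Proof. by case: impl. Qed.

Lemma V'_vec a : V' (vec a) = vec (gaugeV a). Proof. by case: impl. Qed.

Lemma V_Omega : V Omega = Omega.
Proof. by rewrite -vec1 V_vec; case: (gauge_hom hS) => _ [->]. Qed.

Lemma V'_Omega : V' Omega = Omega. Proof. by rewrite -{1}V_Omega VK. Qed.

Lemma V_adj : adjoint_of V V'.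
Proof.
move=> xi eta; move: xi.
apply: (GNS_ind) => [u xi uP uxi|xi xi' h h'|_ _ a _].
- have /bounded_operatorP[_ [C _ VC]] := bV.
  apply: (@conv_unique _ R[i]^o _ _ _ (conv_innerl eta (conv_lin Vl VC uxi))).
  by apply: (conv_eventually (N := 0%N)) (conv_innerl (V' eta) uxi) => n _; rewrite uP.
- by rewrite (linD Vl) !innerDl h h'.
move: eta; apply: (GNS_ind) => [u xi uP uxi|xi xi' h h'|_ _ b _].
- have /bounded_operatorP[_ [C _ VC]] := bV'.
  apply: (@conv_unique _ R[i]^o _ _ _ (conv_innerr (V (vec a)) uxi)).
  apply: (conv_eventually (N := 0%N)) (conv_innerr (vec a) (conv_lin V'l VC uxi)) => n _.
  by rewrite uP.
- by rewrite (linD V'l) !innerDr h h'.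
rewrite V_vec V'_vec -!om_inner -[RHS]om_gauge (gaugeM hS) (gauge_star hS).
by rewrite gaugeVK.
Qed.

Lemma V_isometry xi : nrm (V xi) = nrm xi.
Proof. exact: adjoint_isometry V_adj VK xi. Qed.

Lemma V_rho a xi : V (rho a xi) = rho (gauge S a) (V xi).
Proof.
move: xi; apply: (operator_ext (bounded_operator_comp bV (rho_bounded a))
  (bounded_operator_comp (rho_bounded (gauge S a)) bV)) => m n b _ /=.
by rewrite rho_vec !V_vec rho_vec (gaugeM hS).
Qed.

Lemma V'_rho a xi : V' (rho a xi) = rho (gaugeV a) (V' xi).
Proof. by rewrite -{1}[xi]V'K -{1}[a]gaugeVK -V_rho VK. Qed.

Definition gauge_conj X : H -> H := V \o X \o V'.

(** Conjugation by V preserves the image of the representation, hence its commutant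
    and its bicommutant. *)
Lemma vN_M_gauge X : M X -> M (gauge_conj X).
Proof.
move=> MX; apply: commutantI => [|T xi cT].
  by apply/bounded_operator_comp/bV'/bounded_operator_comp/(commutant_bounded MX)/bV.
have cT' : commutant (range rho) (V' \o T \o V).
  apply: commutantI => [|_ eta [a _ <-] /=].
    by apply/bounded_operator_comp/bV/bounded_operator_comp/(commutant_bounded cT)/bV'.
  rewrite V_rho (commutantE _ cT); last by exists (gauge S a).
  by rewrite V'_rho gaugeK.
have := commutantE (V' xi) MX cT'; rewrite /= V'K /gauge_conj /= => ->.
by rewrite V'K.
Qed.

Lemma iter_gauge_conj l X xi :
  iter l gauge_conj X xi = iter l V (X (iter l V' xi)).
Proof. by elim: l xi => [|l IH] xi //=; rewrite /gauge_conj /= IH -iterSr. Qed.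

(** P is the projection onto the eigenspace of V for w^k. *)
Definition spectral k (P : H -> H) : Prop :=
  [/\ bounded_operator P, forall a, P (vec a) = vec (fourier S k a) &
      forall xi, conv (fun n => cesaro V (wc R ^ (- k)) n xi) (P xi)].

Lemma spectral_projection k : exists P, spectral k P.
Proof.
have V_le xi : nrm (V xi) <= nrm xi by rewrite V_isometry.
have ces_vec n a : cesaro V (wc R ^ (- k)) n (vec a)
    = vec (cesaro (gauge S) (wc R ^ (- k)) n a).
  rewrite /cesaro (linZ vec_lin) (lin_sum vec_lin); congr (_ *: _).
  apply: eq_bigr => l _; rewrite (linZ vec_lin); congr (_ *: _).
  by elim: (l : nat) => [|p IH] //=; rewrite IH V_vec.
have [n|n xi|_ [a _ <-]|P [Pl P1 PP]] :=
  strong_limit (T := cesaro V (wc R ^ (- k))) ler01 _ _ vec_dense.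
- exact: cesaro_lin.
- by rewrite mul1r; apply: cesaro_contr => //; exact: cabs_wcX.
- exists (vec (fourier S k a)).
  apply: (conv_eventually (N := 0%N)) (vec_conv (fourier_conv hS k a)) => n _.
  by rewrite ces_vec.
exists P; split=> //; first by apply/bounded_operatorP; split=> //; exists 1.
move=> a; apply: conv_unique (PP (vec a)) _.
apply: (conv_eventually (N := 0%N)) (vec_conv (fourier_conv hS k a)) => n _.
by rewrite ces_vec.
Qed.

Lemma spectral_degree k P xi : spectral k P -> V (P xi) = wc R ^ k *: P xi.
Proof.
move=> [bP Pvec _]; move: xi.
apply: (operator_ext (bounded_operator_comp bV bP) (bounded_operator_scale _ bP)) => m n a _ /=.
by rewrite Pvec V_vec (fourier_degree hS) (linZ vec_lin).
Qed.

Lemma spectral_eigen j k P xi : spectral k P -> V xi = wc R ^ j *: xi ->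
  P xi = if j == k then xi else 0.
Proof.
move=> [_ _ PP] Vxi; apply: conv_unique (PP xi) _.
have := cesaro_eigen_conv Vl (cabs_wcX _ (- k)) Vxi (cabs_wcX _ j).
by rewrite -wcXD wcX_eq1 addrC subr_eq0.
Qed.

(** Let zeta be the difference of eta and its component of degree 0.  The averages
    defining the components of zeta have a constant inner product with an eigenvector
    of the same degree, so zeta is orthogonal to all eigenvectors, which span a dense
    subspace. *)
Lemma degree0_vector (P : int -> H -> H) eta : (forall k, spectral k (P k)) ->
  (forall k, k != 0 -> P k eta = 0) -> V eta = eta.
Proof.
move=> Pk eta0; have V0 := spectral_degree eta (Pk 0).
rewrite expr0z scale1r in V0; suff -> : eta = P 0 eta by [].
apply/eqP; rewrite -subr_eq0; apply/eqP; set zeta := eta - _.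
have Pz k : P k zeta = 0.
  have [bP _ _] := Pk k; rewrite (linB (let: conj l _ := bP in l)).
  have -> : P k (P 0 eta) = if 0 == k then P 0 eta else 0.
    by apply: spectral_eigen (Pk k) _; rewrite expr0z scale1r.
  by have [<-|k0] := eqVneq 0 k; rewrite ?subrr // eta0 ?subrr // eq_sym.
have orth k xi : V xi = wc R ^ k *: xi -> inner zeta xi = 0.
  move=> Vxi; have [_ _ /(_ zeta) Pc] := Pk k; rewrite Pz in Pc.
  have inn l : (wc R ^ (- k)) ^+ l * inner (iter l V zeta) xi = inner zeta xi.
    elim: l => [|l IH]; first by rewrite expr0 mul1r.
    have := congr1 (fun v => inner (V (iter l V zeta)) v) Vxi.
    rewrite V_adj VK innerZr wcX_conj => IH'; rewrite exprS iterS.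
    by rewrite mulrC mulrA (mulrC _ (wc R ^ (- k))) -IH' mulrC.
  have := conv_innerl xi Pc; rewrite inner0l; apply: conv_unique.
  apply: (conv_eventually (N := 0%N)) (conv_cst _) => n _; rewrite /cesaro innerZl.
  have sum_l : inner (\sum_(l < n.+1) (wc R ^ (- k)) ^+ l *: iter l V zeta) xi
      = \sum_(l < n.+1) inner zeta xi.
    rewrite (big_morph (fun z => inner z xi) (fun p q => innerDl p q xi) (inner0l xi)).
    by apply: eq_bigr => l _; rewrite innerZl inn.
  rewrite sum_l sumr_const card_ord -[inner zeta xi *+ _]mulr_natl mulKf // pnatr_eq0 //.
apply: inner_ext => xi; rewrite inner0l; move: xi.
apply: (GNS_ind) => [u xi uP uxi|xi xi' h h'|m n a ga].
- apply: (@conv_unique _ R[i]^o _ _ _ (conv_innerr zeta uxi)).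
  by apply: (conv_eventually (N := 0%N)) (conv_cst _) => n _; rewrite uP.
- by rewrite innerDr h h' addr0.
by apply: orth; rewrite V_vec (gspan_degree hS ga) (linZ vec_lin).
Qed.

(** The averages of w^(-kl) V^l X V'^l belong to M and are bounded by the norm of X.
    They converge at eigenvectors of V, hence strongly. *)
Lemma component_exists k P X : spectral k P -> M X -> exists Xk,
  [/\ M Xk, Xk Omega = P (X Omega) & gauge_conj Xk = fun xi => wc R ^ k *: Xk xi].
Proof.
move=> Pk MX; have [Xl [C C0 XC]] : linear X /\ exists2 C : R, 0 <= C & bounded_by C X.
  exact/bounded_operatorP/(commutant_bounded MX).
have /choice[Q Qs] j : exists P, spectral j P by exact: spectral_projection.
pose T n xi := (n.+1%:R^-1 : R[i]) *:
  \sum_(l < n.+1) (wc R ^ (- k)) ^+ l *: iter l gauge_conj X xi.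
have Mit l : M (iter l gauge_conj X) by elim: l => // l IH; exact: vN_M_gauge.
have M0 : M (fun=> 0 : H).
  have := vN_M_lin (-1) MX MX; congr M; apply/funext => xi; by rewrite scaleN1r addNr.
have MT n : M (T n).
  have Ms p : M (fun xi => \sum_(l < p) (wc R ^ (- k)) ^+ l *: iter l gauge_conj X xi).
    elim: p => [|p IH].
      by congr M: M0; apply/funext => xi; rewrite big_ord0.
    have := vN_M_lin ((wc R ^ (- k)) ^+ p) (Mit p) IH; congr M.
    by apply/funext => xi; rewrite big_ord_recr addrC.
  have := vN_M_lin (n.+1%:R^-1) (Ms n.+1) M0; congr M.
  by apply/funext => xi; rewrite addr0.
have V_le xi : nrm (V xi) <= nrm xi by rewrite V_isometry.
have V'_le xi : nrm (V' xi) <= nrm xi by rewrite -{2}[xi]V'K V_isometry.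
have T_le n : bounded_by C (T n).
  move=> xi; rewrite nrmZ cabs_natV ler_pdivrMl ?ltr0Sn //.
  apply: le_trans (nrm_sum _ _ _) _.
  apply: le_trans (_ : \sum_(l < n.+1) C * nrm xi <= _).
    apply: ler_sum => l _; rewrite nrmZ cabsX cabs_wcX expr1n mul1r iter_gauge_conj.
    apply: le_trans (iter_contr V_le l _) _.
    apply: le_trans (XC _) _; rewrite ler_wpM2l //; exact: iter_contr V'_le l xi.
  by rewrite sumr_const card_ord mulr_natl.
(* On a vector of degree j these means are Cesaro means of V at X xi. *)
have T_eigen j n xi : V' xi = wc R ^ (- j) *: xi ->
    T n xi = cesaro V (wc R ^ (- (k + j))) n (X xi).
  move=> V'xi; rewrite /T /cesaro; congr (_ *: _); apply: eq_bigr => l _.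
  rewrite iter_gauge_conj (iter_eigen V'l l V'xi) (linZ Xl) (linZ (iter_lin Vl l)).
  by rewrite scalerA -exprMn -wcXD opprD.
have V'_gspan m n a : gspan S m n a ->
    V' (vec a) = wc R ^ (- (m%:Z - n%:Z)) *: vec a.
  move=> /(gspan_degree hS) ga; have : V (vec a) = wc R ^ (m%:Z - n%:Z) *: vec a.
    by rewrite V_vec ga (linZ vec_lin).
  move=> /(congr1 V'); rewrite VK (linZ V'l) => E.
  by rewrite {2}E scalerA -wcXD addNr expr0z scale1r.
have T_gspan m n a : gspan S m n a ->
    conv (T^~ (vec a)) (Q (k + (m%:Z - n%:Z)) (X (vec a))).
  move=> ga; have [_ _ /(_ (X (vec a)))] := Qs (k + (m%:Z - n%:Z)).
  by apply: (conv_eventually (N := 0%N)) => p _; rewrite (T_eigen _ _ _ (V'_gspan _ _ _ ga)).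
have Tl n : linear (T n) := vN_M_linear (MT n).
pose Dom := [set xi | exists l, conv (T^~ xi) l].
have dDom : closure Dom = setT.
  apply/seteqP; split=> // xi _; move: xi.
  apply: (GNS_ind) => [u xi uP uxi|xi eta cxi ceta|m n a ga].
  - exact: closed_conv (@closed_closure _ Dom) uP uxi.
  - rewrite -[xi]scale1r; apply: closure_lincomb cxi ceta => c x y [l xl] [l' yl'].
    exists (c *: l + l').
    apply: (conv_eventually (N := 0%N)) (convD (convZ c xl) yl') => n _.
    by rewrite Tl.
  - apply: subset_closure; exists (Q (k + (m%:Z - n%:Z)) (X (vec a))); exact: T_gspan.
have [xi //|Xk [Xkl XkC XkP]] := strong_limit C0 Tl T_le dDom.
have bXk : bounded_operator Xk by apply/bounded_operatorP; split=> //; exists C.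
exists Xk; split.
- by apply: commutant_conv XkP => //; exact: commutant_bounded.
- apply: conv_unique (XkP Omega) _; have [_ _ /(_ (X Omega))] := Pk.
  apply: (conv_eventually (N := 0%N)) => n _.
  by rewrite (T_eigen 0) ?addr0 // V'_Omega oppr0 expr0z scale1r.
- apply/funext; apply: (operator_ext (bounded_operator_comp (bounded_operator_comp bV bXk) bV')
    (bounded_operator_scale _ bXk)) => m n a ga /=.
  rewrite (V'_gspan _ _ _ ga) (linZ Xkl) (linZ Vl).
  rewrite (conv_unique (XkP (vec a)) (T_gspan _ _ _ ga)) (spectral_degree _ (Qs _)).
  by rewrite scalerA -wcXD; congr (_ ^ _ *: _); lia.
Qed.

Definition gdegree k X : Prop := gauge_conj X = fun xi => wc R ^ k *: X xi.

Lemma gdegreeE k X : gdegree k X -> forall xi, V (X (V' xi)) = wc R ^ k *: X xi.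
Proof. by move=> Xk xi; rewrite -[RHS]/((fun xi => wc R ^ k *: X xi) xi) -Xk. Qed.

Lemma gdegree_comp j k X Y : bounded_operator X -> gdegree j X -> gdegree k Y ->
  gdegree (j + k) (X \o Y).
Proof.
move=> [Xl _] /gdegreeE Xj /gdegreeE Yk; apply/funext => xi; rewrite /gauge_conj /=.
by rewrite -[Y _]VK Yk (linZ V'l) (linZ Xl) (linZ Vl) Xj scalerA wcXD mulrC.
Qed.

Lemma gdegree_adjoint k X X' : adjoint_of X X' -> gdegree k X -> gdegree (- k) X'.
Proof.
move=> XX' /gdegreeE Xk; apply/esym.
apply: (@adjoint_unique _ _ (gauge_conj X)) => xi eta.
  by rewrite /gauge_conj /= Xk innerZl XX' innerZr wcX_conj opprK.
by rewrite /gauge_conj /= V_adj XX' (adjoint_sym V_adj) /=.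
Qed.

Lemma gdegree_Omega k X : gdegree k X -> V (X Omega) = wc R ^ k *: X Omega.
Proof. by move=> /gdegreeE/(_ Omega); rewrite V'_Omega. Qed.

Lemma spectral_contr k P xi : spectral k P -> nrm (P xi) <= nrm xi.
Proof.
move=> [_ _ PP]; apply: conv_le (PP xi) _ => n; apply: cesaro_contr.
  by move=> x; rewrite V_isometry.
exact: cabs_wcX.
Qed.

(** Apply the projection of degree k to an approximation by arbitrary vectors. *)
Lemma degree_approx k eta : V eta = wc R ^ k *: eta -> exists2 u : nat -> A,
  (forall n, degree S k (u n)) & conv (fun n => vec (u n)) eta.
Proof.
move=> Veta; have [P Pk] := spectral_projection k; have [bP Pvec _] := Pk.
have /closure_seq[v vr veta] : closure (range vec) eta by rewrite vec_dense.
have /choice[c cv] n : exists c, vec c = v n by have [c _ <-] := vr n; exists c.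
exists (fun n => fourier S k (c n)) => [n|]; first exact: fourier_degree.
have [Pl [C _ PC]] : linear P /\ exists2 C : R, 0 <= C & bounded_by C P.
  exact/bounded_operatorP.
have := conv_lin Pl PC veta; rewrite (spectral_eigen Pk Veta) eqxx.
by apply: (conv_eventually (N := 0%N)) => n _; rewrite -cv Pvec.
Qed.

(** This is the KMS relation for a and its adjoint. *)
Lemma nrm_vec_star k a : degree S k%:Z a ->
  nrm (vec a) = Num.sqrt d%:R ^+ k * nrm (vec (star a)).
Proof.
move=> ak; apply/eqP; rewrite -(@eqrXn2 _ 2) ?mulr_ge0 ?exprn_ge0 ?sqrtr_ge0 ?nrm_ge0 //.
rewrite exprMn exprAC sqr_sqrtr //; apply/eqP/complexI.
rewrite -om_sqr [RHS](rmorphM (real_complex R)) /= -om_sqr starK rmorphXn rmorph_nat.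
by have := vN_M_kms ak (vN_M_rho (star a)); rewrite -!/(vec _) !rho_vec.
Qed.

(** The vector Z' Omega is tested against vec b with b of degree -k.  The KMS relation
    turns the inner product into that of Z Omega and vec (b^* ), whose norm is
    d^(k/2) |vec b|. *)
Lemma vN_M_adjoint_nrm (k : nat) Z Z' : M Z -> adjoint_of Z Z' ->
  V (Z' Omega) = wc R ^ (- k%:Z) *: Z' Omega ->
  Num.sqrt d%:R ^+ k * nrm (Z' Omega) <= nrm (Z Omega).
Proof.
move=> MZ ZZ' Z'k; set r := Num.sqrt d%:R; set eta := Z' Omega.
have r0 : 0 < r by rewrite sqrtr_gt0 ltr0n (ltnW d_gt1).
have rk0 : 0 < r ^+ k by exact: exprn_gt0.
have r2 : r ^+ k * r ^+ k = (d%:R ^+ k : R) by rewrite -exprMn -expr2 sqr_sqrtr.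
have bound b : degree S (- k%:Z) b ->
    cabs (inner (vec b) eta) <= nrm (Z Omega) / r ^+ k * nrm (vec b).
  move=> bk; have bk' := degree_star hS bk; rewrite opprK in bk'.
  rewrite -ZZ' (vN_M_kms bk MZ) cabsM.
  have -> : cabs (D ^ (- k%:Z)) = (d%:R ^+ k)^-1 :> R.
    rewrite -exprnN cabsV cabsX; congr (_ ^+ _)^-1.
    by rewrite -(rmorph_nat (real_complex R)) cabs_real.
  have -> : inner (rho b (Z Omega)) Omega = inner (Z Omega) (vec (star b)).
    exact: rho_adj.
  have := cauchy_schwarz (Z Omega) (vec (star b)).
  rewrite (nrm_vec_star bk') starK -/r => cs.
  rewrite mulrC ler_pdivrMr ?exprn_gt0 ?ltr0n ?(ltnW d_gt1) //.
  apply: le_trans cs _; rewrite -r2 -!mulrA ler_wpM2l ?nrm_ge0 //.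
  by rewrite (mulrC (nrm _)) mulrA mulKf ?gt_eqF.
have [u ud ueta] := degree_approx Z'k.
have C0 : 0 <= nrm (Z Omega) / r ^+ k by rewrite divr_ge0 ?nrm_ge0 // ltW.
have := @conv_nrm_le _ _ R[i]^o _ _ _ _ _ C0 ueta (conv_innerl eta ueta) (fun n => bound _ (ud n)).
rewrite -/eta innerxx -[X in X <= _]/(cabs _) cabs_real ?sqr_ge0 // => h.
rewrite mulrC -ler_pdivlMr //.
have := nrm_ge0 eta; rewrite le_eqVlt => /predU1P[<- //|eta0].
by rewrite -(ler_pM2r eta0) -expr2.
Qed.

(** Choose b in the core with vec b close to Y Omega.  Then b^* is equally good for Y',
    because adjunction is contractive in degree 0, and the differences Y - b and
    Y' - b^* are small on all vectors of words.  As T commutes with b, it commutes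
    with Y in the weak sense between such vectors, up to a small error. *)
Lemma vN_N_degree0 Y Y' : M Y -> M Y' -> adjoint_of Y Y' -> V (Y Omega) = Y Omega ->
  V (Y' Omega) = Y' Omega -> vN_N S rho Y.
Proof.
move=> MY MY' YY' Y0 Y'0; apply: commutantI (commutant_bounded MY) _ => T xi cT.
have /bounded_operatorP[Tl [C C0 TC]] := commutant_bounded cT.
have YT : bounded_operator (Y \o T).
  exact: bounded_operator_comp (commutant_bounded MY) (commutant_bounded cT).
have TY : bounded_operator (T \o Y).
  exact: bounded_operator_comp (commutant_bounded cT) (commutant_bounded MY).
move: xi; apply: (operator_ext YT TY) => m n a ga /=; apply: inner_ext => zeta; move: zeta.
apply: (GNS_ind) => [u z uP uz|z z' h h'|m' n' a' ga'].
- apply: (@conv_unique _ R[i]^o _ _ _ (conv_innerr _ uz)).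
  by apply: (conv_eventually (N := 0%N)) (conv_innerr _ uz) => p _; rewrite uP.
- by rewrite !innerDr h h'.
have [C1 C10 hC1] := vN_M_vec_bound ga; have [C2 C20 hC2] := vN_M_vec_bound ga'.
apply/eqP; rewrite -subr_eq0; apply/eqP.
apply: (@nrm_small_eq0 R R[i]^o) => e e0; rewrite -[nrm _]/(cabs _).
pose K := nrm (T (vec a)) * C2 + C * C1 * nrm (vec a') + 1.
have K0 : 0 < K by rewrite ltr_wpDl // addr_ge0 // !mulr_ge0 // nrm_ge0.
have /degree_approx[u ud uY] : V (Y Omega) = wc R ^ 0 *: Y Omega.
  by rewrite expr0z scale1r.
have [N /(_ N (leqnn N))] := uY _ (divr_gt0 e0 K0); move: (u N) (ud N) => b b0 bY.
pose Z := fun xi => (-1 : R[i]) *: rho b xi + Y xi.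
pose Z' := fun xi => (-1 : R[i]) *: rho (star b) xi + Y' xi.
have MZ : M Z by exact: vN_M_lin (vN_M_rho b) MY.
have MZ' : M Z' by exact: vN_M_lin (vN_M_rho (star b)) MY'.
have ZZ' : adjoint_of Z Z'.
  move=> x y; rewrite /Z /Z' innerDl innerDr innerZl innerZr (rho_adj b) YY'.
  by rewrite rmorphN1.
have Z_lt : nrm (Z Omega) < e / K.
  by rewrite /Z scaleN1r addrC nrmB.
have Z'_lt : nrm (Z' Omega) <= nrm (Z Omega).
  have := @vN_M_adjoint_nrm 0 Z Z' MZ ZZ'; rewrite expr0 mul1r oppr0 expr0z scale1r.
  apply; rewrite /Z' (linD Vl) (linZ Vl) Y'0 -/(vec _) V_vec.
  by have := degree_star hS b0; rewrite /degree oppr0 expr0z scale1r => ->.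
have -> : inner (Y (T (vec a))) (vec a') - inner (T (Y (vec a))) (vec a')
    = inner (T (vec a)) (Z' (vec a')) - inner (T (Z (vec a))) (vec a').
  have cb : core S b by apply/(degree0_core hS).
  have Tb xi : T (rho b xi) = rho b (T xi) by apply: commutantE cT _; exists b.
  rewrite /Z /Z' Tl innerDl innerZl innerDr innerZr -YY' -(rho_adj b) Tb rmorphN1.
  by rewrite !mulN1r opprD opprK addrACA addNr add0r.
have ZC1 := hC1 _ MZ; have ZC2 := hC2 _ MZ'.
apply: le_trans (nrmD _ _) _; rewrite nrmN -!/(cabs _).
rewrite -[leRHS](divfK (lt0r_neq0 K0)) {2}/K.
have := cauchy_schwarz (T (vec a)) (Z' (vec a')).
have := cauchy_schwarz (T (Z (vec a))) (vec a').
have := TC (Z (vec a)).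
move: Z_lt Z'_lt ZC1 ZC2; set q := e / _.
move: (nrm_ge0 (T (vec a))) (nrm_ge0 (vec a')) (nrm_ge0 (Z Omega)) (nrm_ge0 (Z' Omega)).
move: (nrm_ge0 (Z (vec a))) (nrm_ge0 (Z' (vec a'))).
set t := nrm (T (vec a)); set v' := nrm (vec a'); set z := nrm (Z Omega).
set z' := nrm (Z' Omega); set p := nrm (Z (vec a)); set p' := nrm (Z' (vec a')).
set s := nrm (T (Z (vec a))) => p0 p'0 t0 v0 z0 z'0 zq z'z pz p'z sp i1 i2.
have j1 : t * p' <= t * C2 * q.
  by rewrite -mulrA ler_wpM2l // (le_trans p'z) // ler_wpM2l // (le_trans z'z) // ltW.
have j2 : s * v' <= C * C1 * v' * q.
  rewrite [leRHS]mulrAC; apply: ler_wpM2r => //; apply: le_trans sp _; rewrite -mulrA.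
  apply: ler_wpM2l => //; apply: le_trans pz _; apply: ler_wpM2l => //; exact: ltW.
have q0 : 0 < q by apply: le_lt_trans z0 zq.
have -> : q * (t * C2 + C * C1 * v' + 1) = t * C2 * q + C * C1 * v' * q + q by ring.
by apply: le_trans (lerD i2 i1) _; apply: le_trans (lerD j1 j2) _; rewrite lerDl ltW.
Qed.

(** * Fixed points in the von Neumann algebra *)

Section FixedPoints.
Variables (u : A) (L : (H -> H) -> H -> H).
Hypotheses (u_core : core S u) (u_unitary : unitary u).
Hypothesis L_ext : is_normal_extension S rho Omega u L.
Local Notation lam := (cuntz_endo S u).

Let L_M X : M X -> M (L X). Proof. by case: L_ext => -[h _ _ _] _ _ _ _; exact: h. Qed.

Let L_lin (c : R[i]) X Y : M X -> M Y ->
  L (fun xi => c *: X xi + Y xi) = (fun xi => c *: L X xi + L Y xi).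
Proof. by case: L_ext => -[_ h _ _] _ _ _ _; exact: h. Qed.

Let L_comp X Y : M X -> M Y -> L (X \o Y) = L X \o L Y.
Proof. by case: L_ext => -[_ _ h _] _ _ _ _; exact: h. Qed.

Let L_adj X Y : M X -> M Y -> adjoint_of X Y -> adjoint_of (L X) (L Y).
Proof. by case: L_ext => -[_ _ _ h] _ _ _ _; exact: h. Qed.

Let L_rho a : L (rho a) = rho (lam a). Proof. by case: L_ext. Qed.

Lemma L_nrm X : M X -> nrm (L X Omega) = nrm (X Omega).
Proof.
move=> MX; have [X' MX' XX'] := vN_M_adjoint MX.
have L_state : inner (L (X' \o X) Omega) Omega = inner ((X' \o X) Omega) Omega.
  by case: L_ext => _ _ _ h _; apply: h; exact: vN_M_comp.
apply/eqP; rewrite -(@eqrXn2 _ 2) ?nrm_ge0 //; apply/eqP/complexI; rewrite -!innerxx.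
rewrite (L_adj MX MX' XX') XX' inner_conj [RHS]inner_conj; congr conjc.
by rewrite -L_state L_comp.
Qed.

Lemma L_dist X Y : M X -> M Y -> nrm (L X Omega - L Y Omega) = nrm (X Omega - Y Omega).
Proof.
move=> MX MY; have := L_nrm (vN_M_lin (-1) MY MX); rewrite L_lin //.
by rewrite !scaleN1r addrC [- _ + _]addrC.
Qed.

(** L is isometric on the vectors X Omega because it preserves the vector state, and
    it extends lambda, which commutes with the component maps of the Cuntz algebra.
    Approximating X Omega by some vec c therefore gives L Xk Omega = Xk Omega, and
    Omega separates M. *)
Lemma L_component k P X Xk : spectral k P -> M X -> L X = X -> M Xk ->
  Xk Omega = P (X Omega) -> L Xk = Xk.
Proof.
move=> Pk MX LX MXk XkO; apply: vN_M_eq => //; first exact: L_M.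
have [[Pl _] Pvec _] := Pk.
apply/eqP; rewrite -subr_eq0; apply/eqP/nrm_small_eq0 => e e0.
have e2 : 0 < e / 2 by rewrite divr_gt0.
have /closure_nrmP/(_ _ e2)[_ [c _ <-] cX] : closure (range vec) (X Omega).
  by rewrite vec_dense.
have lamc : vec (lam (fourier S k c)) = P (vec (lam c)).
  rewrite Pvec (fourier_commute hS k (lam_hom hS u_unitary)) //.
  exact: lam_gauge.
have i1 : nrm (vec (fourier S k c) - Xk Omega) < e / 2.
  by rewrite XkO -Pvec -(linB Pl); exact: le_lt_trans (spectral_contr _ Pk) cX.
have := L_dist (vN_M_rho (fourier S k c)) MXk; rewrite L_rho -!/(vec _) lamc => i2.
have := L_dist (vN_M_rho c) MX; rewrite L_rho LX -!/(vec _) => i3.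
have i4 : nrm (P (vec (lam c)) - Xk Omega) < e / 2.
  by rewrite XkO -(linB Pl); apply: le_lt_trans (spectral_contr _ Pk) _; rewrite i3.
have := nrm_dist (L Xk Omega) (P (vec (lam c))) (Xk Omega).
rewrite (nrmB (L Xk Omega) (P _)) i2; lra.
Qed.

Hypothesis N_fixed : fixed_points (vN_N S rho) L = operator_scalars H.

(** Such a Y belongs to N, where the hypothesis applies. *)
Lemma fixed_degree0_scalar Y Y' : M Y -> M Y' -> adjoint_of Y Y' -> gdegree 0 Y ->
  L Y = Y -> exists c : R[i], forall xi, Y xi = c *: xi.
Proof.
move=> MY MY' YY' Y0 LY.
have Y'0 := gdegree_adjoint YY' Y0; rewrite oppr0 in Y'0.
have /gdegree_Omega := Y0; have /gdegree_Omega := Y'0; rewrite expr0z !scale1r => h' h.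
have : fixed_points (vN_N S rho) L Y by split=> //; exact: vN_N_degree0 h h'.
by rewrite N_fixed => -[c _ <-]; exists c.
Qed.

Lemma L_adjoint_fixed X X' : M X -> M X' -> adjoint_of X X' -> L X = X -> L X' = X'.
Proof.
move=> MX MX' XX' LX; apply: (adjoint_unique _ XX').
by have := L_adj MX MX' XX'; rewrite LX.
Qed.

(** The operators X' X and X X' are scalars, equal as soon as X Omega <> 0; so
    X Omega and X' Omega have the same norm, against [vN_M_adjoint_nrm]. *)
Lemma fixed_positive_degree (k : nat) X : (0 < k)%N -> M X -> gdegree k%:Z X ->
  L X = X -> X Omega = 0.
Proof.
move=> k0 MX Xk LX; have [X' MX' XX'] := vN_M_adjoint MX.
have X'X := adjoint_sym XX'; have X'k := gdegree_adjoint XX' Xk.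
have LX' := L_adjoint_fixed MX MX' XX' LX.
have bX := commutant_bounded MX; have bX' := commutant_bounded MX'.
have [|||c Xc] := @fixed_degree0_scalar (X' \o X) (X' \o X) (vN_M_comp MX' MX) (vN_M_comp MX' MX).
- exact: adjoint_comp.
- by rewrite -(addNr k%:Z); exact: gdegree_comp.
- by rewrite L_comp // LX LX'.
have [|||c' Xc'] := @fixed_degree0_scalar (X \o X') (X \o X') (vN_M_comp MX MX') (vN_M_comp MX MX').
- exact: adjoint_comp.
- by rewrite -(subrr k%:Z); exact: gdegree_comp.
- by rewrite L_comp // LX LX'.
have [//|XO] := eqVneq (X Omega) 0.
have cc : c = c'.
  have : (c - c') *: X Omega = 0.
    rewrite scalerBl -(Xc' (X Omega)) /= -[X' (X Omega)]/((X' \o X) Omega) Xc.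
    by rewrite (linZ (vN_M_linear MX)) subrr.
  by move=> /eqP; rewrite scaler_eq0 (negPf XO) orbF subr_eq0 => /eqP.
have XX'n : nrm (X' Omega) = nrm (X Omega).
  apply/eqP; rewrite -(@eqrXn2 _ 2) ?nrm_ge0 //; apply/eqP/complexI; rewrite -!innerxx.
  rewrite XX' X'X -[X (X' _)]/((X \o X') Omega) -[X' (X _)]/((X' \o X) Omega).
  by rewrite Xc Xc' cc.
have := vN_M_adjoint_nrm MX XX' (gdegree_Omega X'k); rewrite XX'n.
set r := Num.sqrt _; set q := nrm _ => rq.
have [/nrm_eq0 //|q0] := eqVneq q 0; exfalso.
have {}q0 : 0 < q by rewrite lt_neqAle eq_sym q0 nrm_ge0.
have r0 : 0 <= r by exact: sqrtr_ge0.
have rk : r ^+ k <= 1 by rewrite -(ler_pM2r q0) mul1r.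
have : (r ^+ k) ^+ 2 <= 1 by rewrite exprn_ile1 // exprn_ge0.
rewrite exprAC sqr_sqrtr // -natrX lern1 leqNgt -(exp1n k) ltn_exp2r //.
by rewrite d_gt1.
Qed.

Lemma fixed_nonzero_degree k X : k != 0 -> M X -> gdegree k X -> L X = X -> X Omega = 0.
Proof.
case: k => [[//|n]|n] _ MX Xk LX; first exact: fixed_positive_degree Xk LX.
have [X' MX' XX'] := vN_M_adjoint MX.
have X'k : gdegree n.+1%:Z X'.
  by have := gdegree_adjoint XX' Xk; rewrite NegzE opprK.
have X'0 := fixed_positive_degree (ltn0Sn n) MX' X'k (L_adjoint_fixed MX MX' XX' LX).
apply: inner_ext => z; rewrite XX' inner0l.
by rewrite (vN_M_separating MX' X'0) inner0r.
Qed.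

Lemma von_neumann_fixed_points : fixed_points (vN_M rho) L = operator_scalars H.
Proof.
have /choice[P Ps] k : exists P, spectral k P by exact: spectral_projection.
apply/seteqP; split=> [X [MX LX]|X Xs]; last first.
  have : fixed_points (vN_N S rho) L X by rewrite N_fixed.
  move=> [NX LX]; split=> //; move: X NX {LX Xs}.
  by apply: commutantS; apply: commutantS => _ [a _ <-]; exists a.
have zero k : k != 0 -> P k (X Omega) = 0.
  move=> k0; have [Xk [MXk XkO Xkd]] := component_exists (Ps k) MX.
  have LXk := L_component (Ps k) MX LX MXk XkO.
  by rewrite -XkO; exact: (fixed_nonzero_degree k0 MXk Xkd LXk).
have V0 := degree0_vector Ps zero.
have [X0 [MX0 X0O X0d]] := component_exists (Ps 0) MX.
have X0X : X0 = X.
  apply: vN_M_eq => //; rewrite X0O.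
  have V0' : V (X Omega) = wc R ^ 0 *: X Omega by rewrite expr0z scale1r.
  by rewrite (spectral_eigen (Ps 0) V0') eqxx.
rewrite X0X in X0d; have [X' MX' XX'] := vN_M_adjoint MX.
have [c Xc] := fixed_degree0_scalar MX MX' XX' X0d LX.
by exists c => //; apply/funext => xi; rewrite Xc.
Qed.

End FixedPoints.

End GaugeUnitary.

End TracialGNS.

(** * The theorem *)

(** Without a normalized trace [core_trace] is the zero functional, so Omega = 0. *)
Lemma GNS_no_trace (R : realType) (d : nat) (A : cstarAlgType R) (S : 'I_d -> A)
    (H : hilbertType R) (rho : A -> H -> H) (Omega : H) :
  is_GNS (omega S) rho Omega -> ~ (exists t, is_normalized_trace S t) ->
  forall xi : H, xi = 0.
Proof.
move=> [[rb _ _ r1 _] om_vec dense] no_trace.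
have om0 a : omega S a = 0.
  rewrite /omega /core_trace; case: xgetP => // t _ ht.
  by case: no_trace; exists t.
have Omega0 : Omega = 0.
  have := om_vec 1; rewrite om0 r1 innerxx => /(@complexI R _ _)/esym/eqP.
  by rewrite sqrf_eq0 => /eqP/nrm_eq0.
move=> xi; apply: nrm_small_eq0 => e e0.
have /closure_nrmP/(_ e e0)[_ [a _ <-]] : closure (range (fun a => rho a Omega)) xi.
  by rewrite dense.
by rewrite Omega0 (lin0 (rb a).1) sub0r nrmN => /ltW.
Qed.

Theorem proposition7p3 (R : realType) (d : nat) (hd : (2 <= d)%N)
    (A : cstarAlgType R) (S : 'I_d -> A) (hS : is_cuntz_algebra S)
    (U : A) (hUF : core S U) (hU : unitary U) :
  (fixed_points (core S) (cuntz_endo S U) = scalars A ->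
   fixed_points [set: A] (cuntz_endo S U) = scalars A)
  /\
  (forall (H : hilbertType R) (rho : A -> H -> H) (Omega : H)
          (L : (H -> H) -> H -> H),
     is_GNS (omega S) rho Omega ->
     is_normal_extension S rho Omega U L ->
     fixed_points (vN_N S rho) L = operator_scalars H ->
     fixed_points (vN_M rho) L = operator_scalars H).
Proof.
split; first exact: cuntz_fixed_points.
move=> H rho Omega L gns L_ext N_fixed.
case: (pselect (exists t, is_normalized_trace S t)) => [tr|no_trace].
  have {}tr : is_normalized_trace S (core_trace S) by exact: xgetPex tr.
  have [V [V' impl]] := implements_exists hS gns tr.
  exact: (von_neumann_fixed_points hd hS gns tr impl hUF hU L_ext N_fixed).
have H0 := GNS_no_trace gns no_trace.
have all_eq (X Y : H -> H) : X = Y.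
  by apply/funext => xi; rewrite (H0 (X xi)) (H0 (Y xi)).
have [X NX] : fixed_points (vN_N S rho) L !=set0.
  by rewrite N_fixed; exists (fun xi => 0 *: xi); exists 0.
apply/seteqP; split=> [Y _|Y _]; first by exists 0 => //; exact: all_eq.
have -> : Y = id by exact: all_eq.
split; last exact: all_eq.
have [[_ _ _ r1 _] _ _] := gns; rewrite -r1.
exact: vN_M_rho gns 1.
Qed.
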